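(* (a) Let $a,b,c\in C(\mathbb{R}^+)$ and let $y\not\equiv0$ be a solution of $\dddot y+a(t)\ddot y+b(t)\dot y+c(t)y=0$ on $\mathbb{R}^+$. Then $$\hat\mu_3(y)\ge\frac{L_\Omega}{2\pi}\hat\nu(y),\qquad \check\mu_3(y)\ge\frac{L_\Omega}{2\pi}\check\nu(y).$$ (b) For every $\varepsilon>0$ there exist smooth functions $a,b,c$ on $\mathbb{R}^+$ and a smooth function $y$ satisfying $\dddot y+a(t)\ddot y+b(t)\dot y+c(t)y=0$ on $\mathbb{R}^+$, for which the exact zero frequency $\nu(y)$ and the exact wandering speed $\mu_3(y)$ exist and $\mu_3(y)<\left(\frac{L_\Omega}{2\pi}+\varepsilon\right)\nu(y)$.
   Context: For a solution $y$, $\nu(y,t)$ is the number of zeros of $y$ on $[0,t]$; the lower and upper zero frequencies are $\check\nu(y)=\liminf_{t\to\infty}\frac{\pi}{t}\nu(y,t)$ and $\hat\nu(y)=\limsup_{t\to\infty}\frac{\pi}{t}\nu(y,t)$, and if they coincide their common value is the exact zero frequency $\nu(y)$. With $x(\tau)=(y,\dot y,\ddot y)(\tau)$ and $\gamma_3(y,t)=\int_0^t\left|\frac{d}{d\tau}\frac{x(\tau)}{|x(\tau)|}\right|d\tau$, the lower and upper wandering speeds are $\check\mu_3(y)=\liminf_{t\to\infty}\frac{1}{t}\gamma_3(y,t)$ and $\hat\mu_3(y)=\limsup_{t\to\infty}\frac1t\gamma_3(y,t)$; if they coincide their common value is the exact wandering speed $\mu_3(y)$. $L_\Omega$ is the length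 of the boundary (on the unit sphere $S^2$) of $\Omega_+=\{(x_0,x_1,x_2)\in S^2: x_0x_2-x_1^2>0,\ x_2>0\}$; explicitly $L_\Omega=4\int_0^\pi\frac{\sqrt{5-\cos\alpha}}{7+\cos\alpha}d\alpha$. *)

(* Defs.v *)
From Stdlib Require Import Reals List.
From Coquelicot Require Import Coquelicot.
Open Scope R_scope.

Definition Liminf_infty (g : R -> Rbar) : Rbar :=
  Rbar_lub (fun m => exists T : R, m = Rbar_glb (fun v => exists t, T <= t /\ v = g t)).
Definition Limsup_infty (g : R -> Rbar) : Rbar :=
  Rbar_glb (fun m => exists T : R, m = Rbar_lub (fun v => exists t, T <= t /\ v = g t)).

Definition cont_Rplus (f : R -> R) : Prop :=
  (forall t, 0 < t -> continuous f t) /\ filterlim f (at_right 0) (locally (f 0)).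

Definition deriv_Rplus (f f' : R -> R) : Prop :=
  (forall t, 0 < t -> is_derive f t (f' t)) /\
  filterlim (fun h => (f h - f 0) / h) (at_right 0) (locally (f' 0)).

Definition smooth_Rplus (f : R -> R) : Prop :=
  forall (n : nat) (t : R), 0 <= t -> ex_derive_n f n t.

Definition nu_count (y : R -> R) (t : R) : Rbar :=
  Rbar_lub (fun m => exists l : list R, NoDup l /\
     (forall s, In s l -> 0 <= s <= t /\ y s = 0) /\ m = Finite (INR (length l))).

Definition nu_lower (y : R -> R) : Rbar :=
  Liminf_infty (fun t => Rbar_mult (Finite (PI / t)) (nu_count y t)).
Definition nu_upper (y : R -> R) : Rbar :=
  Limsup_infty (fun t => Rbar_mult (Finite (PI / t)) (nu_count y t)).

(** x = (y, y1, y2) with y1 = y', y2 = y''; gamma_3 = length of the path x/|x| on S^2. *)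
Definition xnorm (y y1 y2 : R -> R) (s : R) : R :=
  sqrt (y s ^ 2 + y1 s ^ 2 + y2 s ^ 2).
Definition gamma3 (y y1 y2 : R -> R) (t : R) : R :=
  RInt (fun tau =>
    sqrt ((Derive (fun s => y s / xnorm y y1 y2 s) tau) ^ 2
        + (Derive (fun s => y1 s / xnorm y y1 y2 s) tau) ^ 2
        + (Derive (fun s => y2 s / xnorm y y1 y2 s) tau) ^ 2)) 0 t.

Definition mu3_lower (y y1 y2 : R -> R) : Rbar :=
  Liminf_infty (fun t => Finite (gamma3 y y1 y2 t / t)).
Definition mu3_upper (y y1 y2 : R -> R) : Rbar :=
  Limsup_infty (fun t => Finite (gamma3 y y1 y2 t / t)).

Definition L_Omega : R :=
  4 * RInt (fun al => sqrt (5 - cos al) / (7 + cos al)) 0 PI.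

(* Main.v *)
Require Import Defs.
From Stdlib Require Import Reals List.
From Coquelicot Require Import Coquelicot.
From Stdlib Require FinFun.
From Stdlib Require Import ZArith Lra Lia Psatz Classical FunctionalExtensionality.
Open Scope R_scope.

(** Let [x = (y, y', y'')] and [l = y'/y].  Since [l' = y''/y - l^2], the longitude [l] can
    decrease only while [x] is outside the cone [Omega], and between two zeros of [y] it has to
    run from [+oo] to [-oo].  A point outside [Omega] lies on a great circle tangent to the
    boundary of [Omega] at [(1, m, m^2)] with [m >= l]; the sum of the boundary arc up to this
    tangency point and of the distance from it to [x] is the length of a taut string wound
    around [Omega], and it grows no faster than the length of the path of [x/|x|].  Intervals
    with [y < 0] reduce to those with [y > 0] through [y(t) -> - y(-t)].  With a bounded
    potential attached to the zeros, each interval between consecutive zeros costs at least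
    half of the boundary length.

    For sharpness, [y = (1 + eta + cos(t/n))^n - (2 eta)^n] has two zeros per period; when [n]
    is large and then [eta] small, its path follows the boundary of [Omega] except for a short
    loop near its point [(0, 0, 1)]. *)

(* [rewrite] fails on the eta-expanded functions that [auto_derive] leaves under [Derive]. *)
Ltac der_rw := repeat match goal with
  | H : is_derive ?f ?t ?l |- context [Derive ?g ?t] =>
    replace (Derive g t) with l by (symmetry; apply is_derive_unique; exact H)
  end.

(** Why half a boundary per arch: a full turn of the string takes one arch of each sign. An upward
    zero is given the string length with arc term [0], midway between the limits [- L_Omega / 2] and
    [L_Omega / 2] of the arc at the two ends of the range of [y'/y], so each of the two arches is
    charged one half. A double zero has the direction [(0, 0, 1)] or its opposite and fits the same
    accounting, so signs need not alternate. The obstacle is differentiability: the tangency point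
    contains a square root that vanishes on the cone, and an angle is not smooth at parallel
    vectors. Hence string length and arc length are compared through one-sided increments, freezing
    the path and the tangency point in turn. Origin of the family: for [(1 + cos (t / n)) ^ n] the
    longitude is [l = - tan (t / (2 * n))], and [l' = - (1 + l^2) / (2 * n)], so [y''/y = l^2 + l']
    nearly puts the path on the boundary. A positive [eta] lifts the zero of high order, and
    subtracting [(2 * eta) ^ n] cuts two simple zeros next to it. *)

(** * Real-variable tools *)

Lemma real_induction (P : R -> Prop) (a b : R) :
  a <= b -> P a ->
  (forall t, a <= t < b -> P t -> exists d, 0 < d /\ forall s, t < s < t + d -> P s) ->
  (forall t, a < t <= b -> (forall s, a <= s < t -> P s) -> P t) ->
  P b.
Proof.
intros Hab Pa Hr Hl.
set (E := fun x => a <= x <= b /\ forall s, a <= s <= x -> P s).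
destruct (completeness E) as [m [Hub Hlub]].
- exists b. intros x [Hx _]. lra.
- exists a. split; [lra|]. intros s Hs. now replace s with a by lra.
- assert (Ham : a <= m).
  { apply Hub. split; [lra|]. intros s Hs. now replace s with a by lra. }
  assert (Hmb : m <= b) by (apply Hlub; intros x [Hx _]; lra).
  assert (Hlt : forall s, a <= s < m -> P s).
  { intros s Hs. destruct (classic (exists x, E x /\ s < x)) as [[x [[_ Hx] Hsx]]|Hn].
    - apply Hx. lra.
    - exfalso. assert (m <= s); [|lra]. apply Hlub. intros x Ex.
      destruct (Rle_lt_dec x s); [easy|]. exfalso. apply Hn. now exists x. }
  assert (Pm : P m).
  { destruct (Rle_lt_or_eq_dec a m Ham) as [H|H]; [|now subst].
    apply Hl; [lra|assumption]. }
  destruct (Rle_lt_or_eq_dec m b Hmb) as [H|H]; [|now subst].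
  destruct (Hr m) as [d [Hd Hs]]; [lra|assumption|].
  assert (Hx : E (Rmin (m + d / 2) b)).
  { assert (H1 := Rmin_l (m + d/2) b). assert (H2 := Rmin_r (m + d/2) b).
    split; [split; [|assumption]|].
    - apply Rmin_glb; lra.
    - intros s Hs'. destruct (Rtotal_order s m) as [H3|[H3|H3]].
      + apply Hlt; lra. + now subst. + apply Hs; lra. }
  apply Hub in Hx. assert (m < Rmin (m + d/2) b) by (apply Rmin_glb_lt; lra). lra.
Qed.

Lemma nondecreasing_of_derive (f f' : R -> R) (a b : R) :
  a <= b -> (forall t, a <= t <= b -> is_derive f t (f' t)) ->
  (forall t, a <= t <= b -> 0 <= f' t) -> f a <= f b.
Proof.
intros Hab Hd Hp. destruct (Rle_lt_or_eq_dec a b Hab) as [H|H]; [|subst; lra].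
destruct (MVT_cor2 f f' a b H) as [c [Hc Hc']].
- intros c Hc. apply is_derive_Reals, Hd, Hc.
- assert (0 <= f' c * (b - a)) by (apply Rmult_le_pos; [apply Hp|]; lra). lra.
Qed.

(** The derivative of [acos] blows up at the endpoints, so the modulus comes from [cos A - cos B = 2
    sin ((B - A) / 2) sin ((A + B) / 2)]: if [B - A >= e], both half-angles lie in [[e', PI - e']]
    and both sines are at least [sin e']. *)
Lemma acos_uniform (e : R) : 0 < e ->
  exists d, 0 < d /\ forall u v, -1 <= u <= 1 -> -1 <= v <= 1 ->
  Rabs (u - v) < d -> Rabs (acos u - acos v) < e.
Proof.
intros He. assert (Hpi := PI_RGT_0).
set (e' := Rmin e PI / 2).
assert (He' : 0 < e' <= PI / 2).
{ unfold e'. split. - assert (0 < Rmin e PI) by (apply Rmin_glb_lt; lra). lra.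
  - assert (H := Rmin_r e PI). lra. }
assert (Hs : 0 < sin e') by (apply sin_gt_0; lra).
exists (2 * sin e' ^ 2). split; [nra|].
intros u v Hu Hv Huv.
assert (Hle : e' <= e / 2) by (unfold e'; assert (H := Rmin_l e PI); lra).
rewrite <- (cos_acos u Hu), <- (cos_acos v Hv) in Huv.
assert (HA := acos_bound u). assert (HB := acos_bound v).
revert Huv. generalize dependent (acos u). generalize dependent (acos v).
clear u v Hu Hv.
assert (K : forall A B, 0 <= A <= PI -> 0 <= B <= PI -> A <= B ->
  Rabs (cos A - cos B) < 2 * sin e' ^ 2 -> B - A < e).
{ intros A B HA HB HAB H. apply Rnot_le_lt. intros Hbad.
  rewrite form2 in H.
  replace ((A - B) / 2) with (- ((B - A) / 2)) in H by lra.
  rewrite sin_neg in H.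
  assert (S1 : sin e' <= sin ((B - A) / 2)) by (apply sin_incr_1; lra).
  assert (S2 : sin e' <= sin ((A + B) / 2)).
  { destruct (Rle_lt_dec ((A + B) / 2) (PI / 2)).
    - apply sin_incr_1; lra.
    - rewrite <- (sin_PI_x ((A + B) / 2)). apply sin_incr_1; lra. }
  replace (-2 * - sin ((B - A) / 2) * sin ((A + B) / 2))
    with (2 * sin ((B - A) / 2) * sin ((A + B) / 2)) in H by ring.
  rewrite Rabs_pos_eq in H by nra. nra. }
intros B HB A HA H. destruct (Rle_lt_dec A B) as [HAB|HAB].
- rewrite Rabs_minus_sym, Rabs_pos_eq by lra. now apply K.
- rewrite Rabs_pos_eq by lra. apply K; try lra. now rewrite Rabs_minus_sym.
Qed.

Lemma continuous_acos_comp (c : R -> R) (t : R) :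
  continuous c t -> locally t (fun s => -1 <= c s <= 1) ->
  continuous (fun s => acos (c s)) t.
Proof.
intros Hc Hl. apply filterlim_locally. intros e.
destruct (acos_uniform e (cond_pos e)) as [d [Hd H]].
assert (Hc' := proj1 (filterlim_locally c (c t)) Hc (mkposreal d Hd)).
generalize (filter_and _ _ Hc' Hl). apply filter_imp. intros s [H1 H2].
change (Rabs (acos (c s) - acos (c t)) < e). apply H; [assumption| |exact H1].
now apply locally_singleton in Hl.
Qed.

(** * Vectors, angles and spherical speed *)

Definition V3 := (R * R * R)%type.
Definition px (v : V3) : R := fst (fst v).
Definition py (v : V3) : R := snd (fst v).
Definition pz (v : V3) : R := snd v.
Definition dot (a b : V3) : R := px a * px b + py a * py b + pz a * pz b.
Definition cross (a b : V3) : V3 :=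
  (py a * pz b - pz a * py b, pz a * px b - px a * pz b, px a * py b - py a * px b).
(* If [a] or [b] is zero, the division by zero makes this [acos 0]. *)
Definition ang (a b : V3) : R := acos (dot a b / sqrt (dot a a * dot b b)).
Definition speed (x v : V3) : R := sqrt (dot (cross x v) (cross x v)) / dot x x.

Ltac v3 := repeat match goal with a : V3 |- _ => destruct a as [[? ?] ?] end;
  unfold dot, cross, px, py, pz in *; simpl in *.

Lemma lagrange (a b : V3) :
  dot a a * dot b b - dot a b ^ 2 = dot (cross a b) (cross a b).
Proof. v3. ring. Qed.

Lemma binet_cauchy (a b c d : V3) :
  dot (cross a b) (cross c d) = dot a c * dot b d - dot a d * dot b c.
Proof. v3. ring. Qed.

Lemma dot_comm (a b : V3) : dot a b = dot b a.
Proof. v3. ring. Qed.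

Lemma dot_ge0 (a : V3) : 0 <= dot a a.
Proof. v3. nra. Qed.

Lemma dot_pos (a : V3) : px a <> 0 \/ py a <> 0 \/ pz a <> 0 -> 0 < dot a a.
Proof.
v3. assert (Hs : forall x, x <> 0 -> 0 < x * x) by (intros; nra).
intros [H|[H|H]]; apply Hs in H; nra.
Qed.

Lemma cauchy_schwarz (a b : V3) : dot a b ^ 2 <= dot a a * dot b b.
Proof. generalize (lagrange a b) (dot_ge0 (cross a b)). lra. Qed.

Lemma cos_bound (a b : V3) : -1 <= dot a b / sqrt (dot a a * dot b b) <= 1.
Proof.
assert (H := cauchy_schwarz a b).
assert (Hp : 0 <= dot a a * dot b b) by (apply Rmult_le_pos; apply dot_ge0).
assert (Hq := sqrt_sqrt _ Hp). assert (Hq0 := sqrt_pos (dot a a * dot b b)).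
set (q := sqrt (dot a a * dot b b)) in *. set (d := dot a b) in *.
destruct (Req_dec q 0) as [H0|H0].
- rewrite H0. unfold Rdiv. rewrite Rinv_0. lra.
- assert (0 < q) by lra.
  split; [apply Rle_div_r|apply Rle_div_l]; try lra; nra.
Qed.

Lemma speed_ge0 (x v : V3) : 0 <= speed x v.
Proof.
unfold speed. destruct (Req_dec (dot x x) 0) as [H|H].
- rewrite H. unfold Rdiv. rewrite Rinv_0. lra.
- apply Rdiv_le_0_compat; [apply sqrt_pos|]. generalize (dot_ge0 x). lra.
Qed.

Lemma sqrt_div_cos (a x : V3) : 0 < dot a a -> 0 < dot x x ->
  1 - (dot a x / sqrt (dot a a * dot x x)) ^ 2 =
  dot (cross a x) (cross a x) / (dot a a * dot x x).
Proof.
intros Ha Hx. rewrite <- lagrange.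
assert (Hp : 0 < dot a a * dot x x) by now apply Rmult_lt_0_compat.
unfold Rdiv. rewrite Rpow_mult_distr, pow_inv, pow2_sqrt by lra. field. lra.
Qed.

Lemma is_derive_dot (a : V3) (X0 X1 X2 : R -> R) (t : R) (X' : V3) :
  is_derive X0 t (px X') -> is_derive X1 t (py X') -> is_derive X2 t (pz X') ->
  is_derive (fun s => dot a (X0 s, X1 s, X2 s)) t (dot a X').
Proof.
intros H0 H1 H2. unfold dot, px, py, pz in *; simpl. auto_derive.
- repeat split; eexists; eassumption.
- der_rw. ring.
Qed.

Lemma is_derive_dot_self (X0 X1 X2 : R -> R) (t : R) (X' : V3) :
  is_derive X0 t (px X') -> is_derive X1 t (py X') -> is_derive X2 t (pz X') ->
  is_derive (fun s => dot (X0 s, X1 s, X2 s) (X0 s, X1 s, X2 s)) t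
    (2 * dot (X0 t, X1 t, X2 t) X').
Proof.
intros H0 H1 H2. unfold dot, px, py, pz in *; simpl. auto_derive.
- repeat split; eexists; eassumption.
- der_rw. ring.
Qed.

Lemma is_derive_ratio_sqrt (u v : R -> R) (r t l m : R) :
  0 < r * v t -> 0 < v t -> is_derive u t l -> is_derive v t (2 * m) ->
  is_derive (fun s => u s / sqrt (r * v s)) t ((l * v t - u t * m) / (sqrt (r * v t) * v t)).
Proof.
intros Hp Hx D1 D2. assert (Hq := sqrt_lt_R0 _ Hp).
auto_derive.
- repeat split; try (eexists; eassumption); lra.
- der_rw.
  assert (Hs := sqrt_sqrt _ (Rlt_le _ _ Hp)).
  set (q := sqrt (r * v t)) in *.
  assert (Hqq : q ^ 2 = r * v t) by (rewrite <- Hs; ring).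
  clearbody q.
  assert (r = q ^ 2 / v t) as -> by (rewrite Hqq; field; lra).
  field. lra.
Qed.

(** The numerator is kept as a product of two cross products so that Cauchy-Schwarz bounds the
    derivative by the sine of the angle times the speed. *)
Lemma is_derive_cos_ang (a : V3) (X0 X1 X2 : R -> R) (t : R) (X' : V3) :
  let X := fun s => (X0 s, X1 s, X2 s) in
  is_derive X0 t (px X') -> is_derive X1 t (py X') -> is_derive X2 t (pz X') ->
  0 < dot a a -> 0 < dot (X t) (X t) ->
  is_derive (fun s => dot a (X s) / sqrt (dot a a * dot (X s) (X s))) t
    (dot (cross a (X t)) (cross X' (X t)) /
      (sqrt (dot a a * dot (X t) (X t)) * dot (X t) (X t))).
Proof.
intros X H0 H1 H2 Ha Hx.
assert (D1 := is_derive_dot a X0 X1 X2 t X' H0 H1 H2).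
assert (D2 := is_derive_dot_self X0 X1 X2 t X' H0 H1 H2).
assert (Hp : 0 < dot a a * dot (X t) (X t)) by now apply Rmult_lt_0_compat.
assert (Hq := sqrt_lt_R0 _ Hp).
change (is_derive (fun s => dot a (X s)) t (dot a X')) in D1.
change (is_derive (fun s => dot (X s) (X s)) t (2 * dot (X t) X')) in D2.
rewrite binet_cauchy.
exact (is_derive_ratio_sqrt _ _ (dot a a) t _ _ Hp Hx D1 D2).
Qed.

Lemma is_derive_acos (c : R -> R) (t c' : R) : -1 < c t < 1 -> is_derive c t c' ->
  is_derive (fun s => acos (c s)) t (- c' / sqrt (1 - c t ^ 2)).
Proof.
intros H Hc. assert (0 < 1 - c t ^ 2) by nra.
assert (Hs := sqrt_lt_R0 _ H0).
replace (- c' / sqrt (1 - c t ^ 2)) with (scal c' (- / sqrt (1 - c t ^ 2)))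
  by (change (c' * (- / sqrt (1 - c t ^ 2)) = - c' / sqrt (1 - c t ^ 2)); field; lra).
apply (is_derive_comp acos c); [|assumption].
apply is_derive_Reals.
replace (- / sqrt (1 - c t ^ 2)) with (derive_pt acos (c t) (derivable_pt_acos (c t) H)).
- unfold derive_pt. exact (proj2_sig (derivable_pt_acos (c t) H)).
- rewrite derive_pt_acos. replace (Rsqr (c t)) with (c t ^ 2) by (unfold Rsqr; ring).
  field. lra.
Qed.

(* [acos (k * c)] with [k < 1] stays smooth where the curve passes through [a] or [-a]. *)
Lemma ang_lipschitz (a : V3) (X0 X1 X2 X0' X1' X2' H : R -> R) (s t : R) :
  let X := fun s => (X0 s, X1 s, X2 s) in
  let X' := fun s => (X0' s, X1' s, X2' s) in
  s <= t -> 0 < dot a a ->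
  (forall r, s <= r <= t -> is_derive X0 r (X0' r) /\ is_derive X1 r (X1' r) /\
    is_derive X2 r (X2' r) /\ 0 < dot (X r) (X r) /\ is_derive H r (speed (X r) (X' r))) ->
  Rabs (ang a (X t) - ang a (X s)) <= H t - H s.
Proof.
intros X X' Hst Ha HX.
set (c := fun r => dot a (X r) / sqrt (dot a a * dot (X r) (X r))).
set (c' := fun r => dot (cross a (X r)) (cross (X' r) (X r)) /
      (sqrt (dot a a * dot (X r) (X r)) * dot (X r) (X r))).
assert (Hc : forall r, s <= r <= t -> is_derive c r (c' r)).
{ intros r Hr. destruct (HX r Hr) as (D0 & D1 & D2 & Hp & _).
  now apply (is_derive_cos_ang a X0 X1 X2 r (X' r)). }
assert (Hb : forall r, -1 <= c r <= 1) by (intros; apply cos_bound).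
(* [1 - c ^ 2] is the squared sine of the angle. The squared form remains meaningful where the sine
   vanishes and the derivative of the angle itself does not exist. *)
assert (Hc' : forall r, s <= r <= t ->
   c' r ^ 2 <= (1 - c r ^ 2) * speed (X r) (X' r) ^ 2).
{ intros r Hr. destruct (HX r Hr) as (_ & _ & _ & Hp & _).
  unfold c, c'. rewrite sqrt_div_cos by assumption. unfold speed.
  assert (Hq : 0 < dot a a * dot (X r) (X r)) by now apply Rmult_lt_0_compat.
  unfold Rdiv. rewrite !Rpow_mult_distr, !pow_inv, Rpow_mult_distr.
  rewrite !pow2_sqrt; [|apply dot_ge0|lra].
  assert (C := cauchy_schwarz (cross a (X r)) (cross (X' r) (X r))).
  assert (E : dot (cross (X' r) (X r)) (cross (X' r) (X r)) =
    dot (cross (X r) (X' r)) (cross (X r) (X' r)))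
    by (rewrite !binet_cauchy, (dot_comm (X r) (X' r)); ring).
  rewrite E in C.
  assert (0 < / (dot a a * dot (X r) (X r) * dot (X r) (X r) ^ 2)).
  { apply Rinv_0_lt_compat. apply Rmult_lt_0_compat; [assumption|]. nra. }
  replace (dot (cross a (X r)) (cross a (X r)) * / (dot a a * dot (X r) (X r)) *
    (dot (cross (X r) (X' r)) (cross (X r) (X' r)) * / dot (X r) (X r) ^ 2)) with
    (dot (cross a (X r)) (cross a (X r)) * dot (cross (X r) (X' r)) (cross (X r) (X' r))
     * / (dot a a * dot (X r) (X r) * dot (X r) (X r) ^ 2)) by (field; lra).
  apply Rmult_le_compat_r; lra. }
assert (Hk : forall k, 0 < k < 1 -> forall sg, sg = 1 \/ sg = -1 ->
  sg * (acos (k * c t) - acos (k * c s)) <= H t - H s).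
{ intros k Hk sg Hsg.
  enough (H s - sg * acos (k * c s) <= H t - sg * acos (k * c t)) by lra.
  apply (nondecreasing_of_derive (fun r => H r - sg * acos (k * c r))
    (fun r => speed (X r) (X' r) + sg * (k * c' r) / sqrt (1 - (k * c r) ^ 2))); [assumption| |].
  - intros r Hr. destruct (HX r Hr) as (_ & _ & _ & _ & DH). specialize (Hb r).
    assert (D := is_derive_acos (fun r => k * c r) r (k * c' r)).
    replace (speed (X r) (X' r) + sg * (k * c' r) / sqrt (1 - (k * c r) ^ 2))
     with (minus (speed (X r) (X' r)) (sg * (- (k * c' r) / sqrt (1 - (k * c r) ^ 2))))
     by (unfold minus, plus, opp; simpl; unfold Rdiv; ring).
    apply (is_derive_minus H); [assumption|].
    apply (is_derive_scal (fun r => acos (k * c r))). apply D; [nra|].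
    now apply (is_derive_scal c), Hc.
  - intros r Hr. specialize (Hb r). specialize (Hc' r Hr).
    assert (Hs := speed_ge0 (X r) (X' r)). set (v := speed (X r) (X' r)) in *.
    assert (Hc2 : 0 <= c r ^ 2 <= 1) by nra. assert (Hk2 : 0 < k ^ 2 < 1) by nra.
    assert (Hp : 0 < 1 - (k * c r) ^ 2) by (rewrite Rpow_mult_distr; nra).
    assert (Hq := sqrt_lt_R0 _ Hp). assert (Hqq := sqrt_sqrt _ (Rlt_le _ _ Hp)).
    set (q := sqrt (1 - (k * c r) ^ 2)) in *.
    enough (Rabs (sg * (k * c' r)) <= v * q).
    { apply Rabs_le_between in H0.
      replace (v + sg * (k * c' r) / q) with ((v * q + sg * (k * c' r)) / q) by (field; lra).
      apply Rdiv_le_0_compat; lra. }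
    apply Rsqr_incr_0_var; [|nra]. rewrite <- Rsqr_abs. unfold Rsqr.
    replace (v * q * (v * q)) with (v ^ 2 * (q * q)) by ring. rewrite Hqq.
    assert (sg * sg = 1) by (destruct Hsg; subst; ring).
    replace (sg * (k * c' r) * (sg * (k * c' r))) with (sg * sg * (k ^ 2 * c' r ^ 2)) by ring.
    rewrite H0, Rmult_1_l.
    apply Rle_trans with (k ^ 2 * ((1 - c r ^ 2) * v ^ 2)).
    + apply Rmult_le_compat_l; [nra|assumption].
    + assert (k ^ 2 * (1 - c r ^ 2) <= 1 - (k * c r) ^ 2) by nra.
      assert (0 <= v ^ 2) by nra. nra. }
assert (Hlim : forall e, 0 < e -> forall sg, sg = 1 \/ sg = -1 ->
  sg * (acos (c t) - acos (c s)) <= H t - H s + e).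
{ intros e He sg Hsg. destruct (acos_uniform (e / 2)) as [d [Hd Hu]]; [lra|].
  (* [1 - k <= d / 2] keeps [k * c] within [d] of [c], and the floor [1 / 2] keeps [k] positive when
     [d] is large. *)
  set (k := Rmax (1 / 2) (1 - d / 2)).
  assert (Hk1 : 1 / 2 <= k /\ 1 - d / 2 <= k)
    by (split; [apply Rmax_l|apply Rmax_r]).
  assert (k < 1) by (apply Rmax_lub_lt; lra).
  assert (Hk' : 0 < k < 1) by lra.
  specialize (Hk k Hk' sg Hsg).
  assert (Hr : forall r, Rabs (acos (c r) - acos (k * c r)) < e / 2).
  { intros r. specialize (Hb r). apply Hu; [assumption|nra|].
    replace (c r - k * c r) with ((1 - k) * c r) by ring.
    rewrite Rabs_mult, (Rabs_pos_eq (1 - k)) by lra.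
    assert (Rabs (c r) <= 1) by (apply Rabs_le; assumption).
    assert (0 <= Rabs (c r)) by apply Rabs_pos. nra. }
  assert (R1 := Rabs_def2 _ _ (Hr t)). assert (R2 := Rabs_def2 _ _ (Hr s)).
  destruct Hsg; subst; lra. }
change (ang a (X t)) with (acos (c t)). change (ang a (X s)) with (acos (c s)).
apply Rabs_le. split.
- apply le_epsilon. intros e He. specialize (Hlim e He (-1)). lra.
- apply le_epsilon. intros e He. specialize (Hlim e He 1). lra.
Qed.

Lemma ang_scale (a b : V3) (k : R) : 0 < k ->
  ang a (k * px b, k * py b, k * pz b) = ang a b.
Proof.
intros Hk. unfold ang. f_equal.
replace (dot a (k * px b, k * py b, k * pz b)) with (k * dot a b) by (v3; ring).
replace (dot a a * dot (k * px b, k * py b, k * pz b) (k * px b, k * py b, k * pz b))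
  with (k ^ 2 * (dot a a * dot b b)) by (v3; ring).
rewrite (sqrt_mult_alt (k ^ 2)) by apply pow2_ge_0. rewrite sqrt_pow2 by lra.
set (q := sqrt _). unfold Rdiv. rewrite Rinv_mult.
replace (k * dot a b * (/ k * / q)) with ((k * / k) * (dot a b * / q)) by ring.
rewrite Rinv_r by lra. ring.
Qed.

Lemma ang_ge0 (a b : V3) : 0 <= ang a b.
Proof. apply acos_bound. Qed.

Lemma ang_lePI (a b : V3) : ang a b <= PI.
Proof. apply acos_bound. Qed.

Lemma ang_comm (a b : V3) : ang a b = ang b a.
Proof. unfold ang. now rewrite (dot_comm a b), (Rmult_comm (dot a a)). Qed.

Lemma ang_self (a : V3) : 0 < dot a a -> ang a a = 0.
Proof.
intros H. unfold ang. rewrite sqrt_square by lra.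
unfold Rdiv. rewrite Rinv_r by lra. apply acos_1.
Qed.

Lemma ang_opp (a b c : V3) : dot a c = - dot a b -> dot c c = dot b b ->
  ang a c = PI - ang a b.
Proof.
intros H1 H2. unfold ang. rewrite H1, H2, <- acos_opp. f_equal. unfold Rdiv. ring.
Qed.

Lemma ang_isom (a b a' b' : V3) : dot a b = dot a' b' -> dot a a = dot a' a' ->
  dot b b = dot b' b' -> ang a b = ang a' b'.
Proof. intros H1 H2 H3. unfold ang. now rewrite H1, H2, H3. Qed.

Lemma continuous_Rplus (f g : R -> R) (t : R) : continuous f t -> continuous g t ->
  continuous (fun s => f s + g s) t.
Proof. intros Hf Hg. apply (continuous_plus f g); assumption. Qed.

Lemma continuous_Rmult (f g : R -> R) (t : R) : continuous f t -> continuous g t ->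
  continuous (fun s => f s * g s) t.
Proof. intros Hf Hg. apply (continuous_mult f g); assumption. Qed.

Lemma continuous_Rminus (f g : R -> R) (t : R) : continuous f t -> continuous g t ->
  continuous (fun s => f s - g s) t.
Proof. intros Hf Hg. apply (continuous_minus f g); assumption. Qed.

Lemma continuous_Rid (t : R) : continuous (fun s : R => s) t.
Proof. apply continuous_id. Qed.

Lemma continuous_Rconst (k t : R) : continuous (fun _ : R => k) t.
Proof. apply continuous_const. Qed.

Lemma continuous_Rpow (f : R -> R) (n : nat) (t : R) : continuous f t ->
  continuous (fun s => f s ^ n) t.
Proof.
intros Hf. induction n as [|n IH]; simpl; [apply continuous_Rconst|now apply continuous_Rmult].
Qed.

Lemma continuous_dot (A0 A1 A2 B0 B1 B2 : R -> R) (t : R) :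
  continuous A0 t -> continuous A1 t -> continuous A2 t ->
  continuous B0 t -> continuous B1 t -> continuous B2 t ->
  continuous (fun s => dot (A0 s, A1 s, A2 s) (B0 s, B1 s, B2 s)) t.
Proof.
intros HA0 HA1 HA2 HB0 HB1 HB2.
exact (continuous_Rplus _ _ t (continuous_Rplus _ _ t (continuous_Rmult _ _ t HA0 HB0) (continuous_Rmult _ _ t HA1 HB1)) (continuous_Rmult _ _ t HA2 HB2)).
Qed.

Lemma continuous_Rinv_comp (f : R -> R) (t : R) : continuous f t -> f t <> 0 ->
  continuous (fun s => / f s) t.
Proof.
intros Hf H0. apply (continuous_comp f Rinv); [assumption|].
apply continuity_pt_filterlim. apply continuity_pt_inv; [|assumption].
apply derivable_continuous_pt, derivable_pt_id.
Qed.

Lemma continuous_sqrt_comp (f : R -> R) (t : R) : continuous f t ->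
  continuous (fun s => sqrt (f s)) t.
Proof. intros Hf. apply (continuous_comp f sqrt); [assumption|apply continuous_sqrt]. Qed.

Lemma continuous_ang (A0 A1 A2 B0 B1 B2 : R -> R) (t : R) :
  continuous A0 t -> continuous A1 t -> continuous A2 t ->
  continuous B0 t -> continuous B1 t -> continuous B2 t ->
  0 < dot (A0 t, A1 t, A2 t) (A0 t, A1 t, A2 t) ->
  0 < dot (B0 t, B1 t, B2 t) (B0 t, B1 t, B2 t) ->
  continuous (fun s => ang (A0 s, A1 s, A2 s) (B0 s, B1 s, B2 s)) t.
Proof.
intros HA0 HA1 HA2 HB0 HB1 HB2 HA HB. unfold ang. apply continuous_acos_comp.
- unfold Rdiv. apply continuous_Rmult; [now apply continuous_dot|].
  apply (continuous_Rinv_comp (fun s => sqrt (dot (A0 s, A1 s, A2 s) (A0 s, A1 s, A2 s) *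
     dot (B0 s, B1 s, B2 s) (B0 s, B1 s, B2 s)))).
  + apply (continuous_sqrt_comp (fun s => dot (A0 s, A1 s, A2 s) (A0 s, A1 s, A2 s) *
     dot (B0 s, B1 s, B2 s) (B0 s, B1 s, B2 s))).
    apply continuous_Rmult; now apply continuous_dot.
  + apply Rgt_not_eq, sqrt_lt_R0. now apply Rmult_lt_0_compat.
- apply filter_forall. intros s. apply cos_bound.
Qed.

(** * The boundary of Omega *)

Definition par (m : R) : V3 := (1, m, m ^ 2).
Definition gam (m : R) : R := speed (par m) (0, 1, 2 * m).
Definition arc (m : R) : R := - RInt gam 0 m.
(* Winds along the boundary from [par 0] to [par m] (signed so that decreasing [m] is forward),
   then goes straight from [par m] to [x]. *)
Definition detour (m : R) (x : V3) : R := arc m + ang (par m) x.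

Lemma par_pos (m : R) : 0 < dot (par m) (par m).
Proof. unfold par. v3. nra. Qed.

Lemma gam_eq (m : R) : gam m = sqrt (1 + 4 * m ^ 2 + m ^ 4) / (1 + m ^ 2 + m ^ 4).
Proof. unfold gam, speed, par. v3. f_equal; [f_equal|]; ring. Qed.

Lemma gam_pos (m : R) : 0 < gam m.
Proof.
rewrite gam_eq. apply Rdiv_lt_0_compat; [apply sqrt_lt_R0|];
 replace (m ^ 4) with ((m ^ 2) ^ 2) by ring; nra.
Qed.

Lemma continuous_gam (m : R) : continuous gam m.
Proof.
apply (continuous_ext (fun m => sqrt (1 + 4 * m ^ 2 + m ^ 4) / (1 + m ^ 2 + m ^ 4))).
- intros. now rewrite gam_eq.
- apply (ex_derive_continuous (V := R_NormedModule)). auto_derive.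
  replace (m * (m * (m * (m * 1)))) with ((m * m) ^ 2) by ring.
  repeat split; nra.
Qed.

Lemma is_derive_arc (m : R) : is_derive arc m (- gam m).
Proof.
unfold arc. apply (is_derive_opp (fun m => RInt gam 0 m)).
apply (is_derive_RInt gam _ 0); [|apply continuous_gam].
apply filter_forall. intros b. apply (RInt_correct gam). apply (ex_RInt_continuous gam).
intros; apply continuous_gam.
Qed.

Lemma arc_0 : arc 0 = 0.
Proof. unfold arc. rewrite RInt_point. apply Ropp_0. Qed.

Lemma arc_decr (a b : R) : a <= b -> arc b <= arc a.
Proof.
intros H. enough (- arc a <= - arc b) by lra.
apply (nondecreasing_of_derive (fun m => - arc m) gam); [assumption| |].
- intros t _. rewrite <- (Ropp_involutive (gam t)). apply (is_derive_opp arc). apply is_derive_arc.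
- intros t _. left; apply gam_pos.
Qed.

Lemma gam_opp (m : R) : gam (- m) = gam m.
Proof. rewrite !gam_eq. f_equal; [f_equal|]; ring. Qed.

(** Stands in for substitution in integrals: both sides of a change of variables are primitives of
    one function and agree at one point. *)
Lemma eq_of_derive (f g f' : R -> R) (a b : R) :
  (forall t, is_derive f t (f' t)) -> (forall t, is_derive g t (f' t)) ->
  f a = g a -> f b = g b.
Proof.
intros Hf Hg E.
assert (K : forall u v, u <= v -> forall sg, sg * (f u - g u) <= sg * (f v - g v)).
{ intros u v Huv sg.
  apply (nondecreasing_of_derive (fun t => sg * (f t - g t)) (fun t => sg * (f' t - f' t)));
    [assumption| |intros; lra].
  intros t _. apply (is_derive_scal (fun t => f t - g t)). now apply (is_derive_minus f g). }
destruct (Rle_lt_dec a b) as [H|H].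
- assert (K1 := K a b H 1). assert (K2 := K a b H (-1)). lra.
- assert (K1 := K b a (Rlt_le _ _ H) 1). assert (K2 := K b a (Rlt_le _ _ H) (-1)). lra.
Qed.

Lemma is_derive_affine (f : R -> R) (u v t l : R) : is_derive f (u * t + v) l ->
  is_derive (fun s => f (u * s + v)) t (u * l).
Proof.
intros H. apply (is_derive_comp f (fun s => u * s + v) t l u H).
auto_derive; [easy|ring].
Qed.

Lemma arc_opp (m : R) : arc (- m) = - arc m.
Proof.
replace (- m) with (-1 * m + 0) by ring.
apply (eq_of_derive (fun m => arc (-1 * m + 0)) (fun m => - arc m) gam 0).
- intros t. replace (gam t) with (-1 * - gam (-1 * t + 0)).
  + apply is_derive_affine, is_derive_arc.
  + replace (-1 * t + 0) with (- t) by ring. rewrite gam_opp. ring.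
- intros t. rewrite <- (Ropp_involutive (gam t)). apply (is_derive_opp arc), is_derive_arc.
- replace (-1 * 0 + 0) with 0 by ring. rewrite arc_0. ring.
Qed.

Lemma is_derive_RInt_continuous (f : R -> R) (t : R) : (forall s, continuous f s) ->
  is_derive (fun s => RInt f 0 s) t (f t).
Proof.
intros Hf. apply (is_derive_RInt f _ 0); [|apply Hf].
apply filter_forall. intros b. apply (RInt_correct f).
apply (ex_RInt_continuous f). intros; apply Hf.
Qed.

(* Speed of the boundary of Omega in the angular parameter [al = -2 * atan m]. *)
Definition gal (a : R) : R := sqrt (6 - 2 * cos a ^ 2) / (3 + cos a ^ 2).

Lemma cos_sq_le (a : R) : 0 <= cos a ^ 2 <= 1.
Proof. generalize (COS_bound a). nra. Qed.

Lemma continuous_gal (a : R) : continuous gal a.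
Proof.
apply (ex_derive_continuous (V := R_NormedModule)). unfold gal. generalize (cos_sq_le a).
intros H. simpl in H. auto_derive. repeat split; lra.
Qed.

Lemma gal_pos (a : R) : 0 < gal a.
Proof.
unfold gal. generalize (cos_sq_le a). intros H.
apply Rdiv_lt_0_compat; [apply sqrt_lt_R0|]; lra.
Qed.

(** Doubling the angle turns the integrand [k] of [L_Omega] into [gal t = 2 * k (2 * t)], so the
    integral of [k] up to [PI] equals that of [gal] up to [PI / 2]; the symmetry of [gal] about
    [PI / 2] doubles it. *)
Lemma gal_int_PI : RInt gal 0 PI = L_Omega / 2.
Proof.
set (G := fun s => RInt gal 0 s).
assert (DG : forall t, is_derive G t (gal t))
  by (intros; apply is_derive_RInt_continuous, continuous_gal).
assert (G0 : G 0 = 0) by (unfold G; now rewrite RInt_point).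
set (k := fun al => sqrt (5 - cos al) / (7 + cos al)).
set (K := fun s => RInt k 0 s).
assert (DK : forall t, is_derive K t (k t)).
{ intros. apply is_derive_RInt_continuous. intros s.
  apply (ex_derive_continuous (V := R_NormedModule)). unfold k.
  generalize (COS_bound s). intros H. auto_derive. repeat split; lra. }
assert (E1 : K PI = G (PI / 2)).
{ replace PI with (2 * (PI / 2) + 0) at 1 by field.
  apply (eq_of_derive (fun s => K (2 * s + 0)) G gal 0).
  - intros t. replace (gal t) with (2 * k (2 * t + 0)).
    + apply is_derive_affine, DK.
    + rewrite Rplus_0_r. unfold k, gal. rewrite cos_2a_cos.
      generalize (cos_sq_le t). intros H.
      replace (5 - (2 * cos t * cos t - 1)) with (6 - 2 * cos t ^ 2) by ring.
      replace (7 + (2 * cos t * cos t - 1)) with (2 * (3 + cos t ^ 2)) by ring.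
      field. lra.
  - apply DG.
  - rewrite G0. replace (2 * 0 + 0) with 0 by ring. unfold K. now rewrite RInt_point. }
assert (E2 : forall b, G (-1 * b + PI) = G PI - G b).
{ intros b. apply (eq_of_derive (fun s => G (-1 * s + PI)) (fun s => G PI - G s)
    (fun s => - gal s) 0).
  - intros t. replace (- gal t) with (-1 * gal (-1 * t + PI)).
    + apply is_derive_affine, DG.
    + replace (-1 * t + PI) with (- t + PI) by ring. unfold gal.
      rewrite neg_cos, cos_neg. replace ((- cos t) ^ 2) with (cos t ^ 2) by ring. ring.
  - intros t. rewrite <- (Rplus_0_l (- gal t)).
    apply (is_derive_minus (fun _ => G PI) G t 0); [apply (@is_derive_const R_AbsRing R_NormedModule)|apply DG].
  - rewrite G0. replace (-1 * 0 + PI) with PI by ring. symmetry; apply Rminus_0_r. }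
change (G PI = L_Omega / 2). unfold L_Omega. change (G PI = 4 * K PI / 2). rewrite E1.
specialize (E2 (PI / 2)). replace (-1 * (PI / 2) + PI) with (PI / 2) in E2 by field. lra.
Qed.

(** With [a = 2 * atan m], the vector [(1 + cos a, sin a, 1 - cos a)] is proportional to [par m].
    This angle brings the infinite end of the parameter [m] to the finite value [PI]. *)
Lemma arc_gal (m : R) : arc m = - RInt gal 0 (2 * atan m).
Proof.
apply (eq_of_derive arc (fun m => - RInt gal 0 (2 * atan m)) (fun m => - gam m) 0).
- apply is_derive_arc.
- clear m. intros m. apply (is_derive_opp (fun m => RInt gal 0 (2 * atan m))).
  replace (gam m) with (2 * (/ (1 + m ^ 2)) * gal (2 * atan m)).
  + apply (is_derive_comp (fun s => RInt gal 0 s) (fun m => 2 * atan m)).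
    * apply is_derive_RInt_continuous, continuous_gal.
    * apply is_derive_scal. apply is_derive_Reals.
      apply derivable_pt_lim_atan.
  + unfold gal. rewrite cos_2a_cos, cos_atan, gam_eq.
    assert (Hp : 0 < 1 + m ^ 2) by nra.
    replace (Rsqr m) with (m ^ 2) by (unfold Rsqr; ring).
    replace (2 * (1 / sqrt (1 + m ^ 2)) * (1 / sqrt (1 + m ^ 2)) - 1)
      with ((1 - m ^ 2) / (1 + m ^ 2)).
    2:{ assert (Hs := sqrt_sqrt _ (Rlt_le _ _ Hp)). assert (Hs0 := sqrt_lt_R0 _ Hp).
        replace (2 * (1 / sqrt (1 + m ^ 2)) * (1 / sqrt (1 + m ^ 2))) with
          (2 / (sqrt (1 + m ^ 2) * sqrt (1 + m ^ 2))) by (field; lra).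
        rewrite Hs. field. lra. }
    replace (6 - 2 * ((1 - m ^ 2) / (1 + m ^ 2)) ^ 2) with
      ((2 / (1 + m ^ 2)) ^ 2 * (1 + 4 * m ^ 2 + m ^ 4)) by (field; lra).
    assert (0 < 1 + m ^ 2 + m ^ 4) by (replace (m ^ 4) with ((m ^ 2) ^ 2) by ring; nra).
    rewrite sqrt_mult_alt by apply pow2_ge_0.
    rewrite sqrt_pow2 by (left; apply Rdiv_lt_0_compat; lra).
    replace (3 + ((1 - m ^ 2) / (1 + m ^ 2)) ^ 2) with
      (4 * (1 + m ^ 2 + m ^ 4) / (1 + m ^ 2) ^ 2) by (field; lra).
    field. lra.
- rewrite arc_0, atan_0, Rmult_0_r, RInt_point. symmetry; apply Ropp_0.
Qed.

Lemma arc_gt (m : R) : - (L_Omega / 2) < arc m.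
Proof.
rewrite arc_gal, <- gal_int_PI. apply Ropp_lt_contravar.
assert (Ha := atan_bound m).
assert (Hi : forall a b, ex_RInt gal a b)
  by (intros; apply (ex_RInt_continuous gal); intros; apply continuous_gal).
rewrite <- (RInt_Chasles gal 0 (2 * atan m) PI) by apply Hi.
assert (0 < RInt gal (2 * atan m) PI); [|unfold plus; simpl; lra].
apply RInt_gt_0; [lra| |]; intros; [apply gal_pos|apply continuous_gal].
Qed.

Lemma arc_lim (e : R) : 0 < e -> exists M, forall m, M <= m -> arc m < - (L_Omega / 2) + e.
Proof.
intros He. set (G := fun s => RInt gal 0 s).
assert (CG : continuous G PI).
{ apply (ex_derive_continuous (V := R_NormedModule)). eexists.
  apply is_derive_RInt_continuous, continuous_gal. }
destruct (proj1 (filterlim_locally G (G PI)) CG (mkposreal e He)) as [d Hd].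
assert (Hpi := PI_RGT_0). destruct d as [d Hd0]. simpl in Hd.
set (a := Rmax (PI / 4) (PI / 2 - d / 4)).
assert (Ha : PI / 4 <= a /\ PI / 2 - d / 4 <= a) by (split; [apply Rmax_l|apply Rmax_r]).
assert (Ha' : a < PI / 2) by (apply Rmax_lub_lt; lra).
exists (tan a). intros m Hm. assert (Hb := atan_bound m).
assert (a <= atan m).
{ rewrite <- (atan_tan a) by lra. destruct Hm as [Hm|Hm].
  - left. now apply atan_increasing. - rewrite Hm. lra. }
rewrite arc_gal, <- gal_int_PI.
assert (B : ball PI d (2 * atan m)).
{ change (Rabs (2 * atan m - PI) < d). apply Rabs_def1; lra. }
apply Hd in B. change (Rabs (G (2 * atan m) - G PI) < e) in B.
apply Rabs_def2 in B. unfold G in B. lra.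
Qed.

(** The roles in [ang_lipschitz] are exchanged: [x] is the fixed vector and the moving point is
    [par m], with arc length [- arc]. *)
Lemma detour_arc_lipschitz (x : V3) (m1 m2 : R) : 0 < dot x x -> m1 <= m2 ->
  Rabs (ang (par m2) x - ang (par m1) x) <= arc m1 - arc m2.
Proof.
intros Hx Hm. rewrite (ang_comm (par m2)), (ang_comm (par m1)).
replace (arc m1 - arc m2) with ((fun m => - arc m) m2 - (fun m => - arc m) m1) by ring.
apply (ang_lipschitz x (fun _ => 1) (fun m => m) (fun m => m ^ 2)
  (fun _ => 0) (fun _ => 1) (fun m => 2 * m) (fun m => - arc m)); [assumption..|].
intros r _. refine (conj _ (conj _ (conj _ (conj _ _)))).
- apply (@is_derive_const R_AbsRing R_NormedModule).
- apply (@is_derive_id R_AbsRing).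
- auto_derive; [easy|ring].
- apply par_pos.
- change (is_derive (fun m => - arc m) r (gam r)). rewrite <- (Ropp_involutive (gam r)).
  apply (is_derive_opp arc), is_derive_arc.
Qed.

(** Triangle inequality: with a larger [m] the string leaves the boundary earlier and replaces a
    stretch of arc by a shortcut. *)
Lemma detour_mono (x : V3) (m1 m2 : R) : 0 < dot x x -> m1 <= m2 -> detour m2 x <= detour m1 x.
Proof.
intros Hx Hm. assert (H := detour_arc_lipschitz x m1 m2 Hx Hm).
apply Rabs_le_between in H. unfold detour. lra.
Qed.

Lemma detour_lip (x : V3) (m1 m2 : R) : 0 < dot x x ->
  Rabs (detour m2 x - detour m1 x) <= 2 * Rabs (arc m2 - arc m1).
Proof.
intros Hx.
assert (K : forall a b, a <= b -> Rabs (detour b x - detour a x) <= 2 * Rabs (arc b - arc a)).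
{ intros a b Hab. assert (H := detour_arc_lipschitz x a b Hx Hab).
  assert (Ha := arc_decr a b Hab). rewrite (Rabs_left1 (arc b - arc a)) by lra.
  apply Rabs_le_between in H. unfold detour. apply Rabs_le. lra. }
destruct (Rle_lt_dec m1 m2) as [H|H]; [now apply K|].
rewrite Rabs_minus_sym, (Rabs_minus_sym (arc m2)). apply K. lra.
Qed.

(* The great circle through [par (l + r)] tangent to the boundary of Omega contains [x],
   so moving the tangency point trades arc length against angle at equal rates. *)
Lemma detour_critical (y l r : R) : 0 < y -> 0 < r ->
  is_derive (fun m => detour m (y, y * l, y * (l ^ 2 - r ^ 2))) (l + r) 0.
Proof.
intros Hy Hr. set (x := (y, y * l, y * (l ^ 2 - r ^ 2))). set (m := l + r).
assert (Hx : 0 < dot x x) by (apply dot_pos; left; unfold x; v3; lra).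
assert (Hm := par_pos m).
set (c := fun m => dot x (par m) / sqrt (dot x x * dot (par m) (par m))).
assert (Dc := is_derive_cos_ang x (fun _ => 1) (fun m => m) (fun m => m ^ 2) m (0, 1, 2 * m)).
assert (Dc' : is_derive c m (dot (cross x (par m)) (cross (0, 1, 2 * m) (par m)) /
   (sqrt (dot x x * dot (par m) (par m)) * dot (par m) (par m)))).
{ apply Dc; [| | |assumption|assumption].
  - apply (@is_derive_const R_AbsRing R_NormedModule).
  - apply (@is_derive_id R_AbsRing).
  - unfold pz; simpl. auto_derive; [easy|ring]. }
clear Dc.
set (n := dot (cross (par m) (0, 1, 2 * m)) (cross (par m) (0, 1, 2 * m))).
assert (Hn : 0 < n) by (apply dot_pos; right; right; unfold par; v3; lra).
(* Both identities express [x = y * (par m - r * (0, 1, 2 * m))]: [x] lies in the plane of [par m]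
   and its derivative, on the side towards which [m] decreases. The sign in [E2] is what makes the
   two rates cancel. *)
assert (E1 : dot (cross x (par m)) (cross x (par m)) = (y * r) ^ 2 * n)
  by (unfold n, x, par, m; v3; ring).
assert (E2 : dot (cross x (par m)) (cross (0, 1, 2 * m) (par m)) = - (y * r * n))
  by (unfold n, x, par, m; v3; ring).
assert (S1 := sqrt_div_cos x (par m) Hx Hm). rewrite E1 in S1. fold (c m) in S1.
assert (Hyr : 0 < y * r) by now apply Rmult_lt_0_compat.
assert (Hq : 0 < dot x x * dot (par m) (par m)) by now apply Rmult_lt_0_compat.
assert (Hpos : 0 < (y * r) ^ 2 * n / (dot x x * dot (par m) (par m))).
{ apply Rdiv_lt_0_compat; [|assumption]. apply Rmult_lt_0_compat; [nra|assumption]. }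
assert (Hc : -1 < c m < 1).
{ rewrite <- S1 in Hpos. clear - Hpos. generalize dependent (c m). intros; nra. }
assert (D := is_derive_acos c m _ Hc Dc'). rewrite S1, E2 in D.
unfold detour. replace 0 with (plus (- gam m) (gam m)) by (unfold plus; simpl; ring).
apply (is_derive_plus arc (fun m => ang (par m) x)); [apply is_derive_arc|].
apply (is_derive_ext (fun s => acos (c s))); [intros s; unfold c; rewrite (ang_comm _ x); reflexivity|].
evar_last; [exact D|].
unfold gam, speed. fold n.
rewrite sqrt_div_alt by assumption. rewrite (sqrt_mult_alt ((y * r) ^ 2)) by apply pow2_ge_0.
rewrite sqrt_pow2 by lra.
assert (Hs := sqrt_lt_R0 _ Hq). assert (Hs' := sqrt_lt_R0 _ Hn).
rewrite <- (sqrt_sqrt n) at 1 by lra. field. lra.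
Qed.

Lemma continuous_arc (m : R) : continuous arc m.
Proof.
apply (ex_derive_continuous (V := R_NormedModule)). eexists. apply is_derive_arc.
Qed.

Lemma continuous_detour (mu : R -> R) (x : V3) (t : R) : 0 < dot x x -> continuous mu t ->
  continuous (fun s => detour (mu s) x) t.
Proof.
intros Hx Hmu. destruct x as [[a b] c]. unfold detour. apply continuous_Rplus.
- apply (continuous_comp mu arc); [assumption|apply continuous_arc].
- apply (continuous_ang (fun _ => 1) mu (fun s => mu s ^ 2) (fun _ => a) (fun _ => b) (fun _ => c));
  try apply continuous_Rconst; try assumption.
  + now apply continuous_Rpow. + apply (par_pos (mu t)).
Qed.

(** * Growth of the taut string along the path *)

(** Real induction on the bound with slack [e * (r - s)]: the local hypothesis extends it to the
    right, while continuity of [f] and monotonicity of [H] carry it to limits from the left. No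
    derivative of [f] is involved, which is what the square root in [pot] calls for. *)
Lemma dini_le (f H : R -> R) (s t : R) : s <= t ->
  (forall r, s <= r <= t -> continuous f r) ->
  (forall a b, s <= a <= b -> b <= t -> H a <= H b) ->
  (forall r, s <= r < t -> forall e, 0 < e -> exists d, 0 < d /\
     forall w, r < w < r + d -> w <= t -> f w - f r <= H w - H r + e * (w - r)) ->
  f t - f s <= H t - H s.
Proof.
intros Hst Cf MH HD. apply le_epsilon. intros e0 He0.
set (e := e0 / (t - s + 1)).
assert (He : 0 < e) by (apply Rdiv_lt_0_compat; lra).
enough (K : t <= t -> f t - f s <= H t - H s + e * (t - s)).
{ specialize (K (Rle_refl t)). assert (e * (t - s) <= e0); [|lra].
  assert (Ee : e * (t - s + 1) = e0) by (unfold e; field; lra).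
  clearbody e. lra. }
apply (real_induction (fun r => r <= t -> f r - f s <= H r - H s + e * (r - s)) s t);
  [assumption|lra| |].
- intros r Hr IH. destruct (HD r Hr e He) as [d [Hd K]]. exists d. split; [assumption|].
  intros w Hw Hwt. specialize (K w Hw Hwt). specialize (IH (Rlt_le _ _ (proj2 Hr))). lra.
- intros r Hr IH _. apply le_epsilon. intros e1 He1.
  assert (Cr : continuous f r) by (apply Cf; lra).
  destruct (proj1 (filterlim_locally f (f r)) Cr (mkposreal e1 He1)) as [d Hd].
  set (w := Rmax s (r - d / 2)). assert (Hd0 := cond_pos d).
  assert (Hw : s <= w /\ r - d / 2 <= w) by (split; [apply Rmax_l|apply Rmax_r]).
  assert (w < r) by (apply Rmax_lub_lt; lra).
  assert (B : ball r d w) by (change (Rabs (w - r) < d); apply Rabs_def1; lra).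
  apply Hd in B. change (Rabs (f w - f r) < e1) in B. apply Rabs_def2 in B.
  assert (K : f w - f s <= H w - H s + e * (w - s)) by (apply IH; lra).
  assert (K2 : H w <= H r) by (apply MH; lra).
  assert (e * (w - s) <= e * (r - s)) by (apply Rmult_le_compat_l; lra). lra.
Qed.

Lemma is_derive_near (f : R -> R) (r l e : R) : is_derive f r l -> 0 < e ->
  exists d, 0 < d /\
  forall w, Rabs (w - r) < d -> Rabs (f w - f r - l * (w - r)) <= e * Rabs (w - r).
Proof.
intros D He. apply is_derive_Reals in D. destruct (D e He) as [d Hd].
exists d. split; [apply cond_pos|]. intros w Hw.
destruct (Req_dec w r) as [->|Hn].
- replace (f r - f r - l * (r - r)) with 0 by ring. replace (r - r) with 0 by ring.
  rewrite !Rabs_R0. lra.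
- specialize (Hd (w - r) ltac:(lra) Hw). replace (r + (w - r)) with w in Hd by ring.
  replace (f w - f r - l * (w - r)) with (((f w - f r) / (w - r) - l) * (w - r)) by (field; lra).
  rewrite Rabs_mult. apply Rmult_le_compat_r; [apply Rabs_pos|lra].
Qed.

Lemma near_continuous (f : R -> R) (r e : R) : continuous f r -> 0 < e ->
  exists d, 0 < d /\ forall w, Rabs (w - r) < d -> Rabs (f w - f r) < e.
Proof.
intros C He. destruct (proj1 (filterlim_locally f (f r)) C (mkposreal e He)) as [d Hd].
exists d. split; [apply cond_pos|]. intros w Hw. exact (Hd w Hw).
Qed.

Definition derivs_on (y y1 y2 y3 : R -> R) (p q : R) : Prop :=
  forall t, p <= t <= q ->
  is_derive y t (y1 t) /\ is_derive y1 t (y2 t) /\ is_derive y2 t (y3 t).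

(** Arc length enters only through this bound on angles to fixed vectors: it applies at once to any
    frozen tangency point and survives the reflection [y(t) -> - y(- t)]. *)
Definition arclength_on (X : R -> V3) (H : R -> R) (p q : R) : Prop :=
  forall a s t, 0 < dot a a -> p <= s -> s <= t -> t <= q ->
  Rabs (ang a (X t) - ang a (X s)) <= H t - H s.

(* Taut-string length for [x] proportional to [(1, l, m)]; a point inside Omega is first moved
   along its meridian to [(1, l, l^2)]. *)
Definition pot (l m : R) : R :=
  detour (l + sqrt (Rmax (l ^ 2 - m) 0)) (1, l, l ^ 2 - Rmax (l ^ 2 - m) 0).

Lemma detour_scale (m k l n : R) : 0 < k -> detour m (k, k * l, k * n) = detour m (1, l, n).
Proof.
intros Hk. unfold detour. f_equal. rewrite <- (ang_scale (par m) (1, l, n) k Hk).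
unfold px, py, pz; simpl. now rewrite Rmult_1_r.
Qed.

Lemma detour_par (l : R) : detour l (1, l, l ^ 2) = arc l.
Proof.
unfold detour. change (1, l, l ^ 2) with (par l). rewrite ang_self by apply par_pos. ring.
Qed.

Lemma pot_outside (l m : R) : 0 <= l ^ 2 - m ->
  pot l m = detour (l + sqrt (l ^ 2 - m)) (1, l, m).
Proof.
intros H. unfold pot. rewrite Rmax_left by assumption. do 2 f_equal. ring.
Qed.

Lemma pot_inside (l m : R) : l ^ 2 - m <= 0 -> pot l m = arc l.
Proof.
intros H. unfold pot. rewrite Rmax_right by assumption.
rewrite sqrt_0, Rplus_0_r, Rminus_0_r. apply detour_par.
Qed.

(** Outside the cone the tangency point is at least [l], so [detour_mono] applies; inside, the extra
    angle is nonnegative. The right side is free of the square root, which makes it usable for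
    increments starting on the cone. *)
Lemma pot_le (l m : R) : pot l m <= detour l (1, l, m).
Proof.
destruct (Rle_lt_dec 0 (l ^ 2 - m)) as [H|H].
- rewrite pot_outside by assumption. apply detour_mono.
  + apply dot_pos. left. unfold px; simpl; lra.
  + generalize (sqrt_pos (l ^ 2 - m)). lra.
- rewrite pot_inside by lra. unfold detour. generalize (ang_ge0 (par l) (1, l, m)). lra.
Qed.

Lemma pot_ge (l m : R) : l + sqrt (Rmax (l ^ 2 - m) 0) <= 0 -> 0 <= pot l m.
Proof.
intros H. unfold pot, detour. apply arc_decr in H. rewrite arc_0 in H.
match goal with |- _ <= _ + ang ?a ?b => generalize (ang_ge0 a b) end. lra.
Qed.

Lemma continuous_pot (l m : R -> R) (t : R) : continuous l t -> continuous m t ->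
  continuous (fun s => pot (l s) (m s)) t.
Proof.
intros Hl Hm. unfold pot, detour, par.
set (D := fun s => Rmax (l s ^ 2 - m s) 0).
assert (CD : continuous D t).
{ apply (continuous_ext (fun s => (l s ^ 2 - m s + Rabs (l s ^ 2 - m s)) * / 2)).
  - intros s. unfold D. simpl. unfold Rmax. destruct (Rle_dec _ 0).
    + rewrite Rabs_left1 by lra. lra. + rewrite Rabs_pos_eq by lra. lra.
  - apply continuous_Rmult; [|apply continuous_Rconst].
    assert (C : continuous (fun s => l s ^ 2 - m s) t)
      by (apply continuous_Rminus; [now apply continuous_Rpow|assumption]).
    apply continuous_Rplus; [assumption|].
    apply (continuous_comp (fun s => l s ^ 2 - m s) Rabs); [assumption|].
    apply continuous_Rabs. }
assert (Cmu : continuous (fun s => l s + sqrt (D s)) t)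
  by (apply continuous_Rplus; [assumption|now apply continuous_sqrt_comp]).
apply continuous_Rplus.
- apply (continuous_comp (fun s => l s + sqrt (D s)) arc); [assumption|apply continuous_arc].
- apply (continuous_ang (fun _ => 1) (fun s => l s + sqrt (D s))
    (fun s => (l s + sqrt (D s)) ^ 2) (fun _ => 1) l (fun s => l s ^ 2 - D s));
    try apply continuous_Rconst; try assumption.
  + now apply continuous_Rpow.
  + apply continuous_Rminus; [now apply continuous_Rpow|assumption].
  + apply dot_pos. left. unfold px; simpl; lra.
  + apply dot_pos. left. unfold px; simpl; lra.
Qed.

Lemma arclength_mono (X : R -> V3) (H : R -> R) (p q s t : R) :
  arclength_on X H p q -> p <= s -> s <= t -> t <= q -> H s <= H t.
Proof.
intros HA H1 H2 H3. assert (Ha : 0 < dot (1, 0, 0) (1, 0, 0)) by (v3; lra).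
generalize (HA _ s t Ha H1 H2 H3).
generalize (Rabs_pos (ang (1, 0, 0) (X t) - ang (1, 0, 0) (X s))). lra.
Qed.

Lemma arclength_detour (X : R -> V3) (H : R -> R) (p q s t m : R) :
  arclength_on X H p q -> p <= s -> s <= t -> t <= q ->
  Rabs (detour m (X t) - detour m (X s)) <= H t - H s.
Proof.
intros HA H1 H2 H3. unfold detour.
replace (arc m + ang (par m) (X t) - (arc m + ang (par m) (X s)))
  with (ang (par m) (X t) - ang (par m) (X s)) by ring.
apply HA; try assumption. apply par_pos.
Qed.

Lemma detour_state (y y1 y2 : R -> R) (m t : R) : 0 < y t ->
  detour m (y t, y1 t, y2 t) = detour m (1, y1 t / y t, y2 t / y t).
Proof.
intros Hy. rewrite <- (detour_scale m (y t)) by assumption. f_equal. f_equal; [f_equal|]; field; lra.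
Qed.

Lemma pot_step (y y1 y2 y3 H : R -> R) (s t : R) : s <= t ->
  derivs_on y y1 y2 y3 s t -> (forall r, s <= r <= t -> 0 < y r) ->
  arclength_on (fun r => (y r, y1 r, y2 r)) H s t ->
  pot (y1 t / y t) (y2 t / y t) - pot (y1 s / y s) (y2 s / y s) <= H t - H s.
Proof.
intros Hst HD Hy HA. set (X := fun r => (y r, y1 r, y2 r)) in *.
set (l := fun r => y1 r / y r). set (m := fun r => y2 r / y r).
assert (Dl : forall r, s <= r <= t -> is_derive l r (m r - l r ^ 2)).
{ intros r Hr. destruct (HD r Hr) as (D0 & D1 & _). specialize (Hy r Hr). unfold l, m.
  auto_derive.
  - repeat split; try (eexists; eassumption); lra.
  - der_rw. field. lra. }
assert (Em : forall r, s <= r <= t -> ex_derive m r).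
{ intros r Hr. destruct (HD r Hr) as (D0 & _ & D2). specialize (Hy r Hr). unfold m.
  auto_derive. repeat split; try (eexists; eassumption); lra. }
assert (Cl : forall r, s <= r <= t -> continuous l r)
  by (intros r Hr; apply (ex_derive_continuous (V := R_NormedModule)); eexists; apply Dl, Hr).
assert (Cm : forall r, s <= r <= t -> continuous m r)
  by (intros r Hr; apply (ex_derive_continuous (V := R_NormedModule)), Em, Hr).
assert (Xp : forall r, s <= r <= t -> 0 < dot (X r) (X r)).
{ intros r Hr. apply dot_pos. left. specialize (Hy r Hr). unfold X, px; simpl. lra. }
assert (HX : forall k r, s <= r <= t -> detour k (X r) = detour k (1, l r, m r))
  by (intros k r Hr; apply detour_state, Hy, Hr).
apply (dini_le (fun r => pot (l r) (m r)) H); [assumption| | |].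
- intros r Hr. apply continuous_pot; auto.
- intros a b H1 H2. apply (arclength_mono X H s t); tauto || lra.
- intros r Hr e He. assert (Hr' : s <= r <= t) by lra.
  set (D := fun w => l w ^ 2 - m w).
  assert (CD : continuous D r) by (apply continuous_Rminus; [apply continuous_Rpow|]; auto).
  destruct (Rtotal_order (D r) 0) as [HDr|[HDr|HDr]].
  + (* inside the cone the curve moves backwards *)
    destruct (near_continuous D r (- D r) CD) as [d1 [Hd1 K1]]; [lra|].
    assert (Da : is_derive (fun w => arc (l w)) r ((m r - l r ^ 2) * - gam (l r))).
    { apply (is_derive_comp arc l); [apply is_derive_arc|apply Dl, Hr']. }
    destruct (is_derive_near _ _ _ e Da He) as [d2 [Hd2 K2]].
    exists (Rmin d1 d2). split; [now apply Rmin_glb_lt|]. intros w Hw Hwt.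
    assert (M1 := Rmin_l d1 d2). assert (M2 := Rmin_r d1 d2).
    specialize (K1 w). specialize (K2 w). rewrite Rabs_pos_eq in K1, K2 by lra.
    specialize (K1 ltac:(lra)). specialize (K2 ltac:(lra)).
    apply Rabs_def2 in K1. apply Rabs_le_between in K2. unfold D in *.
    rewrite !pot_inside by lra.
    assert (HM : H r <= H w) by (apply (arclength_mono X H s t); tauto || lra).
    assert (Hg := gam_pos (l r)).
    assert ((m r - l r ^ 2) * - gam (l r) * (w - r) <= 0).
    { assert (0 <= (m r - l r ^ 2) * gam (l r) * (w - r)); [|lra].
      apply Rmult_le_pos; [apply Rmult_le_pos|]; lra. }
    lra.
  (* On the cone the square root is not differentiable, but [l' = m - l^2] vanishes. So [pot] at [w]
     is bounded by the detour through [l w], which has not moved to first order; [e / 2] compensates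
     the factor [2] of [detour_lip]. *)
  + assert (Da : is_derive (fun w => arc (l w)) r ((m r - l r ^ 2) * - gam (l r))).
    { apply (is_derive_comp arc l); [apply is_derive_arc|apply Dl, Hr']. }
    replace ((m r - l r ^ 2) * - gam (l r)) with 0 in Da by (unfold D in HDr; nra).
    destruct (is_derive_near _ _ _ (e / 2) Da) as [d [Hd K]]; [lra|].
    exists d. split; [assumption|]. intros w Hw Hwt.
    specialize (K w). rewrite Rabs_pos_eq in K by lra. specialize (K ltac:(lra)).
    replace (arc (l w) - arc (l r) - 0 * (w - r)) with (arc (l w) - arc (l r)) in K by ring.
    assert (K1 := pot_le (l w) (m w)). rewrite <- HX in K1 by lra.
    assert (K2 := arclength_detour X H s t r w (l w) HA). specialize (K2 ltac:(lra) ltac:(lra) ltac:(lra)).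
    assert (K3 := detour_lip (X r) (l r) (l w) (Xp r Hr')).
    rewrite (pot_inside (l r)) by (unfold D in HDr; lra).
    assert (E : detour (l r) (X r) = arc (l r)).
    { rewrite HX by assumption. replace (m r) with (l r ^ 2) by (unfold D in HDr; lra).
      apply detour_par. }
    apply Rabs_le_between in K2. apply Rabs_le_between in K3. lra.
  (* Outside the cone the increment splits in two: the tangency point moves to [mu w] with the path
     frozen at [r], which costs nothing to first order by [detour_critical]; then the path moves to
     [w] with the tangency point frozen, at the price of its arc length. *)
  + destruct (near_continuous D r (D r) CD) as [d1 [Hd1 K1]]; [lra|].
    set (mu := fun w => l w + sqrt (l w ^ 2 - m w)).
    assert (Dmu : exists k, is_derive mu r k).
    { assert (ex_derive l r) by (eexists; apply Dl, Hr').
      assert (ex_derive m r) by (apply Em, Hr'). unfold D in HDr. simpl in HDr.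
      change (ex_derive mu r). unfold mu. auto_derive. repeat split; try assumption; lra. }
    destruct Dmu as [k Dmu].
    assert (Da : is_derive (fun w => detour (mu w) (X r)) r (k * 0)).
    { apply (is_derive_comp (fun v => detour v (X r)) mu); [|assumption].
      assert (Hyr := Hy r Hr'). assert (Hq := sqrt_lt_R0 _ HDr).
      assert (Hc := detour_critical (y r) (l r) (sqrt (D r)) Hyr Hq).
      rewrite pow2_sqrt in Hc by lra.
      replace (X r) with (y r, y r * l r, y r * (l r ^ 2 - D r)); [exact Hc|].
      unfold X, D, l, m. f_equal; [f_equal|]; field; lra. }
    rewrite Rmult_0_r in Da.
    destruct (is_derive_near _ _ _ e Da He) as [d2 [Hd2 K2]].
    exists (Rmin d1 d2). split; [now apply Rmin_glb_lt|]. intros w Hw Hwt.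
    assert (M1 := Rmin_l d1 d2). assert (M2 := Rmin_r d1 d2).
    specialize (K1 w). specialize (K2 w). rewrite Rabs_pos_eq in K1, K2 by lra.
    specialize (K1 ltac:(lra)). specialize (K2 ltac:(lra)).
    apply Rabs_def2 in K1. apply Rabs_le_between in K2. unfold D in *.
    rewrite !pot_outside by lra. fold (mu w). fold (mu r). rewrite <- !HX by lra.
    assert (K3 := arclength_detour X H s t r w (mu w) HA). specialize (K3 ltac:(lra) ltac:(lra) ltac:(lra)).
    apply Rabs_le_between in K3. lra.
Qed.

(** * The gain over one arch *)

(** Dividing [par m] by [m ^ 2] gives [((/ m) ^ 2, / m, 1)], which tends to [(0, 0, 1)] without
    changing angles, while [arc m] tends to [- (L_Omega / 2)]. *)
Lemma detour_limit (x : V3) (e : R) : 0 < dot x x -> 0 < e ->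
  exists M, forall m, M <= m -> detour m x <= - (L_Omega / 2) + ang (0, 0, 1) x + e.
Proof.
intros Hx He. destruct (arc_lim (e / 2)) as [M1 H1]; [lra|].
assert (C : continuous (fun k => ang (k ^ 2, k, 1) x) 0).
{ destruct x as [[a b] c].
  apply (continuous_ang (fun k => k ^ 2) (fun k => k) (fun _ => 1) (fun _ => a)
    (fun _ => b) (fun _ => c)); try apply continuous_Rconst; try apply continuous_Rid; try assumption.
  - apply continuous_Rpow, continuous_Rid.
  - apply dot_pos. right; right. unfold pz; simpl; lra. }
destruct (near_continuous _ _ (e / 2) C) as [d [Hd K]]; [lra|].
exists (Rmax M1 (2 / d)). intros m Hm.
assert (Hm1 : M1 <= m) by (eapply Rle_trans; [apply Rmax_l|exact Hm]).
assert (Hm2 : 2 / d <= m) by (eapply Rle_trans; [apply Rmax_r|exact Hm]).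
assert (Hd2 : 0 < 2 / d) by (apply Rdiv_lt_0_compat; lra).
specialize (H1 m Hm1). specialize (K (/ m)).
assert (Hm0 : 0 < m) by lra.
assert (Hi : / m <= d / 2).
{ replace (d / 2) with (/ (2 / d)) by (field; lra). apply Rinv_le_contravar; lra. }
assert (0 < / m) by (apply Rinv_0_lt_compat; lra).
rewrite Rminus_0_r, Rabs_pos_eq in K by lra. specialize (K ltac:(lra)).
apply Rabs_def2 in K. cbv beta in K. replace (0 ^ 2) with 0 in K by ring.
destruct K as [K _]. change (ang ((/ m) ^ 2, / m, 1) x - ang (0, 0, 1) x < e / 2) in K.
unfold detour. replace (ang (par m) x) with (ang ((/ m) ^ 2, / m, 1) x); [lra|].
rewrite (ang_comm _ x), (ang_comm _ x).
rewrite <- (ang_scale x ((/ m) ^ 2, / m, 1) (m ^ 2)) by (apply pow_lt; assumption).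
unfold px, py, pz, par; simpl. f_equal. f_equal; [f_equal|]; field; lra.
Qed.

(* If [y'/y] stayed below [M], then [y * exp (- M t)] could not leave [0]. *)
Lemma log_derivative_unbounded (y y1 : R -> R) (p t M : R) : p < t ->
  (forall r, p <= r <= t -> is_derive y r (y1 r)) -> y p = 0 ->
  (forall r, p < r < t -> 0 < y r) ->
  exists s, p < s < t /\ M <= y1 s / y s.
Proof.
intros Hpt HD H0 Hy. apply NNPP. intros Hn.
assert (Hl : forall s, p < s < t -> y1 s < M * y s).
{ intros s Hs. apply Rnot_le_lt. intros Hle. apply Hn. exists s. split; [assumption|].
  specialize (Hy s Hs). apply Rle_div_r; lra. }
set (f := fun r => y r * exp (- M * r)).
set (f' := fun r => (y1 r - M * y r) * exp (- M * r)).
destruct (MVT_cor2 f f' p ((p + t) / 2)) as [c [Hc Hc']]; [lra| |].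
- intros r Hr. apply is_derive_Reals. unfold f, f'.
  assert (D := HD r ltac:(lra)). auto_derive; [eexists; eassumption|]. der_rw. ring.
- unfold f in Hc. rewrite H0 in Hc. unfold f' in Hc.
  assert (K1 := Hl c ltac:(lra)). assert (K2 := exp_pos (- M * c)).
  assert (K3 := Hy ((p + t) / 2) ltac:(lra)). assert (K4 := exp_pos (- M * ((p + t) / 2))).
  assert (0 < y ((p + t) / 2) * exp (- M * ((p + t) / 2))) by now apply Rmult_lt_0_compat.
  assert (0 < (M * y c - y1 c) * exp (- M * c) * ((p + t) / 2 - p)).
  { repeat apply Rmult_lt_0_compat; lra. }
  lra.
Qed.

Lemma derivs_continuous (y y1 y2 y3 : R -> R) (p q t : R) : derivs_on y y1 y2 y3 p q ->
  p <= t <= q -> continuous y t /\ continuous y1 t /\ continuous y2 t.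
Proof.
intros HD Ht. destruct (HD t Ht) as (D0 & D1 & D2).
repeat split; apply (ex_derive_continuous (V := R_NormedModule)); eexists; eassumption.
Qed.

(** No limit of [pot] at [p] is taken. At some [s] the longitude is large; the detour through that
    single tangency point is compared at [p] and at [s], and [pot_step] covers the rest of the way
    to [t]. *)
Lemma positive_arch_start (y y1 y2 y3 H : R -> R) (p q t : R) : p < t < q ->
  derivs_on y y1 y2 y3 p q -> (forall r, p < r < q -> 0 < y r) -> y p = 0 ->
  arclength_on (fun r => (y r, y1 r, y2 r)) H p q -> 0 < dot (y p, y1 p, y2 p) (y p, y1 p, y2 p) ->
  pot (y1 t / y t) (y2 t / y t) + L_Omega / 2 - ang (0, 0, 1) (y p, y1 p, y2 p) <= H t - H p.
Proof.
intros Ht HD Hy Hp HA Hx. apply le_epsilon. intros e He.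
destruct (detour_limit _ e Hx He) as [M HM].
destruct (log_derivative_unbounded y y1 p t M) as [s [Hs Hl]]; [lra| |assumption| |].
- intros r Hr. apply (HD r). lra.
- intros r Hr. apply Hy. lra.
- specialize (HM _ Hl).
  assert (K1 := pot_le (y1 s / y s) (y2 s / y s)).
  rewrite <- detour_state in K1 by (apply Hy; lra).
  assert (K2 := arclength_detour _ H p q p s (y1 s / y s) HA). specialize (K2 ltac:(lra) ltac:(lra) ltac:(lra)).
  apply Rabs_le_between in K2.
  assert (K3 : pot (y1 t / y t) (y2 t / y t) - pot (y1 s / y s) (y2 s / y s) <= H t - H s).
  { apply (pot_step y y1 y2 y3); [lra| | |].
    - intros r Hr. apply HD. lra.
    - intros r Hr. apply Hy. lra.
    - intros a u v Ha H1 H2 H3. apply HA; lra. }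
  lra.
Qed.

Lemma positive_arch_simple (y y1 y2 y3 H : R -> R) (p q : R) : p < q ->
  derivs_on y y1 y2 y3 p q -> (forall r, p < r < q -> 0 < y r) -> y p = 0 -> y q = 0 ->
  arclength_on (fun r => (y r, y1 r, y2 r)) H p q -> 0 < dot (y p, y1 p, y2 p) (y p, y1 p, y2 p) ->
  y1 q < 0 ->
  detour (y2 q / (2 * y1 q)) (y q, y1 q, y2 q) + L_Omega / 2
    - ang (0, 0, 1) (y p, y1 p, y2 p) <= H q - H p.
Proof.
intros Hpq HD Hy Hp Hq HA Hx H1. apply le_epsilon. intros e He.
set (X := fun r => (y r, y1 r, y2 r)) in *.
destruct (derivs_continuous y y1 y2 y3 p q q HD) as (C0 & C1 & C2); [lra|].
set (D := fun r => y1 r ^ 2 - y r * y2 r).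
assert (CD : continuous D q) by (apply continuous_Rminus; [now apply continuous_Rpow|now apply continuous_Rmult]).
(* The tangency point [(y1 + sqrt D) / y] becomes [0 / 0] at a downward simple zero. Multiplying by
   the conjugate gives this form, continuous at [q] with value [y2 / (2 * y1)], the one used in
   [zero_pot]. *)
set (mu := fun r => y2 r / (y1 r - sqrt (D r))).
assert (Dq : D q = y1 q ^ 2) by (unfold D; rewrite Hq; ring).
assert (Sq : sqrt (D q) = - y1 q).
{ rewrite Dq. replace (y1 q ^ 2) with ((- y1 q) ^ 2) by ring. apply sqrt_pow2. lra. }
assert (Cmu : continuous mu q).
{ unfold mu, Rdiv. apply continuous_Rmult; [assumption|].
  apply (continuous_Rinv_comp (fun r => y1 r - sqrt (D r))); [|lra].
  apply continuous_Rminus; [assumption|now apply continuous_sqrt_comp]. }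
assert (Xq : 0 < dot (X q) (X q)) by (apply dot_pos; right; left; unfold X, py; simpl; lra).
assert (Ch := continuous_detour mu (X q) q Xq Cmu).
destruct (near_continuous _ _ e Ch He) as [d1 [Hd1 K1]].
destruct (near_continuous y1 q (- y1 q) C1) as [d2 [Hd2 K2]]; [lra|].
destruct (near_continuous D q (D q) CD) as [d3 [Hd3 K3]]; [nra|].
set (d := Rmin d1 (Rmin d2 d3)).
assert (Hd : 0 < d) by (repeat apply Rmin_glb_lt; assumption).
assert (E1 : d <= d1) by apply Rmin_l.
assert (E2 : d <= d2) by (eapply Rle_trans; [apply Rmin_r|apply Rmin_l]).
assert (E3 : d <= d3) by (eapply Rle_trans; [apply Rmin_r|apply Rmin_r]).
set (t := Rmax ((p + q) / 2) (q - d / 2)).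
assert (Ht : (p + q) / 2 <= t /\ q - d / 2 <= t) by (split; [apply Rmax_l|apply Rmax_r]).
assert (Ht' : t < q) by (apply Rmax_lub_lt; lra).
assert (Ha : Rabs (t - q) < d) by (apply Rabs_def1; lra).
specialize (K1 t ltac:(lra)). specialize (K2 t ltac:(lra)). specialize (K3 t ltac:(lra)).
apply Rabs_def2 in K1. apply Rabs_def2 in K2. apply Rabs_def2 in K3.
assert (K4 := positive_arch_start y y1 y2 y3 H p q t ltac:(lra) HD Hy Hp HA Hx).
assert (Hyt : 0 < y t) by (apply Hy; lra).
assert (ED : (y1 t / y t) ^ 2 - y2 t / y t = D t / (y t) ^ 2) by (unfold D; field; lra).
assert (HDt : 0 < D t) by lra.
assert (Hp2 : 0 < y t ^ 2) by nra.
rewrite pot_outside in K4.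
2:{ rewrite ED. left. now apply Rdiv_lt_0_compat. }
rewrite ED, sqrt_div_alt, sqrt_pow2 in K4 by lra.
rewrite <- detour_state in K4 by assumption.
assert (Hs := sqrt_lt_R0 _ HDt). assert (Hss := sqrt_sqrt _ (Rlt_le _ _ HDt)).
assert (Em : y1 t / y t + sqrt (D t) / y t = mu t).
{ unfold mu. assert (y1 t - sqrt (D t) <> 0) by lra.
  replace (y2 t) with ((y1 t ^ 2 - sqrt (D t) * sqrt (D t)) / y t)
    by (rewrite Hss; unfold D; field; lra).
  field. split; lra. }
rewrite Em in K4. fold (X t) in K4.
assert (K5 := arclength_detour X H p q t q (mu t) HA). specialize (K5 ltac:(lra) ltac:(lra) ltac:(lra)).
apply Rabs_le_between in K5.
assert (Eq : mu q = y2 q / (2 * y1 q)) by (unfold mu; rewrite Sq; f_equal; ring).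
rewrite Eq in K1. fold (X q). fold (X p) in K4. fold (X p). lra.
Qed.

(** Just before such a zero [y' <= 0 < y''], so the tangency point has passed [par 0] and the string
    length is nonnegative. The bound [0] suffices, since [zero_pot] vanishes in the direction
    [(0, 0, 1)]. *)
Lemma positive_arch_double (y y1 y2 y3 H : R -> R) (p q : R) : p < q ->
  derivs_on y y1 y2 y3 p q -> (forall r, p < r < q -> 0 < y r) -> y p = 0 ->
  arclength_on (fun r => (y r, y1 r, y2 r)) H p q -> 0 < dot (y p, y1 p, y2 p) (y p, y1 p, y2 p) ->
  y1 q = 0 -> 0 < y2 q ->
  L_Omega / 2 - ang (0, 0, 1) (y p, y1 p, y2 p) <= H q - H p.
Proof.
intros Hpq HD Hy Hp HA Hx H1 H2.
destruct (derivs_continuous y y1 y2 y3 p q q HD) as (C0 & C1 & C2); [lra|].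
destruct (near_continuous y2 q (y2 q) C2 H2) as [d [Hd K]].
set (t := Rmax ((p + q) / 2) (q - d / 2)).
assert (Ht : (p + q) / 2 <= t /\ q - d / 2 <= t) by (split; [apply Rmax_l|apply Rmax_r]).
assert (Ht' : t < q) by (apply Rmax_lub_lt; lra).
assert (Kp : forall r, t <= r <= q -> 0 < y2 r).
{ intros r Hr. specialize (K r). assert (Ha : Rabs (r - q) < d) by (apply Rabs_def1; lra).
  apply K in Ha. apply Rabs_def2 in Ha. lra. }
assert (Y1 : y1 t <= 0).
{ rewrite <- H1. apply (nondecreasing_of_derive y1 y2); [lra| |].
  - intros r Hr. apply HD. lra.
  - intros r Hr. left. now apply Kp. }
assert (K4 := positive_arch_start y y1 y2 y3 H p q t ltac:(lra) HD Hy Hp HA Hx).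
assert (Hyt : 0 < y t) by (apply Hy; lra). assert (Y2 := Kp t ltac:(lra)).
assert (Hl : y1 t / y t <= 0) by (apply Rle_div_l; lra).
assert (Hm : 0 < y2 t / y t) by now apply Rdiv_lt_0_compat.
assert (K5 : 0 <= pot (y1 t / y t) (y2 t / y t)).
{ apply pot_ge. set (l := y1 t / y t) in *. set (m := y2 t / y t) in *.
  assert (sqrt (Rmax (l ^ 2 - m) 0) <= sqrt ((- l) ^ 2)).
  { apply sqrt_le_1_alt. apply Rmax_lub; nra. }
  rewrite sqrt_pow2 in H0 by lra. lra. }
assert (H t <= H q) by (apply (arclength_mono _ H p q t q HA); lra). lra.
Qed.

(* At an upward zero the taut string starts afresh from [(0, 0, 1)], hence the two branches. *)
Definition zero_pot (x : V3) : R :=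
  if Rle_dec 0 (py x) then ang (0, 0, 1) x else detour (pz x / (2 * py x)) x.

Lemma sign_at_left_end (y y1 y2 y3 : R -> R) (p q : R) : p < q ->
  derivs_on y y1 y2 y3 p q -> (forall r, p < r < q -> 0 < y r) -> y p = 0 ->
  0 <= y1 p /\ (y1 p = 0 -> 0 <= y2 p).
Proof.
intros Hpq HD Hy Hp.
destruct (derivs_continuous y y1 y2 y3 p q p HD) as (C0 & C1 & C2); [lra|].
assert (A : forall d, 0 < d -> exists c, p < c < q /\ c < p + d /\ 0 < y1 c).
{ intros d Hd. set (t := Rmin ((p + q) / 2) (p + d / 2)).
  assert (Ht : t <= (p + q) / 2 /\ t <= p + d / 2) by (split; [apply Rmin_l|apply Rmin_r]).
  assert (Ht' : p < t) by (apply Rmin_glb_lt; lra).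
  destruct (MVT_cor2 y y1 p t Ht') as [c [Hc Hc']].
  - intros c Hc. apply is_derive_Reals, HD. lra.
  - exists c. rewrite Hp in Hc. assert (K := Hy t ltac:(lra)).
    repeat split; try lra. apply Rnot_le_lt. intros Hn.
    assert (0 <= - y1 c * (t - p)) by (apply Rmult_le_pos; lra). lra. }
split.
- apply Rnot_lt_le. intros Hn. destruct (near_continuous y1 p (- y1 p) C1) as [d [Hd K]]; [lra|].
  destruct (A d Hd) as [c (H1 & H2 & H3)]. specialize (K c).
  rewrite Rabs_pos_eq in K by lra. specialize (K ltac:(lra)). apply Rabs_def2 in K. lra.
- intros E. apply Rnot_lt_le. intros Hn.
  destruct (near_continuous y2 p (- y2 p) C2) as [d [Hd K]]; [lra|].
  destruct (A d Hd) as [c (H1 & H2 & H3)].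
  destruct (MVT_cor2 y1 y2 p c) as [c' [Hc Hc']]; [lra| |].
  + intros r Hr. apply is_derive_Reals, HD. lra.
  + specialize (K c'). rewrite Rabs_pos_eq in K by lra. specialize (K ltac:(lra)).
    apply Rabs_def2 in K. rewrite E in Hc.
    assert (0 <= - y2 c' * (c - p)) by (apply Rmult_le_pos; lra). lra.
Qed.

Lemma is_derive_reflect (f : R -> R) (t l : R) : is_derive f (- t) l ->
  is_derive (fun s => f (- s)) t (- l).
Proof.
intros H. replace (- l) with (-1 * l) by ring.
apply (is_derive_ext (fun s => f (-1 * s + 0))).
- intros s. f_equal. ring.
- apply is_derive_affine. now replace (-1 * t + 0) with (- t) by ring.
Qed.

Lemma derivs_reflect (y y1 y2 y3 : R -> R) (p q : R) : derivs_on y y1 y2 y3 p q ->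
  derivs_on (fun t => - y (- t)) (fun t => y1 (- t)) (fun t => - y2 (- t))
    (fun t => y3 (- t)) (- q) (- p).
Proof.
intros HD t Ht. destruct (HD (- t)) as (D0 & D1 & D2); [lra|].
refine (conj _ (conj _ _)).
- rewrite <- (Ropp_involutive (y1 (- t))).
  apply (is_derive_opp (fun s => y (- s))). now apply is_derive_reflect.
- now apply is_derive_reflect.
- rewrite <- (Ropp_involutive (y3 (- t))).
  apply (is_derive_opp (fun s => y2 (- s))). now apply is_derive_reflect.
Qed.

(** Up to reversal of time, the reflected path is the image of the old one under the isometry that
    negates the first and third coordinates; the isometry is moved onto the test vector. *)
Lemma arclength_reflect (y y1 y2 H : R -> R) (p q : R) :
  arclength_on (fun r => (y r, y1 r, y2 r)) H p q ->
  arclength_on (fun r => (- y (- r), y1 (- r), - y2 (- r))) (fun t => - H (- t)) (- q) (- p).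
Proof.
intros HA a s t Ha H1 H2 H3.
set (a' := (- px a, py a, - pz a)).
assert (E : forall r, ang a (- y (- r), y1 (- r), - y2 (- r)) = ang a' (y (- r), y1 (- r), y2 (- r))).
{ intros r. unfold a'. apply ang_isom; v3; ring. }
rewrite !E, Rabs_minus_sym.
replace (- H (- t) - - H (- s)) with (H (- s) - H (- t)) by ring.
apply HA; try lra. replace (dot a' a') with (dot a a); [assumption|]. unfold a'. v3; ring.
Qed.

Lemma sign_at_right_end (y y1 y2 y3 : R -> R) (p q : R) : p < q ->
  derivs_on y y1 y2 y3 p q -> (forall r, p < r < q -> 0 < y r) -> y q = 0 ->
  y1 q <= 0 /\ (y1 q = 0 -> 0 <= y2 q).
Proof.
intros Hpq HD Hy Hq.
assert (HD' : derivs_on (fun t => y (- t)) (fun t => - y1 (- t)) (fun t => y2 (- t))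
  (fun t => - y3 (- t)) (- q) (- p)).
{ intros t Ht. destruct (HD (- t)) as (D0 & D1 & D2); [lra|].
  refine (conj _ (conj _ _)); [now apply is_derive_reflect| |now apply is_derive_reflect].
  rewrite <- (Ropp_involutive (y2 (- t))).
  apply (is_derive_opp (fun s => y1 (- s))). now apply is_derive_reflect. }
destruct (sign_at_left_end _ _ _ _ (- q) (- p) ltac:(lra) HD') as [K1 K2].
- intros r Hr. apply Hy. lra.
- now rewrite Ropp_involutive.
- rewrite !Ropp_involutive in *. split; [lra|]. intros E. apply K2. lra.
Qed.

Lemma positive_arch (y y1 y2 y3 H : R -> R) (p q : R) : p < q ->
  let X := fun r => (y r, y1 r, y2 r) in
  derivs_on y y1 y2 y3 p q -> (forall r, p < r < q -> 0 < y r) -> y p = 0 -> y q = 0 ->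
  arclength_on X H p q -> 0 < dot (X p) (X p) -> 0 < dot (X q) (X q) ->
  zero_pot (X q) - zero_pot (X p) + L_Omega / 2 <= H q - H p.
Proof.
intros Hpq X HD Hy Hp Hq HA Xp Xq.
destruct (sign_at_left_end y y1 y2 y3 p q Hpq HD Hy Hp) as [S1 S2].
destruct (sign_at_right_end y y1 y2 y3 p q Hpq HD Hy Hq) as [S3 S4].
assert (E : zero_pot (X p) = ang (0, 0, 1) (X p)).
{ unfold zero_pot. now destruct (Rle_dec 0 (py (X p))). }
rewrite E. unfold zero_pot. destruct (Rle_dec 0 (py (X q))) as [H1|H1]; unfold X, py, pz in H1 |- *; simpl in *.
- assert (E1 : y1 q = 0) by lra. specialize (S4 E1).
  assert (y2 q <> 0).
  { intros E2. unfold X in Xq. rewrite Hq, E1, E2 in Xq. v3. lra. }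
  assert (K := positive_arch_double y y1 y2 y3 H p q Hpq HD Hy Hp HA Xp E1 ltac:(lra)).
  replace (ang (0, 0, 1) (y q, y1 q, y2 q)) with 0; [unfold X in K; lra|].
  rewrite Hq, E1. transitivity (ang (0, 0, 1) (0, 0, 1)).
  { symmetry. apply ang_self. v3. lra. }
  rewrite <- (ang_scale (0, 0, 1) (0, 0, 1) (y2 q)) by lra.
  unfold px, py, pz; simpl. now rewrite Rmult_0_r, Rmult_1_r.
- assert (K := positive_arch_simple y y1 y2 y3 H p q Hpq HD Hy Hp Hq HA Xp ltac:(lra)).
  unfold X in *; lra.
Qed.

(** A potential compatible with time reversal must change sign up to a constant. Here [arc] is odd
    and the angles become supplementary; the constant [PI] cancels in differences, so negative
    arches obey the inequality of positive ones. *)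
Lemma zero_pot_reflect (b c : R) : zero_pot (0, b, - c) = PI - zero_pot (0, b, c).
Proof.
unfold zero_pot, py, pz; simpl. destruct (Rle_dec 0 b).
- rewrite (ang_opp (0, 0, 1) (0, b, c)); [reflexivity| |]; v3; ring.
- replace (- c / (2 * b)) with (- (c / (2 * b))) by (field; lra).
  set (l := c / (2 * b)). unfold detour. rewrite arc_opp.
  rewrite (ang_opp (par (- l)) (0, - b, c)); [|unfold par; v3; ring..].
  rewrite (ang_isom (par (- l)) (0, - b, c) (par l) (0, b, c)); [|unfold par; v3; ring..].
  ring.
Qed.

Lemma nonzero_sign (y : R -> R) (p q : R) : (forall r, continuous y r) ->
  (forall r, p < r < q -> y r <> 0) ->
  (forall r, p < r < q -> 0 < y r) \/ (forall r, p < r < q -> y r < 0).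
Proof.
intros Cy Hy. destruct (classic (exists u, p < u < q /\ 0 < y u)) as [[u [Hu Yu]]|Hn].
- left. intros r Hr. destruct (Rtotal_order (y r) 0) as [K|[K|K]];
    [|now destruct (Hy r Hr)|assumption].
  exfalso. destruct (IVT_gen y u r 0) as [x [Hx E]].
  + intros x. apply continuity_pt_filterlim, Cy.
  + rewrite Rmin_right, Rmax_left by lra. lra.
  + apply (Hy x); [|assumption].
    assert (p < Rmin u r) by (apply Rmin_glb_lt; lra).
    assert (Rmax u r < q) by (apply Rmax_lub_lt; lra). lra.
- right. intros r Hr. assert (K := Hy r Hr). apply Rnot_le_lt. intros Hle.
  apply Hn. exists r. lra.
Qed.

Lemma arch_gain (y y1 y2 y3 H : R -> R) (p q : R) : p < q ->
  let X := fun r => (y r, y1 r, y2 r) in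
  (forall r, continuous y r) ->
  derivs_on y y1 y2 y3 p q -> (forall r, p < r < q -> y r <> 0) -> y p = 0 -> y q = 0 ->
  arclength_on X H p q -> 0 < dot (X p) (X p) -> 0 < dot (X q) (X q) ->
  zero_pot (X q) - zero_pot (X p) + L_Omega / 2 <= H q - H p.
Proof.
intros Hpq X Cy HD Hy Hp Hq HA Xp Xq.
destruct (nonzero_sign y p q Cy Hy) as [S|S].
- now apply (positive_arch y y1 y2 y3).
- assert (K := positive_arch (fun t => - y (- t)) (fun t => y1 (- t)) (fun t => - y2 (- t))
    (fun t => y3 (- t)) (fun t => - H (- t)) (- q) (- p) ltac:(lra)).
  assert (K1 := arclength_reflect y y1 y2 H p q HA).
  specialize (K (derivs_reflect y y1 y2 y3 p q HD)).
  cbv beta zeta in K. rewrite !Ropp_involutive, Hp, Hq, !Ropp_0 in K.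
  rewrite !zero_pot_reflect in K.
  assert (N : forall b c, dot (0, b, - c) (0, b, - c) = dot (0, b, c) (0, b, c))
    by (intros; v3; ring).
  rewrite !N in K. unfold X in *. rewrite Hp in Xp |- *. rewrite Hq in Xq |- *.
  enough (PI - zero_pot (0, y1 p, y2 p) - (PI - zero_pot (0, y1 q, y2 q)) + L_Omega / 2 <=
    - H p - - H q) by lra.
  apply K; try assumption; try reflexivity.
  intros r Hr. assert (y (- r) < 0) by (apply S; lra). lra.
Qed.

Lemma zero_pot_bound (x : V3) : Rabs (zero_pot x) <= PI + L_Omega.
Proof.
assert (HL : forall m, Rabs (arc m) <= L_Omega / 2).
{ intros m. assert (K1 := arc_gt m). assert (K2 := arc_gt (- m)). rewrite arc_opp in K2.
  apply Rabs_le. lra. }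
assert (HP := PI_RGT_0).
assert (0 <= L_Omega) by (specialize (HL 0); generalize (Rabs_pos (arc 0)); lra).
unfold zero_pot, detour. destruct (Rle_dec 0 (py x)) as [K|K].
- rewrite Rabs_pos_eq by apply ang_ge0. generalize (ang_lePI (0, 0, 1) x). lra.
- set (m := pz x / (2 * py x)). eapply Rle_trans; [apply Rabs_triang|].
  specialize (HL m). rewrite (Rabs_pos_eq (ang _ _)) by apply ang_ge0.
  generalize (ang_lePI (par m) x). lra.
Qed.

(** * Upper and lower limits *)

Lemma Rbar_glb_correct (E : Rbar -> Prop) : Rbar_is_glb E (Rbar_glb E).
Proof. unfold Rbar_glb. now destruct (Rbar_ex_glb E). Qed.

Lemma Rbar_lub_correct (E : Rbar -> Prop) : Rbar_is_lub E (Rbar_lub E).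
Proof. unfold Rbar_lub. now destruct (Rbar_ex_lub E). Qed.

Lemma Limsup_le_of_eventually (g : R -> Rbar) (T : R) (M : Rbar) :
  (forall t, T <= t -> Rbar_le (g t) M) -> Rbar_le (Limsup_infty g) M.
Proof.
intros H. apply Rbar_le_trans with (Rbar_lub (fun v => exists t, T <= t /\ v = g t)).
- apply (proj1 (Rbar_glb_correct _)). now exists T.
- apply (proj2 (Rbar_lub_correct _)). intros v [t [Ht ->]]. now apply H.
Qed.

Lemma Limsup_lt_eventually (g : R -> Rbar) (M : Rbar) :
  Rbar_lt (Limsup_infty g) M -> exists T, forall t, T <= t -> Rbar_le (g t) M.
Proof.
intros H. apply NNPP. intros Hn. apply (Rbar_lt_not_le _ _ H).
apply (proj2 (Rbar_glb_correct _)). intros v [T ->].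
apply Rbar_not_lt_le. intros Hlt. apply Hn. exists T. intros t Ht.
apply Rbar_le_trans with (Rbar_lub (fun v => exists t, T <= t /\ v = g t)).
- apply (proj1 (Rbar_lub_correct _)). now exists t.
- now apply Rbar_lt_le.
Qed.

Lemma Liminf_ge_of_eventually (g : R -> Rbar) (T : R) (M : Rbar) :
  (forall t, T <= t -> Rbar_le M (g t)) -> Rbar_le M (Liminf_infty g).
Proof.
intros H. apply Rbar_le_trans with (Rbar_glb (fun v => exists t, T <= t /\ v = g t)).
- apply (proj2 (Rbar_glb_correct _)). intros v [t [Ht ->]]. now apply H.
- apply (proj1 (Rbar_lub_correct _)). now exists T.
Qed.

Lemma Liminf_gt_eventually (g : R -> Rbar) (M : Rbar) :
  Rbar_lt M (Liminf_infty g) -> exists T, forall t, T <= t -> Rbar_le M (g t).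
Proof.
intros H. apply NNPP. intros Hn. apply (Rbar_lt_not_le _ _ H).
apply (proj2 (Rbar_lub_correct _)). intros v [T ->].
apply Rbar_not_lt_le. intros Hlt. apply Hn. exists T. intros t Ht.
apply Rbar_le_trans with (Rbar_glb (fun v => exists t, T <= t /\ v = g t)).
- now apply Rbar_lt_le.
- apply (proj1 (Rbar_glb_correct _)). now exists t.
Qed.

Lemma Liminf_le_Limsup (g : R -> Rbar) : Rbar_le (Liminf_infty g) (Limsup_infty g).
Proof.
apply (proj2 (Rbar_lub_correct _)). intros v [T ->].
apply (proj2 (Rbar_glb_correct _)). intros w [T' ->].
apply Rbar_le_trans with (g (Rmax T T')).
- apply (proj1 (Rbar_glb_correct _)). exists (Rmax T T'). split; [apply Rmax_l|easy].
- apply (proj1 (Rbar_lub_correct _)). exists (Rmax T T'). split; [apply Rmax_r|easy].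
Qed.

Lemma Rbar_le_of_reals (u v : Rbar) :
  (forall M : R, Rbar_lt v M -> Rbar_le u M) -> Rbar_le u v.
Proof.
intros H. destruct v as [v| |].
- destruct u as [u| |]; simpl.
  + apply le_epsilon. intros e He. apply (H (v + e)). simpl. lra.
  + apply (H (v + 1)). simpl. lra. + easy.
- destruct u; easy.
- destruct u as [u| |]; simpl; [|apply (H 0); easy|easy].
  assert (K := H (u - 1)). simpl in K. assert (u <= u - 1) by now apply K. lra.
Qed.

Lemma Rbar_le_of_reals_below (u v : Rbar) :
  (forall M : R, Rbar_lt M u -> Rbar_le M v) -> Rbar_le u v.
Proof.
intros H. apply Rbar_opp_le. apply Rbar_le_of_reals. intros M HM.
rewrite <- (Rbar_opp_involutive M). apply Rbar_opp_le. apply (H (- M)).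
change (Rbar_lt (Rbar_opp M) u). rewrite <- (Rbar_opp_involutive u). now apply Rbar_opp_lt.
Qed.

Lemma Rbar_mult_pos_le (k : R) (l : Rbar) (M : R) : 0 < k ->
  Rbar_le l (M / k) -> Rbar_le (Rbar_mult k l) M.
Proof.
intros Hk. destruct l as [l| |]; simpl; [|easy|].
- intros H. apply (Rmult_le_compat_l k) in H; [|lra].
  replace (k * (M / k)) with M in H by (field; lra). exact H.
- intros _. destruct (Rle_dec 0 k) as [H|H]; [|lra].
  destruct (Rle_lt_or_eq_dec 0 k H); [easy|lra].
Qed.

Lemma Rbar_mult_pos_lt (k : R) (l : Rbar) (M : R) : 0 < k ->
  Rbar_lt M (Rbar_mult k l) -> Rbar_lt (M / k) l.
Proof.
intros Hk. destruct l as [l| |]; simpl; [|easy|].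
- intros H. apply Rlt_div_l; [lra|]. lra.
- destruct (Rle_dec 0 k) as [H|H]; [|lra].
  destruct (Rle_lt_or_eq_dec 0 k H); [easy|lra].
Qed.

Lemma eventually_small (C e : R) : 0 < e -> exists T, 0 < T /\ forall t, T <= t -> C / t <= e.
Proof.
intros He. exists (Rmax 1 (C / e)).
assert (H1 := Rmax_l 1 (C / e)). assert (H2 := Rmax_r 1 (C / e)).
split; [lra|]. intros t Ht. apply Rle_div_l; [lra|].
assert (K : C / e <= t) by lra. apply Rle_div_l in K; lra.
Qed.

(** An error bounded by [C] before division by [t] disappears in the limit; testing against real
    bounds [M < M'] treats infinite limits on the same footing. *)
Lemma Limsup_compare (g1 g2 : R -> Rbar) (a b : R -> R) (k C : R) : 0 < k ->
  (forall t, 0 < t -> g1 t = Finite (a t) /\ g2 t = Finite (b t) /\ k * a t <= b t + C / t) ->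
  Rbar_le (Rbar_mult k (Limsup_infty g1)) (Limsup_infty g2).
Proof.
intros Hk H. apply Rbar_le_of_reals. intros M HM.
destruct (Limsup_lt_eventually _ _ HM) as [T HT].
apply Rbar_le_of_reals. intros M' HM'. simpl in HM'.
destruct (eventually_small C (M' - M)) as [T' [HT0 HT']]; [lra|].
apply Rbar_mult_pos_le; [assumption|].
apply (Limsup_le_of_eventually _ (Rmax T T')). intros t Ht.
assert (H1 := Rmax_l T T'). assert (H2 := Rmax_r T T').
destruct (H t) as (E1 & E2 & K); [lra|]. rewrite E1. specialize (HT t ltac:(lra)).
rewrite E2 in HT. simpl in HT |- *. specialize (HT' t ltac:(lra)).
apply Rle_div_r; [assumption|]. lra.
Qed.

Lemma Liminf_compare (g1 g2 : R -> Rbar) (a b : R -> R) (k C : R) : 0 < k ->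
  (forall t, 0 < t -> g1 t = Finite (a t) /\ g2 t = Finite (b t) /\ k * a t <= b t + C / t) ->
  Rbar_le (Rbar_mult k (Liminf_infty g1)) (Liminf_infty g2).
Proof.
intros Hk H. apply Rbar_le_of_reals_below. intros M HM.
apply Rbar_mult_pos_lt in HM; [|assumption].
destruct (Liminf_gt_eventually _ _ HM) as [T HT].
apply Rbar_le_of_reals_below. intros M' HM'. simpl in HM'.
destruct (eventually_small C (M - M')) as [T' [HT0 HT']]; [lra|].
apply (Liminf_ge_of_eventually _ (Rmax T T')). intros t Ht.
assert (H1 := Rmax_l T T'). assert (H2 := Rmax_r T T').
destruct (H t) as (E1 & E2 & K); [lra|]. rewrite E2. specialize (HT t ltac:(lra)).
rewrite E1 in HT. simpl in HT |- *. specialize (HT' t ltac:(lra)).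
apply Rle_div_l in HT; [|assumption]. lra.
Qed.

Lemma Lim_infty_of_bounded (g : R -> Rbar) (a : R -> R) (l C : R) :
  (forall t, 0 < t -> g t = Finite (a t) /\ Rabs (a t - l) <= C / t) ->
  Liminf_infty g = Finite l /\ Limsup_infty g = Finite l.
Proof.
intros H.
assert (K1 : Rbar_le (Limsup_infty g) l).
{ apply Rbar_le_of_reals. intros M HM. simpl in HM.
  destruct (eventually_small C (M - l)) as [T [HT0 HT]]; [lra|].
  apply (Limsup_le_of_eventually _ T). intros t Ht. specialize (HT t Ht).
  destruct (H t) as [-> K]; [lra|]. apply Rabs_le_between in K. simpl. lra. }
assert (K2 : Rbar_le l (Liminf_infty g)).
{ apply Rbar_le_of_reals_below. intros M HM. simpl in HM.
  destruct (eventually_small C (l - M)) as [T [HT0 HT]]; [lra|].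
  apply (Liminf_ge_of_eventually _ T). intros t Ht. specialize (HT t Ht).
  destruct (H t) as [-> K]; [lra|]. apply Rabs_le_between in K. simpl. lra. }
assert (K3 := Liminf_le_Limsup g).
split; apply Rbar_le_antisym; try assumption; eapply Rbar_le_trans; eassumption.
Qed.

Lemma nu_count_finite (y : R -> R) (t M : R) :
  (forall l, NoDup l -> (forall s, In s l -> 0 <= s <= t /\ y s = 0) -> INR (length l) <= M) ->
  exists N, nu_count y t = Finite N /\ N <= M /\
  forall l, NoDup l -> (forall s, In s l -> 0 <= s <= t /\ y s = 0) -> INR (length l) <= N.
Proof.
intros H. unfold nu_count. match goal with |- context [Rbar_lub ?F] => set (E := F) end.
destruct (Rbar_lub_correct E) as [U L].
assert (K1 : Rbar_le (Rbar_lub E) M).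
{ apply L. intros m (l & N & Hl & ->). now apply H. }
(* The empty list keeps the least upper bound away from [m_infty]. *)
assert (K2 : Rbar_le 0 (Rbar_lub E)).
{ apply U. exists nil. split; [constructor|]. split; [easy|reflexivity]. }
destruct (Rbar_lub E) as [N| |] eqn:EN; [|easy|easy].
exists N. split; [reflexivity|]. split; [exact K1|].
intros l Nl Hl. apply (U (Finite (INR (length l)))). now exists l.
Qed.

(** * Passing from the half line to the whole line *)

(** Freezing a function at its value at [0] turns continuity on the half line into continuity
    everywhere, the form in which boundedness and integrals are used below. *)
Definition clamp (f : R -> R) (t : R) : R := f (Rmax 0 t).

Lemma continuous_Rmax0 (t : R) : continuous (Rmax 0) t.
Proof.
apply (continuous_ext (fun s => (s + Rabs s) * / 2)).
- intros s. unfold Rmax. simpl. destruct (Rle_dec 0 s).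
  + rewrite Rabs_pos_eq by lra. lra. + rewrite Rabs_left1 by lra. lra.
- apply continuous_Rmult; [|apply continuous_Rconst]. apply continuous_Rplus; [apply continuous_Rid|apply continuous_Rabs].
Qed.

Lemma clamp_continuous (f : R -> R) (t : R) : cont_Rplus f -> continuous (clamp f) t.
Proof.
intros [C1 C2]. destruct (Rlt_le_dec 0 t) as [Ht|Ht].
- apply (continuous_comp (Rmax 0) f); [apply continuous_Rmax0|].
  rewrite Rmax_right by lra. now apply C1.
- apply filterlim_locally. intros e.
  assert (K := proj1 (filterlim_locally f (f 0)) C2 e). destruct K as [d Hd].
  exists d. intros s Hs. unfold clamp. rewrite (Rmax_left 0 t) by lra.
  change (Rabs (s - t) < d) in Hs. apply Rabs_def2 in Hs.
  destruct (Rlt_le_dec 0 s) as [H|H].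
  + rewrite Rmax_right by lra. apply Hd; [|assumption].
    change (Rabs (s - 0) < d). rewrite Rabs_pos_eq; lra.
  + rewrite Rmax_left by lra. apply ball_center.
Qed.

(* Continuing a solution to [t < 0] by Taylor polynomials makes all derivatives two-sided. *)
Definition extend (f g : R -> R) (t : R) : R := if Rle_dec 0 t then f t else g t.

Lemma extend_pos (f g : R -> R) (t : R) : 0 <= t -> extend f g t = f t.
Proof. intros H. unfold extend. now destruct (Rle_dec 0 t). Qed.

Lemma extend_derive (f f' g g' : R -> R) (t : R) : deriv_Rplus f f' ->
  (forall t, is_derive g t (g' t)) -> g 0 = f 0 -> g' 0 = f' 0 ->
  is_derive (extend f g) t (extend f' g' t).
Proof.
intros [D1 D2] Dg E0 E1. destruct (Rtotal_order t 0) as [Ht|[Ht|Ht]].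
- unfold extend at 2. destruct (Rle_dec 0 t); [lra|].
  apply (is_derive_ext_loc g); [|apply Dg].
  apply (filter_imp (fun s => s < 0)); [|now apply (open_lt 0)].
  intros s Hs. unfold extend. destruct (Rle_dec 0 s); [lra|easy].
- subst t. rewrite extend_pos by lra. apply is_derive_Reals. intros e He.
  assert (G := Dg 0). apply is_derive_Reals in G. destruct (G e He) as [d1 H1].
  destruct (proj1 (filterlim_locally _ (f' 0)) D2 (mkposreal e He)) as [d2 H2].
  assert (Hd : 0 < Rmin d1 d2) by (apply Rmin_glb_lt; apply cond_pos).
  exists (mkposreal _ Hd). intros h Hh Hh'. simpl in Hh'.
  assert (M1 := Rmin_l d1 d2). assert (M2 := Rmin_r d1 d2).
  rewrite Rplus_0_l. rewrite (extend_pos f g 0) by lra. unfold extend. destruct (Rle_dec 0 h).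
  + apply (H2 h); [|lra]. change (Rabs (h - 0) < d2). rewrite Rminus_0_r. lra.
  + specialize (H1 h Hh ltac:(lra)). now rewrite Rplus_0_l, E0, E1 in H1.
- rewrite extend_pos by lra. apply (is_derive_ext_loc f); [|now apply D1].
  apply (filter_imp (fun s => 0 < s)); [|now apply (open_gt 0)].
  intros s Hs. symmetry. apply extend_pos. lra.
Qed.

(** [f * exp (- K * t)] is nonincreasing and [f * exp (K * t)] nondecreasing, so a zero of the
    nonnegative [f] spreads forwards by the first and backwards by the second. *)
Lemma gronwall_zero (f f' : R -> R) (K T t0 : R) : 0 <= t0 <= T ->
  (forall t, 0 <= t <= T -> is_derive f t (f' t)) -> (forall t, 0 <= f t) ->
  (forall t, 0 <= t <= T -> Rabs (f' t) <= K * f t) -> f t0 = 0 ->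
  forall t, 0 <= t <= T -> f t = 0.
Proof.
intros Ht0 D P B E t Ht.
assert (A : forall sg, sg = 1 \/ sg = -1 -> forall u v, 0 <= u -> u <= v -> v <= T ->
  sg * f u * exp (sg * K * u) <= sg * f v * exp (sg * K * v)).
{ intros sg Hsg u v Hu Huv Hv.
  apply (nondecreasing_of_derive (fun r => sg * f r * exp (sg * K * r))
    (fun r => (sg * f' r + sg * sg * K * f r) * exp (sg * K * r))); [assumption| |].
  - intros r Hr. assert (Dr := D r ltac:(lra)). auto_derive; [eexists; eassumption|].
    der_rw. ring.
  - intros r Hr. specialize (B r ltac:(lra)). apply Rabs_le_between in B.
    apply Rmult_le_pos; [|left; apply exp_pos]. destruct Hsg; subst; lra. }
assert (P' := P t). destruct (Rle_lt_dec t0 t) as [H|H].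
- assert (K1 := A (-1) ltac:(lra) t0 t ltac:(lra) H ltac:(lra)).
  assert (K2 := exp_pos (-1 * K * t)). rewrite E in K1. nra.
- assert (K1 := A 1 ltac:(lra) t t0 ltac:(lra) ltac:(lra) ltac:(lra)).
  assert (K2 := exp_pos (1 * K * t)). rewrite E in K1. nra.
Qed.

Lemma continuous_bounded (f : R -> R) (T : R) : 0 <= T -> (forall t, continuous f t) ->
  exists M, forall t, 0 <= t <= T -> Rabs (f t) <= M.
Proof.
intros HT C. destruct (continuity_ab_maj (fun t => Rabs (f t)) 0 T HT) as [x [Hx _]].
- intros t _. apply continuity_pt_filterlim. apply (continuous_comp f Rabs); [apply C|].
  apply continuous_Rabs.
- exists (Rabs (f x)). exact Hx.
Qed.

(** * Zeros counted against arc length *)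

(** A zero has multiplicity at most two, as [x] does not vanish: another zero close by would, after
    one or two uses of Rolle, give an even closer zero of the first derivative that is nonzero at
    [t]. *)
Lemma isolated_zero (y y1 y2 y3 : R -> R) (t : R) :
  (forall s, is_derive y s (y1 s) /\ is_derive y1 s (y2 s) /\ is_derive y2 s (y3 s)) ->
  0 < dot (y t, y1 t, y2 t) (y t, y1 t, y2 t) ->
  exists d, 0 < d /\ forall s, s <> t -> Rabs (s - t) < d -> y s <> 0.
Proof.
intros HD HX.
assert (C : forall s, continuous y s /\ continuous y1 s /\ continuous y2 s).
{ intros s. destruct (HD s) as (D0 & D1 & D2).
  repeat split; apply (ex_derive_continuous (V := R_NormedModule)); eexists; eassumption. }
assert (N : forall f, continuous f t -> f t <> 0 ->
  exists d, 0 < d /\ forall s, Rabs (s - t) < d -> f s <> 0).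
{ intros f Cf Hf. destruct (near_continuous f t (Rabs (f t)) Cf) as [d [Hd K]];
    [now apply Rabs_pos_lt|].
  exists d. split; [assumption|]. intros s Hs E. specialize (K s Hs).
  rewrite E, Rminus_0_l, Rabs_Ropp in K. lra. }
assert (Rolle : forall f f' : R -> R, (forall r, is_derive f r (f' r)) ->
  forall s, s <> t -> f s = 0 -> f t = 0 ->
  exists c, c <> t /\ Rabs (c - t) < Rabs (s - t) /\ f' c = 0).
{ intros f f' Df s Hs E1 E2.
  assert (Df' : forall r, derivable_pt_lim f r (f' r)) by (intros; apply is_derive_Reals, Df).
  destruct (Rlt_le_dec s t) as [H|H].
  - destruct (MVT_cor2 f f' s t H) as [c [Hc Hc']]; [intros; apply Df'|].
    exists c. rewrite E1, E2 in Hc. split; [lra|]. split; [|nra].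
    rewrite !Rabs_left1 by lra. lra.
  - destruct (MVT_cor2 f f' t s) as [c [Hc Hc']]; [lra|intros; apply Df'|].
    exists c. rewrite E1, E2 in Hc. split; [lra|]. split; [|nra].
    rewrite !Rabs_pos_eq by lra. lra. }
destruct (Req_dec (y t) 0) as [E0|E0].
2:{ destruct (N y) as [d [Hd K]]; [apply C|assumption|]. exists d. split; auto. }
destruct (Req_dec (y1 t) 0) as [E1|E1].
- assert (E2 : y2 t <> 0).
  { intros E2. rewrite E0, E1, E2 in HX. v3. lra. }
  destruct (N y2) as [d [Hd K]]; [apply C|assumption|]. exists d. split; [assumption|].
  intros s Hs Hsd E. destruct (Rolle y y1 (fun r => proj1 (HD r)) s Hs E E0) as (c & H1 & H2 & H3).
  destruct (Rolle y1 y2 (fun r => proj1 (proj2 (HD r))) c H1 H3 E1) as (c' & H4 & H5 & H6).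
  apply (K c'); [lra|assumption].
- destruct (N y1) as [d [Hd K]]; [apply C|assumption|]. exists d. split; [assumption|].
  intros s Hs Hsd E. destruct (Rolle y y1 (fun r => proj1 (HD r)) s Hs E E0) as (c & H1 & H2 & H3).
  apply (K c); [lra|assumption].
Qed.

(** Real induction collects the zeros in a list from left to right and charges [arch_gain] for each
    arch completed, so finiteness and the bound come out together. The additive constant pays for
    the first zero and for the potential at both ends. *)
Lemma zero_count_le_length (y y1 y2 y3 H : R -> R) :
  let X := fun r => (y r, y1 r, y2 r) in
  (forall s, is_derive y s (y1 s) /\ is_derive y1 s (y2 s) /\ is_derive y2 s (y3 s)) ->
  (forall s, 0 <= s -> 0 < dot (X s) (X s)) ->
  (forall T, arclength_on X H 0 T) -> H 0 = 0 ->
  forall t, 0 <= t -> exists Z : list R, (forall s, 0 <= s <= t -> y s = 0 -> In s Z) /\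
    INR (length Z) * (L_Omega / 2) <= H t + L_Omega / 2 + 2 * (PI + L_Omega).
Proof.
intros X HD HX HA H0 t Ht. set (C0 := PI + L_Omega).
assert (Cy : forall s, continuous y s).
{ intros s. apply (ex_derive_continuous (V := R_NormedModule)). eexists. exact (proj1 (HD s)). }
assert (HL : 0 <= L_Omega).
{ assert (K := arc_gt 0). rewrite arc_0 in K. lra. }
assert (HC : forall x, - C0 <= zero_pot x <= C0)
  by (intros x; apply Rabs_le_between, zero_pot_bound).
assert (Hmono : forall u v, 0 <= u -> u <= v -> H u <= H v).
{ intros u v Hu Huv. apply (arclength_mono X H 0 v); auto. lra. }
(* [p] is the last zero up to [t] and [n] the number of completed arches, one less than the number
   of listed zeros. [- C0] makes the inequality hold at the first zero. *)
set (P := fun t => exists Z : list R, (forall s, 0 <= s <= t -> y s = 0 -> In s Z) /\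
   (Z = nil \/ exists p n, length Z = S n /\ 0 <= p <= t /\ y p = 0 /\
     (forall s, p < s <= t -> y s <> 0) /\
     INR n * (L_Omega / 2) + zero_pot (X p) - C0 <= H p)).
assert (Pt : P t).
{ apply (real_induction P 0 t Ht).
  - destruct (Req_dec (y 0) 0) as [E|E].
    + exists (0 :: nil). split.
      * intros s Hs _. left. lra.
      * right. exists 0, 0%nat. repeat split; try lra; try assumption.
        -- intros s Hs. lra.
        -- rewrite H0. simpl. specialize (HC (X 0)). lra.
    + exists nil. split; [|now left]. intros s Hs Es. replace s with 0 in Es by lra. easy.
  - intros r Hr (Z & HZ & HP).
    destruct (isolated_zero y y1 y2 y3 r HD (HX r (proj1 Hr))) as [d [Hd K]].
    exists d. split; [assumption|]. intros s Hs.
    assert (K' : forall w, r < w <= s -> y w <> 0).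
    { intros w Hw. apply K; [lra|]. rewrite Rabs_pos_eq; lra. }
    exists Z. split.
    + intros w Hw Ew. apply HZ; [|assumption].
      destruct (Rle_lt_dec w r); [lra|]. destruct (K' w); [lra|assumption].
    + destruct HP as [HP|(p & n & H1 & H2 & H3 & H4 & H5)]; [now left|].
      right. exists p, n. repeat split; try assumption; try lra.
      intros w Hw. destruct (Rle_lt_dec w r); [apply H4; lra|apply K'; lra].
  - intros r Hr HP.
    assert (Hr0 : 0 <= r) by lra.
    destruct (isolated_zero y y1 y2 y3 r HD (HX r Hr0)) as [d [Hd K]].
    set (s := Rmax 0 (r - d / 2)).
    assert (Hs : 0 <= s /\ r - d / 2 <= s) by (split; [apply Rmax_l|apply Rmax_r]).
    assert (Hs' : s < r) by (apply Rmax_lub_lt; lra).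
    assert (K' : forall w, s <= w < r -> y w <> 0).
    { intros w Hw. apply K; [lra|]. rewrite Rabs_left1; lra. }
    destruct (HP s) as (Z & HZ & HP'); [lra|].
    destruct (Req_dec (y r) 0) as [E|E].
    + exists (r :: Z). split.
      * intros w Hw Ew. destruct (Req_dec w r) as [->|Hn]; [now left|]. right.
        apply HZ; [|assumption].
        destruct (Rle_lt_dec w s); [lra|]. destruct (K' w); [lra|assumption].
      * right. destruct HP' as [HP'|(p & n & H1 & H2 & H3 & H4 & H5)].
        -- exists r, 0%nat. subst Z. repeat split; try lra; try assumption.
           ++ intros w Hw. lra.
           ++ specialize (HC (X r)). assert (Hm := Hmono 0 r). simpl. lra.
        -- exists r, (S n). repeat split; try lra; try assumption.
           ++ simpl. now rewrite H1.
           ++ intros w Hw. lra.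
           ++ assert (Hpr : p < r) by lra.
              assert (G := arch_gain y y1 y2 y3 H p r Hpr Cy).
              rewrite S_INR. fold X in G. cbv zeta in G.
              assert (G' : zero_pot (X r) - zero_pot (X p) + L_Omega / 2 <= H r - H p).
              { apply G; try assumption.
                - intros w _. apply HD.
                - intros w Hw. destruct (Rle_lt_dec w s); [apply H4; lra|apply K'; lra].
                - intros a u v Ha Hu Huv Hv. apply (HA r); lra.
                - apply HX. lra.
                - apply HX. lra. }
              lra.
    + exists Z. split.
      * intros w Hw Ew. apply HZ; [|assumption]. destruct (Req_dec w r) as [->|Hn]; [easy|].
        destruct (Rle_lt_dec w s); [lra|]. destruct (K' w); [lra|assumption].
      * destruct HP' as [HP'|(p & n & H1 & H2 & H3 & H4 & H5)]; [now left|].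
        right. exists p, n. repeat split; try assumption; try lra.
        intros w Hw. destruct (Req_dec w r) as [->|Hn]; [easy|].
        destruct (Rle_lt_dec w s); [apply H4; lra|apply K'; lra]. }
destruct Pt as (Z & HZ & HP). exists Z. split; [assumption|]. fold C0.
assert (HC0 := HC (X 0)). assert (Hm := Hmono 0 t ltac:(lra) Ht).
destruct HP as [->|(p & n & H1 & H2 & H3 & H4 & H5)].
- simpl. lra.
- rewrite H1, S_INR. assert (Hm' := Hmono p t ltac:(lra) ltac:(lra)).
  specialize (HC (X p)). lra.
Qed.

(** * The path length as an integral of the spherical speed *)

Lemma continuous_speed (X0 X1 X2 Y0 Y1 Y2 : R -> R) (t : R) :
  continuous X0 t -> continuous X1 t -> continuous X2 t ->
  continuous Y0 t -> continuous Y1 t -> continuous Y2 t ->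
  0 < dot (X0 t, X1 t, X2 t) (X0 t, X1 t, X2 t) ->
  continuous (fun s => speed (X0 s, X1 s, X2 s) (Y0 s, Y1 s, Y2 s)) t.
Proof.
intros HX0 HX1 HX2 HY0 HY1 HY2 HX. unfold speed, Rdiv. apply continuous_Rmult.
- apply (continuous_sqrt_comp (fun s => dot (cross (X0 s, X1 s, X2 s) (Y0 s, Y1 s, Y2 s))
    (cross (X0 s, X1 s, X2 s) (Y0 s, Y1 s, Y2 s)))).
  unfold cross, px, py, pz; simpl.
  apply continuous_dot; apply continuous_Rminus; now apply continuous_Rmult.
- apply (continuous_Rinv_comp (fun s => dot (X0 s, X1 s, X2 s) (X0 s, X1 s, X2 s)));
    [now apply continuous_dot|lra].
Qed.

Lemma derive_normalized (f y y1 y2 : R -> R) (t f' v0 v1 v2 : R) :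
  is_derive f t f' -> is_derive y t v0 -> is_derive y1 t v1 -> is_derive y2 t v2 ->
  let x := (y t, y1 t, y2 t) in 0 < dot x x ->
  Derive (fun s => f s / xnorm y y1 y2 s) t =
   f' / sqrt (dot x x) - f t * dot x (v0, v1, v2) / (sqrt (dot x x) * dot x x).
Proof.
intros Df D0 D1 D2 x Hx.
assert (E : y t ^ 2 + y1 t ^ 2 + y2 t ^ 2 = dot x x) by (unfold x; v3; ring).
assert (Dn : is_derive (fun s => y s ^ 2 + y1 s ^ 2 + y2 s ^ 2) t (2 * dot x (v0, v1, v2))).
{ auto_derive; [repeat split; eexists; eassumption|]. der_rw. unfold x. v3. ring. }
assert (Dr := is_derive_ratio_sqrt f (fun s => y s ^ 2 + y1 s ^ 2 + y2 s ^ 2) 1 t f' (dot x (v0, v1, v2))).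
cbv beta in Dr. rewrite Rmult_1_l, E in Dr. specialize (Dr Hx Hx Df Dn).
apply is_derive_unique.
apply (is_derive_ext (fun s => f s / sqrt (1 * (y s ^ 2 + y1 s ^ 2 + y2 s ^ 2)))).
- intros s. unfold xnorm. now rewrite Rmult_1_l.
- evar_last; [exact Dr|]. assert (Hs := sqrt_lt_R0 _ Hx). field. lra.
Qed.

(** The derivative of [x / |x|] has squared norm [|v|^2 / |x|^2 - (x . v)^2 / |x|^4], and Lagrange's
    identity turns this into [|x cross v|^2 / |x|^4]. *)
Lemma gamma3_integrand (y y1 y2 y3 : R -> R) (t : R) :
  is_derive y t (y1 t) -> is_derive y1 t (y2 t) -> is_derive y2 t (y3 t) ->
  0 < dot (y t, y1 t, y2 t) (y t, y1 t, y2 t) ->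
  sqrt (Derive (fun s => y s / xnorm y y1 y2 s) t ^ 2
      + Derive (fun s => y1 s / xnorm y y1 y2 s) t ^ 2
      + Derive (fun s => y2 s / xnorm y y1 y2 s) t ^ 2) =
  speed (y t, y1 t, y2 t) (y1 t, y2 t, y3 t).
Proof.
intros D0 D1 D2 Hx.
rewrite (derive_normalized y y y1 y2 t _ _ _ _ D0 D0 D1 D2 Hx).
rewrite (derive_normalized y1 y y1 y2 t _ _ _ _ D1 D0 D1 D2 Hx).
rewrite (derive_normalized y2 y y1 y2 t _ _ _ _ D2 D0 D1 D2 Hx).
unfold speed.
set (x := (y t, y1 t, y2 t)) in *. set (v := (y1 t, y2 t, y3 t)).
assert (Hs := sqrt_lt_R0 _ Hx). assert (Hss := sqrt_sqrt _ (Rlt_le _ _ Hx)).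
set (q := sqrt (dot x x)) in *.
replace (sqrt (dot (cross x v) (cross x v)) / dot x x) with
  (sqrt (dot (cross x v) (cross x v) / dot x x ^ 2))
  by (rewrite sqrt_div_alt, sqrt_pow2 by (try apply pow_lt; lra); reflexivity).
f_equal. rewrite <- lagrange.
transitivity ((dot v v - 2 * dot x v * dot x v / dot x x + dot x x * dot x v ^ 2 / (dot x x ^ 2)) / (q * q)).
- assert (Ev : dot v v = y1 t ^ 2 + y2 t ^ 2 + y3 t ^ 2) by (unfold v; v3; ring).
  assert (Exv : dot x v = y t * y1 t + y1 t * y2 t + y2 t * y3 t) by (unfold x, v; v3; ring).
  assert (Exx : dot x x = y t ^ 2 + y1 t ^ 2 + y2 t ^ 2) by (unfold x; v3; ring).
  clearbody q. clearbody x v. set (c := dot x v) in *. set (n := dot x x) in *.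
  replace (2 * c * c / n) with (2 * c / n * (y t * y1 t + y1 t * y2 t + y2 t * y3 t))
    by (rewrite <- Exv; field; lra).
  replace (n * c ^ 2 / n ^ 2) with ((y t ^ 2 + y1 t ^ 2 + y2 t ^ 2) * c ^ 2 / n ^ 2)
    by (now rewrite <- Exx).
  rewrite Ev. field. lra.
- rewrite Hss. field. lra.
Qed.

(** [Derive] is two-sided, so the integrand of [gamma3] may be a default value at [0]; the integral
    only sees the open interval. *)
Lemma gamma3_eq (y y1 y2 y3 : R -> R) (t : R) : 0 <= t ->
  (forall s, 0 < s -> is_derive y s (y1 s) /\ is_derive y1 s (y2 s) /\ is_derive y2 s (y3 s)) ->
  (forall s, 0 < s -> 0 < dot (y s, y1 s, y2 s) (y s, y1 s, y2 s)) ->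
  gamma3 y y1 y2 t = RInt (fun s => speed (y s, y1 s, y2 s) (y1 s, y2 s, y3 s)) 0 t.
Proof.
intros Ht HD HX. apply RInt_ext. intros s Hs. rewrite Rmin_left, Rmax_right in Hs by assumption.
destruct (HD s) as (D0 & D1 & D2); [lra|]. apply gamma3_integrand; try assumption. apply HX. lra.
Qed.

(** With [(u, v, w) = (y, y', y'')] the left side is the derivative of [|x|^2] along the equation,
    and the factor on the right is the Gronwall constant. *)
Lemma quadratic_form_bound (a b c Ma Mb Mc u v w : R) :
  Rabs a <= Ma -> Rabs b <= Mb -> Rabs c <= Mc ->
  Rabs (2 * (u * v + v * w + w * - (a * w + b * v + c * u))) <=
  (2 + 2 * Ma + Mb + Mc) * (u * u + v * v + w * w).
Proof.
intros Ha Hb Hc.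
assert (A1 : forall p q, Rabs (2 * (p * q)) <= p * p + q * q).
{ intros p q. apply Rabs_le. generalize (pow2_ge_0 (p - q)) (pow2_ge_0 (p + q)). lra. }
assert (A2 : forall k M q N, Rabs k <= M -> Rabs q <= N -> Rabs (k * q) <= M * N).
{ intros k M q N HM HN. rewrite Rabs_mult.
  apply Rmult_le_compat; try assumption; apply Rabs_pos. }
assert (B1 := A1 u v). assert (B2 := A1 v w).
assert (B4 := A2 _ _ _ _ Hb (A1 v w)). assert (B5 := A2 _ _ _ _ Hc (A1 u w)).
assert (B6 := A2 _ _ _ _ Ha (A1 w w)).
apply Rabs_le_between in B1. apply Rabs_le_between in B2. apply Rabs_le_between in B4.
apply Rabs_le_between in B5. apply Rabs_le_between in B6.
assert (Pa := Rle_trans _ _ _ (Rabs_pos a) Ha). assert (Pb := Rle_trans _ _ _ (Rabs_pos b) Hb).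
assert (Pc := Rle_trans _ _ _ (Rabs_pos c) Hc).
assert (S : forall x, 0 <= x * x) by (intros; nra).
assert (P1 := Rmult_le_pos _ _ Pa (S u)). assert (P2 := Rmult_le_pos _ _ Pa (S v)).
assert (P3 := Rmult_le_pos _ _ Pb (S u)). assert (P4 := Rmult_le_pos _ _ Pc (S v)).
assert (Su := S u). assert (Sv := S v). assert (Sw := S w).
apply Rabs_le. lra.
Qed.

Theorem zero_frequency_le_wandering_speed (a b c y y1 y2 y3 : R -> R) :
     cont_Rplus a -> cont_Rplus b -> cont_Rplus c ->
     deriv_Rplus y y1 -> deriv_Rplus y1 y2 -> deriv_Rplus y2 y3 ->
     (forall t, 0 <= t -> y3 t + a t * y2 t + b t * y1 t + c t * y t = 0) ->
     (exists t, 0 <= t /\ y t <> 0) ->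
     Rbar_le (Rbar_mult (Finite (L_Omega / (2 * PI))) (nu_upper y)) (mu3_upper y y1 y2) /\
     Rbar_le (Rbar_mult (Finite (L_Omega / (2 * PI))) (nu_lower y)) (mu3_lower y y1 y2).
Proof.
intros Ca Cb Cc D0 D1 D2 Eq [t1 [Ht1 Hy1]].
set (z3 := extend y3 (fun _ => y3 0)).
set (z2 := extend y2 (fun t => y2 0 + y3 0 * t)).
set (z1 := extend y1 (fun t => y1 0 + y2 0 * t + y3 0 * t ^ 2 / 2)).
set (z := extend y (fun t => y 0 + y1 0 * t + y2 0 * t ^ 2 / 2 + y3 0 * t ^ 3 / 6)).
assert (HD : forall s, is_derive z s (z1 s) /\ is_derive z1 s (z2 s) /\ is_derive z2 s (z3 s)).
{ intros s. refine (conj _ (conj _ _)); apply extend_derive; try assumption; try field;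
  intros t; auto_derive; try easy; field. }
assert (E0 : forall s, 0 <= s -> z s = y s) by (intros; now apply extend_pos).
assert (E1 : forall s, 0 <= s -> z1 s = y1 s) by (intros; now apply extend_pos).
assert (E2 : forall s, 0 <= s -> z2 s = y2 s) by (intros; now apply extend_pos).
assert (E3 : forall s, 0 <= s -> z3 s = y3 s) by (intros; now apply extend_pos).
assert (Cz : forall s, continuous z s /\ continuous z1 s /\ continuous z2 s).
{ intros s. destruct (HD s) as (K0 & K1 & K2).
  repeat split; apply (ex_derive_continuous (V := R_NormedModule)); eexists; eassumption. }
set (X := fun r => (z r, z1 r, z2 r)).
(* If [x] vanished at [s], it would vanish on all of [[0, T]] by Gronwall, hence at [t1], where [y]
   is nonzero. *)
assert (HX : forall s, 0 <= s -> 0 < dot (X s) (X s)).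
{ intros s Hs. destruct (dot_ge0 (X s)) as [K|K]; [assumption|]. exfalso. apply Hy1.
  set (T := Rmax s t1). assert (HT : s <= T /\ t1 <= T) by (split; [apply Rmax_l|apply Rmax_r]).
  assert (HT0 : 0 <= T) by lra.
  destruct (continuous_bounded (clamp a) T HT0) as [Ma Ba]; [intros; now apply clamp_continuous|].
  destruct (continuous_bounded (clamp b) T HT0) as [Mb Bb]; [intros; now apply clamp_continuous|].
  destruct (continuous_bounded (clamp c) T HT0) as [Mc Bc]; [intros; now apply clamp_continuous|].
  assert (K0 : dot (X t1) (X t1) = 0).
  { apply (gronwall_zero (fun t => dot (X t) (X t)) (fun t => 2 * dot (X t) (z1 t, z2 t, z3 t))
     (2 + 2 * Ma + Mb + Mc) T s); [lra| | | | |].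
    - intros t _. destruct (HD t) as (K0 & K1 & K2).
      now apply (is_derive_dot_self z z1 z2 t (z1 t, z2 t, z3 t)).
    - intros t. apply dot_ge0.
    - intros t Ht. assert (Et := Eq t (proj1 Ht)).
      rewrite <- (E0 t), <- (E1 t), <- (E2 t), <- (E3 t) in Et by apply Ht.
      specialize (Ba t Ht). specialize (Bb t Ht). specialize (Bc t Ht).
      unfold clamp in Ba, Bb, Bc. rewrite Rmax_right in Ba, Bb, Bc by apply Ht.
      unfold X, dot, px, py, pz; simpl.
      generalize dependent (a t). generalize dependent (b t). generalize dependent (c t).
      intros cc Hc bb Hb aa Ha Et.
      replace (z3 t) with (- (aa * z2 t + bb * z1 t + cc * z t)) by lra.
      now apply quadratic_form_bound.
    - easy.
    - lra. }
  assert (Z0 : z t1 = 0).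
  { revert K0. unfold X, dot, px, py, pz; simpl. intros K0. nra. }
  now rewrite <- E0. }
set (sp := fun s => speed (X s) (z1 s, z2 s, z3 s)).
assert (Cz' : forall s, continuous (clamp z) s /\ continuous (clamp z1) s /\ continuous (clamp z2) s).
{ intros s. destruct (Cz (Rmax 0 s)) as (Z0 & Z1 & Z2). assert (CR := continuous_Rmax0 s).
  exact (conj (continuous_comp (Rmax 0) z s CR Z0)
    (conj (continuous_comp (Rmax 0) z1 s CR Z1) (continuous_comp (Rmax 0) z2 s CR Z2))). }
(* Continuity of the third derivative is read off the equation, all of whose other terms are
   continuous. *)
assert (C3 : forall s, continuous (clamp z3) s).
{ intros s. apply (continuous_ext (fun s => - (clamp a s * clamp z2 s + clamp b s * clamp z1 s
    + clamp c s * clamp z s))).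
  - intros r. unfold clamp. simpl. set (r' := Rmax 0 r). assert (Hr : 0 <= r') by apply Rmax_l.
    rewrite E0, E1, E2, E3 by assumption. specialize (Eq r' Hr). lra.
  - destruct (Cz' s) as (Z0 & Z1 & Z2).
    apply (continuous_opp (fun s => clamp a s * clamp z2 s + clamp b s * clamp z1 s
      + clamp c s * clamp z s)).
    assert (CC : forall g h, cont_Rplus g -> continuous h s -> continuous (fun r => clamp g r * h r) s).
    { intros g h Cg Ch. exact (continuous_Rmult (clamp g) h s (clamp_continuous g s Cg) Ch). }
    exact (continuous_Rplus _ _ s (continuous_Rplus _ _ s (CC a _ Ca Z2) (CC b _ Cb Z1)) (CC c _ Cc Z0)). }
assert (Csp : forall s, continuous (clamp sp) s).
{ intros s. apply (continuous_ext (fun s => speed (clamp z s, clamp z1 s, clamp z2 s)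
    (clamp z1 s, clamp z2 s, clamp z3 s))); [reflexivity|].
  destruct (Cz' s) as (Z0 & Z1 & Z2). apply continuous_speed; auto.
  apply (HX (Rmax 0 s)), Rmax_l. }
set (H := fun t => RInt (clamp sp) 0 t).
assert (DH : forall t, is_derive H t (clamp sp t)) by (intros; now apply is_derive_RInt_continuous).
assert (HA : forall T, arclength_on X H 0 T).
{ intros T v s t Hv Hs Hst _.
  apply (ang_lipschitz v z z1 z2 z1 z2 z3 H s t Hst Hv).
  intros r Hr. destruct (HD r) as (K0 & K1 & K2).
  refine (conj K0 (conj K1 (conj K2 (conj _ _)))); [apply HX; lra|].
  replace (speed (z r, z1 r, z2 r) (z1 r, z2 r, z3 r)) with (clamp sp r); [apply DH|].
  unfold clamp. now rewrite Rmax_right by lra. }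
assert (H0 : H 0 = 0) by apply (RInt_point 0 (clamp sp)).
assert (Hg : forall t, 0 <= t -> gamma3 y y1 y2 t = H t).
{ intros t Ht. rewrite (gamma3_eq y y1 y2 y3); [|assumption| |].
  - apply RInt_ext. intros s Hs. rewrite Rmin_left, Rmax_right in Hs by assumption.
    unfold clamp, sp, X. rewrite Rmax_right by lra. now rewrite E0, E1, E2, E3 by lra.
  - intros s Hs. refine (conj _ (conj _ _)); [now apply D0|now apply D1|now apply D2].
  - intros s Hs. rewrite <- E0, <- E1, <- E2 by lra. apply HX. lra. }
set (C := L_Omega / 2 + 2 * (PI + L_Omega)).
assert (HN : forall t, 0 < t -> exists N, nu_count y t = Finite N /\ N * (L_Omega / 2) <= H t + C).
{ intros t Ht. destruct (zero_count_le_length z z1 z2 z3 H HD HX HA H0 t) as (Z & HZ & HL); [lra|].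
  destruct (nu_count_finite y t (INR (length Z))) as (N & EN & HN & _).
  - intros l Nl Hl. apply le_INR. apply NoDup_incl_length; [assumption|].
    intros s Hs. destruct (Hl s Hs) as [Hs' Es]. apply HZ; [assumption|]. rewrite E0; lra.
  - exists N. split; [assumption|].
    assert (0 <= L_Omega / 2).
    { assert (K := arc_gt 0). rewrite arc_0 in K. lra. }
    unfold C. apply Rle_trans with (INR (length Z) * (L_Omega / 2)); [|lra].
    now apply Rmult_le_compat_r. }
assert (HPI := PI_RGT_0).
assert (HL : 0 < L_Omega / (2 * PI)).
{ assert (K := arc_gt 0). rewrite arc_0 in K. apply Rdiv_lt_0_compat; lra. }
assert (Key : forall t, 0 < t ->
  Rbar_mult (Finite (PI / t)) (nu_count y t) = Finite (PI / t * real (nu_count y t)) /\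
  Finite (gamma3 y y1 y2 t / t) = Finite (gamma3 y y1 y2 t / t) /\
  L_Omega / (2 * PI) * (PI / t * real (nu_count y t)) <= gamma3 y y1 y2 t / t + C / t).
{ intros t Ht. destruct (HN t Ht) as (N & EN & HNt). rewrite EN. simpl.
  split; [reflexivity|]. split; [reflexivity|]. rewrite Hg by lra.
  replace (L_Omega / (2 * PI) * (PI / t * N)) with (N * (L_Omega / 2) / t) by (field; lra).
  replace (H t / t + C / t) with ((H t + C) / t) by (field; lra).
  apply Rmult_le_compat_r; [|assumption]. left. now apply Rinv_0_lt_compat. }
split.
- unfold nu_upper, mu3_upper.
  now apply (Limsup_compare _ _ (fun t => PI / t * real (nu_count y t)) (fun t => gamma3 y y1 y2 t / t) _ C).
- unfold nu_lower, mu3_lower.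
  now apply (Liminf_compare _ _ (fun t => PI / t * real (nu_count y t)) (fun t => gamma3 y y1 y2 t / t) _ C).
Qed.

(** * The extremal family *)

(* With [u = t / n] and [y t = sh eta u ^ n - (2 * eta) ^ n], the vector [(y, y', y'')] equals
   [sh eta u ^ (n - 1)] times [profile n eta u]; as [n] grows and [eta] tends to [0], the profile
   tends to [(1 + cos u, - sin u, 1 - cos u)], which runs along the boundary of Omega. *)
Definition sh (eta : R) (u : R) : R := 1 + eta + cos u.
Definition rho (n : nat) (eta u : R) : R := (2 * eta / sh eta u) ^ n.
Definition W0 (n : nat) (eta u : R) : R := sh eta u * (1 - rho n eta u).
Definition W2 (n : nat) (eta u : R) : R :=
  (1 - / INR n) * ((1 - cos u) * (1 - eta / sh eta u)) - / INR n * cos u.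
Definition W0' (n : nat) (eta u : R) : R := - sin u * (1 + (INR n - 1) * rho n eta u).
Definition W2' (n : nat) (eta u : R) : R :=
  sin u * ((1 - / INR n) * (1 - eta * (2 + eta) / sh eta u ^ 2) + / INR n).
Definition profile (n : nat) (eta u : R) : V3 := (W0 n eta u, - sin u, W2 n eta u).
Definition profile' (n : nat) (eta u : R) : V3 := (W0' n eta u, - cos u, W2' n eta u).
Definition vel (n : nat) (eta u : R) : R := speed (profile n eta u) (profile' n eta u).

Lemma sh_bounds (eta u : R) : eta <= sh eta u <= 2 + eta.
Proof. unfold sh. generalize (COS_bound u). lra. Qed.

Lemma norm_triangle (a b : V3) :
  sqrt (dot (px a + px b, py a + py b, pz a + pz b) (px a + px b, py a + py b, pz a + pz b))
  <= sqrt (dot a a) + sqrt (dot b b).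
Proof.
assert (Ha := sqrt_pos (dot a a)). assert (Hb := sqrt_pos (dot b b)).
assert (Ha2 := sqrt_sqrt _ (dot_ge0 a)). assert (Hb2 := sqrt_sqrt _ (dot_ge0 b)).
rewrite <- (sqrt_pow2 (sqrt (dot a a) + sqrt (dot b b))) by lra.
apply sqrt_le_1_alt.
replace (dot (px a + px b, py a + py b, pz a + pz b) (px a + px b, py a + py b, pz a + pz b))
  with (dot a a + 2 * dot a b + dot b b) by (v3; ring).
assert (C := cauchy_schwarz a b).
assert (dot a b <= sqrt (dot a a) * sqrt (dot b b)).
{ rewrite <- sqrt_mult_alt by apply dot_ge0.
  apply Rle_trans with (Rabs (dot a b)); [apply Rle_abs|].
  rewrite <- sqrt_Rsqr_abs. apply sqrt_le_1_alt. unfold Rsqr. lra. }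
simpl. lra.
Qed.

Lemma norm_le_sum (a : V3) : sqrt (dot a a) <= Rabs (px a) + Rabs (py a) + Rabs (pz a).
Proof.
assert (H0 := Rabs_pos (px a)). assert (H1 := Rabs_pos (py a)). assert (H2 := Rabs_pos (pz a)).
rewrite <- (sqrt_pow2 (Rabs (px a) + Rabs (py a) + Rabs (pz a))) by lra.
apply sqrt_le_1_alt. unfold dot.
assert (E : forall x, x * x = Rabs x * Rabs x).
{ intros x. now rewrite <- Rabs_mult, Rabs_pos_eq by nra. }
rewrite (E (px a)), (E (py a)), (E (pz a)). nra.
Qed.

(** Crude constants: each coordinate of the cross product changes by at most [7 * d], hence its norm
    by at most [16 * d]; [|w|^2] keeps at least the fraction [1 - 4 * d]. As [|w|^2 >= 3] and the
    unperturbed speed is at most [1], [14 * d] absorbs both effects. *)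
Lemma speed_perturb (w w' e e' : V3) (d : R) : 0 <= d <= 1 / 16 ->
  (Rabs (px w) <= 2 /\ Rabs (py w) <= 2 /\ Rabs (pz w) <= 2) ->
  (Rabs (px w') <= 1 /\ Rabs (py w') <= 1 /\ Rabs (pz w') <= 1) ->
  (Rabs (px e) <= d /\ Rabs (py e) <= d /\ Rabs (pz e) <= d) ->
  (Rabs (px e') <= d /\ Rabs (py e') <= d /\ Rabs (pz e') <= d) ->
  3 <= dot w w -> speed w w' <= 1 ->
  speed (px w + px e, py w + py e, pz w + pz e) (px w' + px e', py w' + py e', pz w' + pz e')
  <= speed w w' + 14 * d.
Proof.
intros Hd (A0 & A1 & A2) (B0 & B1 & B2) (C0 & C1 & C2) (D0 & D1 & D2) Hw Hsp.
set (x := (px w + px e, py w + py e, pz w + pz e)).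
set (x' := (px w' + px e', py w' + py e', pz w' + pz e')).
set (z := (py e * pz w' - pz e * py w' + (py w * pz e' - pz w * py e') + (py e * pz e' - pz e * py e'),
  pz e * px w' - px e * pz w' + (pz w * px e' - px w * pz e') + (pz e * px e' - px e * pz e'),
  px e * py w' - py e * px w' + (px w * py e' - py w * px e') + (px e * py e' - py e * px e'))).
assert (M : forall p q P Q, Rabs p <= P -> Rabs q <= Q -> Rabs (p * q) <= P * Q).
{ intros p q P Q HP HQ. rewrite Rabs_mult. apply Rmult_le_compat; try assumption; apply Rabs_pos. }
assert (Z : forall e1 e2 w1 w2 w1' w2' e1' e2', Rabs e1 <= d -> Rabs e2 <= d ->
  Rabs w1 <= 2 -> Rabs w2 <= 2 -> Rabs w1' <= 1 -> Rabs w2' <= 1 -> Rabs e1' <= d -> Rabs e2' <= d ->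
  Rabs (e1 * w2' - e2 * w1' + (w1 * e2' - w2 * e1') + (e1 * e2' - e2 * e1')) <= 7 * d).
{ intros e1 e2 w1 w2 w1' w2' e1' e2' h1 h2 h3 h4 h5 h6 h7 h8.
  assert (K1 := M _ _ _ _ h1 h6). assert (K2 := M _ _ _ _ h2 h5).
  assert (K3 := M _ _ _ _ h3 h8). assert (K4 := M _ _ _ _ h4 h7).
  assert (K5 := M _ _ _ _ h1 h8). assert (K6 := M _ _ _ _ h2 h7).
  assert (d * d <= d / 16) by nra.
  apply Rabs_le_between in K1. apply Rabs_le_between in K2. apply Rabs_le_between in K3.
  apply Rabs_le_between in K4. apply Rabs_le_between in K5. apply Rabs_le_between in K6.
  apply Rabs_le. lra. }
assert (Z0 : Rabs (px z) <= 7 * d) by (apply Z; assumption).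
assert (Z1 : Rabs (py z) <= 7 * d) by (apply Z; assumption).
assert (Z2 : Rabs (pz z) <= 7 * d) by (apply Z; assumption).
assert (Nz : sqrt (dot z z) <= 16 * d).
{ rewrite <- (sqrt_pow2 (16 * d)) by lra. apply sqrt_le_1_alt. unfold dot.
  assert (S : forall p, Rabs p <= 7 * d -> p * p <= 49 * d ^ 2).
  { intros p Hp. apply Rabs_le_between in Hp. nra. }
  apply S in Z0. apply S in Z1. apply S in Z2. nra. }
assert (Cr : cross x x' = (px (cross w w') + px z, py (cross w w') + py z, pz (cross w w') + pz z)).
{ unfold x, x', z, cross, px, py, pz; simpl. f_equal; [f_equal|]; ring. }
assert (Nc : sqrt (dot (cross x x') (cross x x')) <= sqrt (dot (cross w w') (cross w w')) + 16 * d).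
{ rewrite Cr. eapply Rle_trans; [apply norm_triangle|]. lra. }
assert (Nx : dot w w * (1 - 4 * d) <= dot x x).
{ assert (K0 := M _ _ _ _ A0 C0). assert (K1 := M _ _ _ _ A1 C1). assert (K2 := M _ _ _ _ A2 C2).
  apply Rabs_le_between in K0. apply Rabs_le_between in K1. apply Rabs_le_between in K2.
  assert (dot x x = dot w w + 2 * (px w * px e + py w * py e + pz w * pz e) + dot e e)
    by (unfold x; v3; ring).
  assert (E0 := dot_ge0 e). nra. }
unfold speed in *. set (g := sqrt (dot (cross w w') (cross w w'))) in *.
assert (Hg : g <= dot w w) by (apply Rle_div_l in Hsp; lra).
assert (Hg0 : 0 <= g) by apply sqrt_pos.
apply Rle_div_l; [nra|].
apply Rle_trans with (g + 16 * d); [assumption|].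
apply Rle_trans with ((g / dot w w + 14 * d) * (dot w w * (1 - 4 * d))).
- replace ((g / dot w w + 14 * d) * (dot w w * (1 - 4 * d))) with
    ((g + 14 * d * dot w w) * (1 - 4 * d)) by (field; lra).
  assert (0 <= d * (dot w w - g)) by (apply Rmult_le_pos; lra).
  assert (d * (d * dot w w) <= 1 / 16 * (d * dot w w)) by (apply Rmult_le_compat_r; nra).
  nra.
- apply Rmult_le_compat_l; [|assumption].
  assert (0 <= g / dot w w) by (apply Rdiv_le_0_compat; lra). lra.
Qed.

Lemma rho_pos (n : nat) (eta u : R) : 0 < eta -> 0 < rho n eta u.
Proof.
intros H. unfold rho. apply pow_lt. apply Rdiv_lt_0_compat; [lra|].
generalize (sh_bounds eta u). lra.
Qed.

Lemma pow_le_self (x : R) (n : nat) : (1 <= n)%nat -> 0 <= x <= 1 -> x ^ n <= x.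
Proof.
intros Hn Hx. destruct n as [|n]; [lia|]. simpl.
assert (x ^ n <= 1 ^ n) by (apply pow_incr; lra). rewrite pow1 in H.
assert (0 <= x ^ n) by (apply pow_le; lra). nra.
Qed.

Lemma inv_INR_bounds (n : nat) : (2 <= n)%nat -> 0 < / INR n <= 1 / 2 /\ 2 <= INR n.
Proof.
intros Hn. assert (2 <= INR n) by (now apply (le_INR 2)).
repeat split; [apply Rinv_0_lt_compat; lra| |assumption].
replace (1 / 2) with (/ 2) by field. apply Rinv_le_contravar; lra.
Qed.

(* Away from [u = PI] the profile is close to its limit together with its derivative. *)
Lemma vel_main (n : nat) (eta s1 d u : R) : (2 <= n)%nat -> 0 < eta -> 0 < s1 <= 1 ->
  0 < d <= 1 / 16 -> / INR n <= d / 2 -> eta <= d * s1 ^ 2 / (16 * INR n) ->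
  s1 <= sh eta u -> vel n eta u <= gal u + 14 * d.
Proof.
intros Hn He Hs1 Hd Hk Heta Hs. destruct (inv_INR_bounds n Hn) as [Hk0 HN].
set (k := / INR n) in *. set (N := INR n) in *.
assert (Hb := sh_bounds eta u).
assert (HNe : N * eta <= d * s1 ^ 2 / 16).
{ apply (Rmult_le_compat_l N) in Heta; [|lra].
  replace (N * (d * s1 ^ 2 / (16 * N))) with (d * s1 ^ 2 / 16) in Heta by (field; lra). lra. }
assert (Hs1s : s1 ^ 2 <= s1) by nra.
assert (He2 : eta <= d * s1 ^ 2 / 32) by nra.
assert (He1 : eta <= d * s1 / 32) by nra.
assert (He0 : eta <= d / 32) by nra.
set (s := sh eta u) in *. set (r := rho n eta u).
assert (Hx : 0 <= 2 * eta / s <= 1).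
{ split; [apply Rdiv_le_0_compat; lra|]. apply Rle_div_l; nra. }
assert (Hr : 0 < r <= 2 * eta / s).
{ split; [now apply rho_pos|]. apply pow_le_self; [lia|assumption]. }
assert (Hes : eta / s <= d / 32).
{ apply Rle_div_l; nra. }
assert (Hsr : 0 < s * r <= 2 * eta).
{ split; [nra|]. apply Rle_trans with (s * (2 * eta / s)); [apply Rmult_le_compat_l; lra|].
  right; field; lra. }
(* Differentiating [rho] brings down a factor [n], so [rho] itself must be small compared with
   [1 / n]; hence the [INR n] in the hypothesis on [eta]. *)
assert (HNr : 0 < N * r <= d / 8).
{ split; [nra|]. apply Rle_trans with (N * (2 * eta / s)); [apply Rmult_le_compat_l; lra|].
  replace (N * (2 * eta / s)) with (2 * (N * eta) / s) by (field; lra).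
  apply Rle_div_l; nra. }
assert (Hes2 : 0 < eta / s ^ 2 <= d / 32).
{ assert (Hs0 : 0 < s) by lra.
  split; [apply Rdiv_lt_0_compat; [assumption|now apply pow_lt]|].
  apply Rle_div_l; [now apply pow_lt|].
  assert (K : s1 ^ 2 <= s ^ 2) by (apply pow_incr; lra).
  apply (Rmult_le_compat_l d) in K; lra. }
assert (Hes0 : 0 < eta / s) by (apply Rdiv_lt_0_compat; lra).
assert (HC := COS_bound u). assert (HS := SIN_bound u).
assert (HSC := sin2_cos2 u). unfold Rsqr in HSC.
set (C := cos u) in *. set (S := sin u) in *.
assert (HS' : Rabs S <= 1) by (apply Rabs_le; lra).
assert (HC' : Rabs C <= 1) by (apply Rabs_le; lra).
assert (HS2 : S * S = 1 - C * C) by lra.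
set (w := (1 + C, - S, 1 - C)). set (w' := (- S, - C, S)).
assert (Egal : speed w w' = gal u).
{ unfold speed, gal. fold C. replace (dot w w) with (3 + C ^ 2).
  - f_equal. f_equal. unfold w, w'; v3.
    transitivity ((- (S * S) + C - C * C) ^ 2 + 4 * (S * S) + (- C - C * C - S * S) ^ 2); [ring|].
    rewrite HS2. ring.
  - unfold w; v3. transitivity (2 + 2 * (C * C) + S * S); [|ring]. rewrite HS2. ring. }
assert (Hg1 : gal u <= 1).
{ unfold gal. fold C. assert (HC2 : 0 <= C ^ 2 <= 1) by nra. apply Rle_div_l; [lra|].
  rewrite Rmult_1_l, <- (sqrt_pow2 (3 + C ^ 2)) by lra. apply sqrt_le_1_alt. nra. }
set (e := (eta - s * r, 0, - k - (1 - k) * (1 - C) * (eta / s))).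
set (e' := (- ((N - 1) * r * S), 0, - (S * (1 - k) * ((2 + eta) * (eta / s ^ 2))))).
assert (EW : profile n eta u = (px w + px e, py w + py e, pz w + pz e)).
{ unfold profile, W0, W2, w, e, px, py, pz; simpl. fold s C S r N. fold k.
  assert (Hs0 : 1 + C = s - eta) by (unfold s, C, sh; ring).
  f_equal; [f_equal|]; [|ring|field; lra].
  rewrite Hs0. ring. }
assert (EW' : profile' n eta u = (px w' + px e', py w' + py e', pz w' + pz e')).
{ unfold profile', W0', W2', w', e', px, py, pz; simpl. fold s C S r N. fold k.
  f_equal; [f_equal|]; [ring|ring|field; lra]. }
unfold vel. rewrite EW, EW', <- Egal.
apply speed_perturb; [lra| | | | |unfold w; v3; nra|lra].
- unfold w, px, py, pz; simpl. repeat split; apply Rabs_le; lra.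
- unfold w', px, py, pz; simpl. rewrite !Rabs_Ropp. repeat split; assumption.
- unfold e, px, py, pz; simpl. rewrite Rabs_R0. repeat split; [apply Rabs_le; lra|lra|].
  assert (0 <= (1 - k) * (1 - C) * (eta / s) <= 2 * (eta / s)).
  { split; [apply Rmult_le_pos; [apply Rmult_le_pos|]; lra|]. apply Rmult_le_compat_r; [lra|]. nra. }
  apply Rabs_le. lra.
- unfold e', px, py, pz; cbn [fst snd]. rewrite Rabs_R0, !Rabs_Ropp.
  assert (M : forall p q P, Rabs p <= 1 -> 0 <= q <= P -> Rabs (p * q) <= P).
  { intros p q P Hp Hq. rewrite Rabs_mult, (Rabs_pos_eq q) by lra.
    assert (0 <= Rabs p) by apply Rabs_pos. nra. }
  repeat split; [|lra|].
  + rewrite (Rmult_comm _ S). apply M; [assumption|].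
    assert (0 <= (N - 1) * r) by (apply Rmult_le_pos; lra). lra.
  + rewrite Rmult_assoc. apply M; [assumption|]. split.
    * apply Rmult_le_pos; [lra|]. apply Rmult_le_pos; lra.
    * assert ((2 + eta) * (eta / s ^ 2) <= 3 * (d / 32)).
      { apply Rmult_le_compat; lra. }
      assert (0 <= (2 + eta) * (eta / s ^ 2)) by (apply Rmult_le_pos; lra). nra.
Qed.

(* Near [u = PI] the third component dominates; [W2'] itself is unbounded as [eta] tends to [0],
   but its products with [sin u] and [W0] are not. *)
Lemma vel_pole (n : nat) (eta u P Q m : R) : (2 <= n)%nat -> 0 < eta -> sh eta u <= 1 ->
  Rabs (1 - rho n eta u) <= P -> Rabs (sin u) * (1 + (INR n - 1) * rho n eta u) <= Q ->
  0 < m <= W2 n eta u -> vel n eta u <= (11 + 4 * Q + 5 * P) / m ^ 2.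
Proof.
intros Hn He Hs HP HQ Hm. destruct (inv_INR_bounds n Hn) as [Hk0 HN].
assert (Hb := sh_bounds eta u). assert (Hr := rho_pos n eta u He).
assert (HC := COS_bound u). assert (HS := SIN_bound u).
assert (HSC := sin2_cos2 u). unfold Rsqr in HSC.
assert (EW2 := eq_refl (W2 n eta u)). unfold W2 at 2 in EW2.
assert (ES : cos u = sh eta u - 1 - eta) by (unfold sh; ring).
assert (EW0 := eq_refl (W0 n eta u)). unfold W0 at 2 in EW0.
assert (EW0' := eq_refl (W0' n eta u)). unfold W0' at 2 in EW0'.
assert (EW2' := eq_refl (W2' n eta u)). unfold W2' at 2 in EW2'.
unfold vel, speed.
assert (HN2 : 0 <= (INR n - 1) * rho n eta u) by (apply Rmult_le_pos; lra).
set (N := INR n) in *. set (k := / N) in *.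
set (s := sh eta u) in *. set (r := rho n eta u) in *.
set (w0 := W0 n eta u) in *. set (w0' := W0' n eta u) in *.
set (w2 := W2 n eta u) in *. set (w2' := W2' n eta u) in *.
set (q := Rabs (sin u)) in *.
assert (Hq : 0 <= q <= 1) by (split; [apply Rabs_pos|apply Rabs_le; lra]).
assert (Hqq : q * q <= 2 * s).
{ assert (E : q * q = sin u * sin u) by (unfold q; rewrite <- Rabs_mult; apply Rabs_pos_eq; nra).
  rewrite E. nra. }
set (h := eta / s).
assert (Hh : 0 < h <= 1) by (split; [apply Rdiv_lt_0_compat; lra|apply Rle_div_l; lra]).
assert (Hhs : eta / s ^ 2 = h / s) by (unfold h; field; lra).
assert (Hw2' : Rabs w2' <= q * (1 + 3 * (h / s))).
{ rewrite EW2', Rabs_mult. apply Rmult_le_compat_l; [lra|].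
  replace (eta * (2 + eta) / s ^ 2) with ((2 + eta) * (h / s)) by (rewrite <- Hhs; field; lra).
  assert (0 < h / s) by (apply Rdiv_lt_0_compat; lra).
  assert (0 <= (2 + eta) * (h / s) <= 3 * (h / s)).
  { split; [apply Rmult_le_pos; lra|apply Rmult_le_compat_r; lra]. }
  apply Rabs_le. nra. }
assert (A : q * Rabs w2' <= 8).
{ apply Rle_trans with (q * (q * (1 + 3 * (h / s)))); [apply Rmult_le_compat_l; lra|].
  assert (0 < h / s) by (apply Rdiv_lt_0_compat; lra).
  rewrite <- Rmult_assoc. apply Rle_trans with (2 * s * (1 + 3 * (h / s))).
  - apply Rmult_le_compat_r; lra.
  - replace (2 * s * (1 + 3 * (h / s))) with (2 * s + 6 * h) by (field; lra). lra. }
assert (B : s * Rabs w2' <= 4).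
{ assert (0 < h / s) by (apply Rdiv_lt_0_compat; lra).
  apply Rle_trans with (s * (1 * (1 + 3 * (h / s)))).
  - apply Rmult_le_compat_l; [lra|]. eapply Rle_trans; [exact Hw2'|].
    apply Rmult_le_compat_r; lra.
  - replace (s * (1 * (1 + 3 * (h / s)))) with (s + 3 * h) by (field; lra). lra. }
assert (Aw0 : Rabs w0 = s * Rabs (1 - r)) by (rewrite EW0, Rabs_mult, (Rabs_pos_eq s); lra).
assert (Aw0' : Rabs w0' <= Q).
{ rewrite EW0', Rabs_mult, Rabs_Ropp. fold q. rewrite (Rabs_pos_eq (1 + _)) by lra. assumption. }
assert (Aw2 : Rabs w2 <= 3).
{ apply Rabs_le. split; [lra|]. rewrite EW2.
  assert (0 <= (1 - cos u) * (1 - h) <= 2).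
  { split; [apply Rmult_le_pos; lra|]. nra. }
  fold h. nra. }
assert (HP0 : 0 <= Rabs (1 - r)) by apply Rabs_pos.
assert (M : forall x y X Y, Rabs x <= X -> Rabs y <= Y -> Rabs (x * y) <= X * Y).
{ intros x y X Y HX HY. rewrite Rabs_mult. apply Rmult_le_compat; try assumption; apply Rabs_pos. }
assert (HQ0 : 0 <= Q) by (eapply Rle_trans; [apply (Rabs_pos w0')|assumption]).
assert (Acos : Rabs (cos u) <= 1) by (apply Rabs_le; lra).
assert (T : forall x y X Y, Rabs x <= X -> Rabs y <= Y -> Rabs (x - y) <= X + Y).
{ intros x y X Y HX HY. apply Rabs_le_between in HX. apply Rabs_le_between in HY. apply Rabs_le. lra. }
assert (Aw0s : Rabs w0 <= P) by (rewrite Aw0; nra).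
assert (K02 : Rabs (w0 * w2') <= 4 * P).
{ rewrite Rabs_mult, Aw0. replace (s * Rabs (1 - r) * Rabs w2') with (s * Rabs w2' * Rabs (1 - r)) by ring.
  apply Rmult_le_compat; try lra. apply Rmult_le_pos; [lra|apply Rabs_pos]. }
assert (K12 : Rabs (- sin u * w2') <= 8) by (rewrite Rabs_mult, Rabs_Ropp; exact A).
assert (Asin : Rabs (- sin u) <= 1) by (rewrite Rabs_Ropp; fold q; lra).
assert (Amcos : Rabs (- cos u) <= 1) by (rewrite Rabs_Ropp; assumption).
apply Rle_trans with ((11 + 4 * Q + 5 * P) / dot (profile n eta u) (profile n eta u)).
- apply Rmult_le_compat_r.
  + left. apply Rinv_0_lt_compat. apply dot_pos. right; right. unfold profile, pz; simpl. fold w2. lra.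
  + eapply Rle_trans; [apply norm_le_sum|].
    unfold profile, profile', cross, px, py, pz; cbn [fst snd]. fold w0 w0' w2 w2'.
    assert (C0 := T _ _ _ _ K12 (M _ _ _ _ Aw2 Amcos)).
    assert (C1 := T _ _ _ _ (M _ _ _ _ Aw2 Aw0') K02).
    assert (C2 := T _ _ _ _ (M _ _ _ _ Aw0s Amcos) (M _ _ _ _ Asin Aw0')). lra.
- apply Rmult_le_compat_l; [lra|]. apply Rinv_le_contravar; [nra|].
  unfold profile, dot, px, py, pz; cbn [fst snd]. fold w0 w2. nra.
Qed.

(** From [2 * eta <= sh] follows [rho <= 1]. Since [sin u ^ 2 <= 2 * sh], the condition
    [eta * n ^ 2 <= 1] tames the product of [sin u] with [n * rho]. So [vel_pole] applies with
    [P = 1], [Q = 3], [m = 1 / 4], and the bound depends on neither [n] nor [eta]. *)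
Lemma vel_zone2 (n : nat) (eta u : R) : (2 <= n)%nat -> 0 < eta -> eta * INR n ^ 2 <= 1 ->
  2 * eta <= sh eta u <= 1 -> vel n eta u <= 448.
Proof.
intros Hn He HeN Hs. destruct (inv_INR_bounds n Hn) as [Hk0 HN].
assert (HC := COS_bound u). assert (HS := SIN_bound u).
assert (HSC := sin2_cos2 u). unfold Rsqr in HSC.
assert (ES : cos u = sh eta u - 1 - eta) by (unfold sh; ring).
assert (Hx : 0 <= 2 * eta / sh eta u <= 1).
{ split; [apply Rdiv_le_0_compat; lra|]. apply Rle_div_l; lra. }
assert (Hr : 0 < rho n eta u <= 2 * eta / sh eta u).
{ split; [now apply rho_pos|]. apply pow_le_self; [lia|assumption]. }
replace 448 with ((11 + 4 * 3 + 5 * 1) / (1 / 4) ^ 2) by field.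
apply vel_pole; try assumption; try lra.
- apply Rabs_le. lra.
- set (q := Rabs (sin u)). assert (Hq : 0 <= q <= 1) by (split; [apply Rabs_pos|apply Rabs_le; lra]).
  assert (Hqq : q * q <= 2 * sh eta u).
  { assert (E : q * q = sin u * sin u) by (unfold q; rewrite <- Rabs_mult; apply Rabs_pos_eq; nra).
    rewrite E. nra. }
  set (N := INR n) in *. set (s := sh eta u) in *. set (r := rho n eta u) in *.
  assert (K : q * (N * (2 * eta / s)) <= 2).
  { replace (q * (N * (2 * eta / s))) with (2 * (q * (N * eta)) / s) by (field; lra).
    apply Rle_div_l; [lra|]. enough (q * (N * eta) <= s) by lra.
    apply Rsqr_incr_0_var; [|lra]. unfold Rsqr.
    replace (q * (N * eta) * (q * (N * eta))) with (q * q * (eta * N ^ 2) * eta) by ring.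
    assert (0 <= eta * N ^ 2) by nra.
    assert (q * q * (eta * N ^ 2) <= 2 * s * 1) by (apply Rmult_le_compat; nra).
    assert (q * q * (eta * N ^ 2) * eta <= 2 * s * 1 * eta) by (apply Rmult_le_compat_r; lra).
    nra. }
  assert (q * ((N - 1) * r) <= q * (N * (2 * eta / s))).
  { apply Rmult_le_compat_l; [lra|]. apply Rmult_le_compat; lra. }
  lra.
- split; [lra|]. unfold W2. set (k := / INR n) in *.
  assert (eta / sh eta u <= 1 / 2) by (apply Rle_div_l; lra).
  assert (1 / 2 <= (1 - cos u) * (1 - eta / sh eta u)) by nra.
  nra.
Qed.

(** The bound of [vel_pole] for [rho <= 2 ^ n]. The value [/ INR n / 2] bounds [W2] below through
    its term [- / INR n * cos u], as the other term vanishes at [u = PI]. It is free of [eta], so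
    the zone can be shrunk after [n] is fixed. *)
Definition pole_bound (n : nat) : R :=
  (11 + 4 * (1 + INR n * 2 ^ n) + 5 * (1 + 2 ^ n)) / (/ INR n / 2) ^ 2.

Lemma vel_zone3 (n : nat) (eta u : R) : (2 <= n)%nat -> 0 < eta -> cos u <= - 1 / 2 ->
  sh eta u <= 1 -> vel n eta u <= pole_bound n.
Proof.
intros Hn He Hc Hs. destruct (inv_INR_bounds n Hn) as [Hk0 HN].
assert (HC := COS_bound u). assert (HS := SIN_bound u).
assert (Hb := sh_bounds eta u).
assert (Hr : 0 < rho n eta u <= 2 ^ n).
{ split; [now apply rho_pos|]. apply pow_incr.
  split; [apply Rdiv_le_0_compat; lra|]. apply Rle_div_l; lra. }
unfold pole_bound. apply vel_pole; try assumption.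
- apply Rabs_le. lra.
- assert (Hq : 0 <= Rabs (sin u) <= 1) by (split; [apply Rabs_pos|apply Rabs_le; lra]).
  assert (0 <= (INR n - 1) * rho n eta u) by (apply Rmult_le_pos; lra).
  assert ((INR n - 1) * rho n eta u <= INR n * 2 ^ n) by (apply Rmult_le_compat; lra).
  nra.
- split; [lra|]. unfold W2. set (k := / INR n) in *.
  assert (eta / sh eta u <= 1) by (apply Rle_div_l; lra).
  assert (0 <= (1 - cos u) * (1 - eta / sh eta u)) by (apply Rmult_le_pos; lra).
  assert (0 <= (1 - k) * ((1 - cos u) * (1 - eta / sh eta u))) by (apply Rmult_le_pos; lra).
  nra.
Qed.

Lemma is_derive_sh (eta u : R) : is_derive (sh eta) u (- sin u).
Proof. unfold sh. auto_derive; [easy|ring]. Qed.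

Lemma is_derive_W0 (n : nat) (eta u : R) : (1 <= n)%nat -> 0 < eta ->
  is_derive (W0 n eta) u (W0' n eta u).
Proof.
intros Hn He. assert (Hb := sh_bounds eta u). assert (D := is_derive_sh eta u).
unfold W0, rho. auto_derive.
- repeat split; try (eexists; exact D); lra.
- der_rw. unfold W0', rho. destruct n as [|n]; [lia|].
  change (pred (S n)) with n. simpl pow. set (x := 2 * eta * / sh eta u).
  replace (2 * eta / sh eta u) with x by reflexivity.
  set (z := INR (S n)). replace x with (2 * eta / sh eta u) at 1 4 by reflexivity.
  unfold x, Rdiv. field. lra.
Qed.

Lemma is_derive_W2 (n : nat) (eta u : R) : 0 < eta -> is_derive (W2 n eta) u (W2' n eta u).
Proof.
intros He. assert (Hb := sh_bounds eta u). assert (D := is_derive_sh eta u).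
unfold W2. auto_derive.
- repeat split; try (eexists; exact D); lra.
- der_rw. unfold W2'.
  replace (cos u) with (sh eta u - 1 - eta) by (unfold sh; ring).
  set (k := / INR n). field. lra.
Qed.

Lemma is_derive_opp_sin (u : R) : is_derive (fun u => - sin u) u (- cos u).
Proof. auto_derive; [easy|ring]. Qed.

Lemma profile_pos (n : nat) (eta u : R) : (2 <= n)%nat -> 0 < eta < 1 ->
  0 < dot (profile n eta u) (profile n eta u).
Proof.
intros Hn He. destruct (inv_INR_bounds n Hn) as [Hk HN].
destruct (Req_dec (sin u) 0) as [E|E].
2:{ apply dot_pos. right; left. unfold profile, py; simpl. lra. }
assert (HSC := sin2_cos2 u). unfold Rsqr in HSC. rewrite E in HSC.
assert (Hc : cos u = 1 \/ cos u = -1).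
{ assert ((cos u - 1) * (cos u + 1) = 0) by lra. apply Rmult_integral in H. lra. }
apply dot_pos. destruct Hc as [Hc|Hc].
- left. unfold profile, px; simpl. unfold W0, rho, sh. rewrite Hc.
  assert ((2 * eta / (1 + eta + 1)) ^ n <= 2 * eta / (1 + eta + 1)).
  { apply pow_le_self; [lia|]. split; [apply Rdiv_le_0_compat; lra|apply Rle_div_l; lra]. }
  assert (2 * eta / (1 + eta + 1) < 1) by (apply Rlt_div_l; lra).
  apply Rgt_not_eq. apply Rmult_lt_0_compat; lra.
- right; right. unfold profile, pz; simpl. unfold W2, sh. rewrite Hc.
  replace (eta / (1 + eta + -1)) with 1 by (field; lra).
  apply Rgt_not_eq. lra.
Qed.

Lemma continuous_vel (n : nat) (eta u : R) : (2 <= n)%nat -> 0 < eta < 1 ->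
  continuous (vel n eta) u.
Proof.
intros Hn He.
assert (Hb := sh_bounds eta u). assert (D := is_derive_sh eta u).
assert (K : forall f : R -> R, ex_derive f u -> continuous f u)
  by (intros; now apply (ex_derive_continuous (V := R_NormedModule))).
apply (continuous_speed (W0 n eta) (fun u => - sin u) (W2 n eta)
  (W0' n eta) (fun u => - cos u) (W2' n eta)); [apply K..|].
- eexists. apply is_derive_W0; [lia|lra].
- auto_derive. easy.
- eexists. apply is_derive_W2. lra.
- unfold W0', rho. auto_derive. repeat split; try (eexists; exact D); lra.
- auto_derive. easy.
- unfold W2'. auto_derive. repeat split; try (eexists; exact D); nra.
- now apply profile_pos.
Qed.

Lemma RInt_le_const (f : R -> R) (a b M : R) : a <= b -> (forall u, continuous f u) ->
  (forall u, a <= u <= b -> f u <= M) -> RInt f a b <= M * (b - a).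
Proof.
intros Hab Cf Hf. replace (M * (b - a)) with (RInt (fun _ => M) a b).
- apply RInt_le; [assumption| |apply ex_RInt_const|].
  + apply (ex_RInt_continuous f). intros; apply Cf.
  + intros u Hu. apply Hf. lra.
- rewrite RInt_const. unfold scal; simpl. unfold mult; simpl. ring.
Qed.

(** The order of choices matters: [th] makes the middle zone short enough for its absolute bound;
    [d] and then [n] control the main zone; [z] makes the last zone short against [pole_bound n];
    [eta] comes last. The three errors are at most [56 / 200], [448 / 2000] and [1 / 4] of [eps]. *)
Lemma half_length_bound (eps : R) : 0 < eps ->
  exists n eta, (2 <= n)%nat /\ 0 < eta < 1 /\ RInt (vel n eta) 0 PI <= L_Omega / 2 + eps.
Proof.
intros Heps. assert (HPI := PI_RGT_0). assert (HPI4 := PI_4).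
set (th := Rmin (PI / 3) (eps / 2000)).
assert (Hth0 : 0 < th) by (apply Rmin_glb_lt; lra).
assert (Hth1 : th <= PI / 3) by apply Rmin_l.
assert (Hth2 : th <= eps / 2000) by apply Rmin_r.
assert (Hcth : 1 / 2 <= cos th < 1).
{ split; [rewrite <- cos_PI3; apply cos_decr_1; lra|]. rewrite <- cos_0. apply cos_decreasing_1; lra. }
set (s1 := 1 - cos th).
set (d := Rmin (1 / 16) (eps / 200)).
assert (Hd0 : 0 < d) by (apply Rmin_glb_lt; lra).
assert (Hd1 : d <= 1 / 16) by apply Rmin_l.
assert (Hd2 : d <= eps / 200) by apply Rmin_r.
assert (exists n, (2 <= n)%nat /\ / INR n <= d / 2) as (n & Hn & Hk).
{ destruct (nfloor_ex (2 / d)) as [m Hm]; [apply Rdiv_le_0_compat; lra|].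
  exists (S (S m)). split; [lia|]. rewrite !S_INR.
  assert (0 < 2 / d) by (apply Rdiv_lt_0_compat; lra).
  replace (d / 2) with (/ (2 / d)) by (field; lra). apply Rinv_le_contravar; lra. }
destruct (inv_INR_bounds n Hn) as [Hk0 HN].
set (M := pole_bound n).
assert (HM : 0 < M).
{ unfold M, pole_bound. assert (0 < 2 ^ n) by (apply pow_lt; lra).
  assert (0 < INR n * 2 ^ n) by (apply Rmult_lt_0_compat; lra).
  apply Rdiv_lt_0_compat; [lra|apply pow_lt; lra]. }
set (z := Rmin th (eps / (4 * M))).
assert (Hz0 : 0 < z) by (apply Rmin_glb_lt; [assumption|apply Rdiv_lt_0_compat; lra]).
assert (Hz1 : z <= th) by apply Rmin_l.
assert (Hz2 : z <= eps / (4 * M)) by apply Rmin_r.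
assert (Hcz : cos th <= cos z < 1).
{ split; [apply cos_decr_1; lra|]. rewrite <- cos_0. apply cos_decreasing_1; lra. }
(* The first bound serves [vel_main]; the second gives [2 * eta <= sh] up to [PI - z]; the third is
   the condition of [vel_zone2]. *)
set (eta := Rmin (d * s1 ^ 2 / (16 * INR n)) (Rmin (1 - cos z) (/ INR n ^ 2))).
assert (Hs1 : 0 < s1 <= 1 / 2) by (unfold s1; lra).
assert (He0 : 0 < eta).
{ repeat apply Rmin_glb_lt; try lra.
  - apply Rdiv_lt_0_compat; [|lra]. apply Rmult_lt_0_compat; [lra|apply pow_lt; lra].
  - apply Rinv_0_lt_compat, pow_lt; lra. }
assert (He1 : eta <= d * s1 ^ 2 / (16 * INR n)) by apply Rmin_l.
assert (He2 : eta <= 1 - cos z) by (eapply Rle_trans; [apply Rmin_r|apply Rmin_l]).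
assert (He3 : eta <= / INR n ^ 2) by (eapply Rle_trans; [apply Rmin_r|apply Rmin_r]).
clearbody eta. unfold s1 in *. clear s1.
assert (HeN : eta * INR n ^ 2 <= 1).
{ apply (Rmult_le_compat_r (INR n ^ 2)) in He3; [|apply pow2_ge_0].
  rewrite Rinv_l in He3; [assumption|]. apply pow_nonzero. lra. }
assert (He : 0 < eta < 1) by lra.
exists n, eta. split; [assumption|]. split; [assumption|].
assert (Cv : forall u, continuous (vel n eta) u) by (intros; now apply continuous_vel).
assert (Iv : forall a b, ex_RInt (vel n eta) a b)
  by (intros; apply (ex_RInt_continuous (vel n eta)); intros; apply Cv).
assert (Ig : forall a b, ex_RInt gal a b)
  by (intros; apply (ex_RInt_continuous gal); intros; apply continuous_gal).
rewrite <- (RInt_Chasles (vel n eta) 0 (PI - th) PI) by apply Iv.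
rewrite <- (RInt_Chasles (vel n eta) (PI - th) (PI - z) PI) by apply Iv.
assert (Ecos : forall x, cos (PI - x) = - cos x)
  by (intros; replace (PI - x) with (- x + PI) by ring; now rewrite neg_cos, cos_neg).
assert (R1 : RInt (vel n eta) 0 (PI - th) <= L_Omega / 2 + 14 * d * PI).
{ apply Rle_trans with (RInt (fun u => gal u + 14 * d) 0 (PI - th)).
  - apply RInt_le; [lra|apply Iv| |].
    + apply (ex_RInt_plus gal (fun _ => 14 * d)); [apply Ig|apply ex_RInt_const].
    + intros u Hu. apply (vel_main n eta (1 - cos th) d u); try assumption; try lra.
      assert (cos (PI - th) <= cos u) by (apply cos_decr_1; lra).
      rewrite Ecos in H. unfold sh. lra.
  - rewrite (RInt_plus gal (fun _ => 14 * d)); [|apply Ig|apply ex_RInt_const].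
    rewrite RInt_const. rewrite <- gal_int_PI.
    rewrite <- (RInt_Chasles gal 0 (PI - th) PI) by apply Ig.
    assert (0 <= RInt gal (PI - th) PI).
    { apply RInt_ge_0; [lra|apply Ig|]. intros; left; apply gal_pos. }
    unfold plus, scal; simpl. unfold mult; simpl. nra. }
assert (R2 : RInt (vel n eta) (PI - th) (PI - z) <= 448 * (PI - z - (PI - th))).
{ apply RInt_le_const; [lra|assumption|]. intros u Hu. apply vel_zone2; try assumption; try lra.
  assert (K1 : cos (PI - z) <= cos u) by (apply cos_decr_1; lra).
  assert (K2 : cos u <= cos (PI - th)) by (apply cos_decr_1; lra).
  rewrite Ecos in K1, K2. unfold sh. split; [lra|].
  assert (eta <= 1 / 2); [|lra]. lra. }
assert (R3 : RInt (vel n eta) (PI - z) PI <= M * (PI - (PI - z))).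
{ apply RInt_le_const; [lra|assumption|]. intros u Hu.
  assert (K2 : cos u <= cos (PI - z)) by (apply cos_decr_1; lra).
  rewrite Ecos in K2. apply vel_zone3; try assumption; try lra. unfold sh. lra. }
assert (R3' : M * (PI - (PI - z)) <= eps / 4).
{ replace (PI - (PI - z)) with z by ring.
  apply (Rmult_le_compat_l M) in Hz2; [|lra].
  replace (M * (eps / (4 * M))) with (eps / 4) in Hz2 by (field; lra). assumption. }
assert (14 * d * PI <= 14 * d * 4) by (apply Rmult_le_compat_l; lra).
unfold plus; simpl. lra.
Qed.

(** * Closure properties of smooth functions *)

(** [ex_derive_n] is pointwise and speaks of the last derivative. Peeling off the first derivative
    instead lets closure under products and inverses go by induction on [n]. *)
Fixpoint differentiable_n (n : nat) (f : R -> R) : Prop :=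
  match n with
  | O => True
  | S m => (forall t, ex_derive f t) /\ differentiable_n m (Derive f)
  end.

Lemma differentiable_n_weaken (n : nat) (f : R -> R) : differentiable_n (S n) f -> differentiable_n n f.
Proof.
revert f. induction n as [|n IH]; intros f [H1 H2]; [exact I|]. split; [assumption|].
now apply IH.
Qed.

Lemma differentiable_n_ex_derive_n (f : R -> R) : (forall n, differentiable_n n f) -> forall n t, ex_derive_n f n t.
Proof.
intros H [|n] t; [exact I|]. generalize (H (S n)). clear H. revert f.
induction n as [|n IH]; intros f [H1 H2]; [apply H1|].
change (ex_derive (Derive_n f (S n)) t).
replace (Derive_n f (S n)) with (Derive_n (Derive f) n); [now apply IH|].
apply functional_extensionality. intros s.
rewrite <- (Nat.add_1_r n). apply (Derive_n_comp f n 1).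
Qed.

Lemma differentiable_n_const (n : nat) (k : R) : differentiable_n n (fun _ => k).
Proof.
revert k. induction n as [|n IH]; intros k; [exact I|]. split.
- intros t. apply ex_derive_const.
- replace (Derive (fun _ => k)) with (fun _ : R => 0); [apply IH|].
  apply functional_extensionality. intros t. symmetry. apply Derive_const.
Qed.

Lemma differentiable_n_plus (n : nat) (f g : R -> R) : differentiable_n n f -> differentiable_n n g -> differentiable_n n (fun t => f t + g t).
Proof.
revert f g. induction n as [|n IH]; intros f g; [easy|]. intros [F1 F2] [G1 G2]. split.
- intros t. now apply (ex_derive_plus f g).
- replace (Derive (fun t => f t + g t)) with (fun t => Derive f t + Derive g t); [now apply IH|].
  apply functional_extensionality. intros t. symmetry. now apply Derive_plus.
Qed.

Lemma differentiable_n_mult (n : nat) (f g : R -> R) : differentiable_n n f -> differentiable_n n g -> differentiable_n n (fun t => f t * g t).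
Proof.
revert f g. induction n as [|n IH]; intros f g; [easy|]. intros F G.
assert (F' := differentiable_n_weaken n f F). assert (G' := differentiable_n_weaken n g G).
destruct F as [F1 F2]. destruct G as [G1 G2]. split.
- intros t. now apply ex_derive_mult.
- replace (Derive (fun t => f t * g t)) with (fun t => Derive f t * g t + f t * Derive g t).
  + apply differentiable_n_plus; now apply IH.
  + apply functional_extensionality. intros t. symmetry. now apply Derive_mult.
Qed.

Lemma differentiable_n_opp (n : nat) (f : R -> R) : differentiable_n n f -> differentiable_n n (fun t => - f t).
Proof.
intros H. replace (fun t => - f t) with (fun t => -1 * f t).
- apply (differentiable_n_mult n (fun _ => -1) f); [apply differentiable_n_const|assumption].
- apply functional_extensionality. intros; ring.
Qed.

Lemma differentiable_n_inv (n : nat) (f : R -> R) : (forall t, f t <> 0) -> differentiable_n n f -> differentiable_n n (fun t => / f t).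
Proof.
intros H0. induction n as [|n IH]; [easy|]. intros F.
assert (F' := IH (differentiable_n_weaken n f F)). destruct F as [F1 F2]. split.
- intros t. now apply ex_derive_inv.
- replace (Derive (fun t => / f t)) with (fun t => - (Derive f t * (/ f t * / f t))).
  + apply differentiable_n_opp. apply (differentiable_n_mult n (Derive f)); [assumption|]. now apply differentiable_n_mult.
  + apply functional_extensionality. intros t. rewrite Derive_inv by auto.
    specialize (H0 t). field. assumption.
Qed.

Lemma differentiable_n_pow (n m : nat) (f : R -> R) : differentiable_n n f -> differentiable_n n (fun t => f t ^ m).
Proof.
intros H. induction m as [|m IH]; [exact (differentiable_n_const n 1)|].
exact (differentiable_n_mult n f (fun t => f t ^ m) H IH).
Qed.

(** The free phase closes the induction: differentiation multiplies by [k] and shifts the phase by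
    [PI / 2]. *)
Lemma differentiable_n_cos (n : nat) (k p : R) : differentiable_n n (fun t => cos (k * t + p)).
Proof.
revert p. induction n as [|n IH]; intros p; [exact I|].
assert (D : forall t, is_derive (fun t => cos (k * t + p)) t (k * cos (k * t + (p + PI / 2)))).
{ intros t. auto_derive; [easy|].
  replace (k * t + (p + PI / 2)) with (k * t + p + PI / 2) by ring.
  rewrite cos_plus, cos_PI2, sin_PI2. ring. }
split; [intros t; eexists; apply D|].
replace (Derive (fun t => cos (k * t + p))) with (fun t => k * cos (k * t + (p + PI / 2))).
- apply (differentiable_n_mult n (fun _ => k)); [apply differentiable_n_const|apply IH].
- apply functional_extensionality. intros t. symmetry. apply is_derive_unique, D.
Qed.

(** * Mean speed and zero frequency of the extremal solution *)

(** For a path [f(k s) w(k s)] the part of the velocity parallel to [w] drops out of the cross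
    product; only the change of clock remains. *)
Lemma speed_scale (w w' : V3) (f f' k : R) : 0 < f -> 0 <= k -> 0 < dot w w ->
  speed (f * px w, f * py w, f * pz w)
    (k * (f' * px w + f * px w'), k * (f' * py w + f * py w'), k * (f' * pz w + f * pz w'))
  = k * speed w w'.
Proof.
intros Hf Hk Hw. unfold speed.
set (x := (f * px w, f * py w, f * pz w)).
set (x' := (k * (f' * px w + f * px w'), k * (f' * py w + f * py w'), k * (f' * pz w + f * pz w'))).
replace (dot x x) with (f ^ 2 * dot w w) by (unfold x; v3; ring).
replace (dot (cross x x') (cross x x')) with
  ((k * f ^ 2) ^ 2 * dot (cross w w') (cross w w')) by (unfold x, x'; v3; ring).
rewrite sqrt_mult_alt by apply pow2_ge_0.
rewrite sqrt_pow2 by (apply Rmult_le_pos; [assumption|apply pow2_ge_0]).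
field. lra.
Qed.

(** After full periods the primitive agrees with the linear function exactly, each period
    contributing twice the half-period integral by symmetry. In between, both are monotone, so they
    differ by at most one period. *)
Lemma periodic_primitive (v : R -> R) : (forall u, continuous v u) -> (forall u, 0 <= v u) ->
  (forall u, v (u + 2 * PI) = v u) -> (forall u, v (2 * PI - u) = v u) ->
  forall u, 0 <= u ->
  Rabs (RInt v 0 u - RInt v 0 PI / PI * u) <= 2 * RInt v 0 PI.
Proof.
intros Cv Pv Ev Rv. assert (HPI := PI_RGT_0).
set (V := fun u => RInt v 0 u : R).
assert (DV : forall u, is_derive V u (v u)) by (intros; now apply is_derive_RInt_continuous).
assert (V0 : V 0 = 0) by apply (RInt_point 0 v).
assert (MV : forall a b, a <= b -> V a <= V b)
  by (intros a b H; apply (nondecreasing_of_derive V v); auto).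
assert (EV : forall u, V (1 * u + 2 * PI) = V u + V (2 * PI)).
{ intros u. apply (eq_of_derive (fun u => V (1 * u + 2 * PI)) (fun u => V u + V (2 * PI)) v 0).
  - intros t. replace (v t) with (1 * v (1 * t + 2 * PI)) by (rewrite !Rmult_1_l; apply Ev).
    apply is_derive_affine, DV.
  - intros t. rewrite <- (Rplus_0_r (v t)).
    apply (is_derive_plus V (fun _ => V (2 * PI))); [apply DV|].
    apply (@is_derive_const R_AbsRing R_NormedModule).
  - rewrite V0. replace (1 * 0 + 2 * PI) with (2 * PI) by ring. ring. }
assert (RV : V (2 * PI) = 2 * V PI).
{ assert (K : V (-1 * PI + 2 * PI) = V (2 * PI) - V PI).
  { apply (eq_of_derive (fun u => V (-1 * u + 2 * PI)) (fun u => V (2 * PI) - V u) (fun u => - v u) 0).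
    - intros t. replace (- v t) with (-1 * v (-1 * t + 2 * PI)).
      + apply is_derive_affine, DV.
      + replace (-1 * t + 2 * PI) with (2 * PI - t) by ring. rewrite Rv. ring.
    - intros t. rewrite <- (Rplus_0_l (- v t)).
      apply (is_derive_minus (fun _ => V (2 * PI)) V t 0); [|apply DV].
      apply (@is_derive_const R_AbsRing R_NormedModule).
    - rewrite V0. replace (-1 * 0 + 2 * PI) with (2 * PI) by ring. ring. }
  replace (-1 * PI + 2 * PI) with PI in K by ring. lra. }
assert (KV : forall m : nat, V (2 * PI * INR m) = INR m * (2 * V PI)).
{ induction m as [|m IH].
  - simpl. rewrite Rmult_0_r, V0. ring.
  - rewrite S_INR. replace (2 * PI * (INR m + 1)) with (1 * (2 * PI * INR m) + 2 * PI) by ring.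
    rewrite EV, IH, RV. ring. }
intros u Hu. change (Rabs (V u - V PI / PI * u) <= 2 * V PI).
destruct (nfloor_ex (u / (2 * PI))) as [m [Hm1 Hm2]]; [apply Rdiv_le_0_compat; lra|].
apply Rle_div_r in Hm1; [|lra]. apply Rlt_div_l in Hm2; [|lra].
assert (H1 := MV (2 * PI * INR m) u ltac:(lra)).
assert (H2 := MV u (2 * PI * INR (S m))). rewrite S_INR in H2 at 1. specialize (H2 ltac:(lra)).
rewrite KV in H1, H2. rewrite S_INR in H2.
assert (P0 : 0 <= V PI) by (rewrite <- V0; apply MV; lra).
assert (A1 : INR m * 2 * V PI <= V PI / PI * u).
{ replace (INR m * 2 * V PI) with (V PI / PI * (INR m * (2 * PI))) by (field; lra).
  apply Rmult_le_compat_l; [apply Rdiv_le_0_compat|]; lra. }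
assert (A2 : V PI / PI * u <= (INR m + 1) * 2 * V PI).
{ replace ((INR m + 1) * 2 * V PI) with (V PI / PI * ((INR m + 1) * (2 * PI))) by (field; lra).
  apply Rmult_le_compat_l; [apply Rdiv_le_0_compat|]; lra. }
apply Rabs_le. lra.
Qed.

Lemma cos_eq_cos (a b : R) : cos a = cos b ->
  exists z : Z, a = b + 2 * PI * IZR z \/ a = - b + 2 * PI * IZR z.
Proof.
intros H. assert (K : -2 * sin ((a - b) / 2) * sin ((a + b) / 2) = 0) by (rewrite <- form2; lra).
assert (K' : sin ((a - b) / 2) = 0 \/ sin ((a + b) / 2) = 0).
{ apply Rmult_integral in K. destruct K as [K|K]; [left; lra|now right]. }
destruct K' as [K'|K']; apply sin_eq_0_0 in K'; destruct K' as [z Hz]; exists z; lra.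
Qed.

(** The zeros form two progressions [p] and [q] of step [2 * PI / k]. The [m] complete periods
    contain exactly [2 * m] of them and the unfinished one at most two, whence the error [2]. *)
Lemma zero_counting (y : R -> R) (k th : R) : 0 < k -> PI / 2 < th < PI ->
  (forall t, y t = 0 <-> cos (k * t) = cos th) ->
  forall t, 0 <= t -> exists N, nu_count y t = Finite N /\ Rabs (N - k * t / PI) <= 2.
Proof.
intros Hk Hth Hy t Ht. assert (HPI := PI_RGT_0).
set (p := fun j : nat => (th + 2 * PI * INR j) / k).
set (q := fun j : nat => (2 * PI * (INR j + 1) - th) / k).
assert (Hkt : 0 <= k * t) by (apply Rmult_le_pos; lra).
destruct (nfloor_ex (k * t / (2 * PI))) as [m [Hm1 Hm2]]; [apply Rdiv_le_0_compat; lra|].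
apply Rle_div_r in Hm1; [|lra]. apply Rlt_div_l in Hm2; [|lra].
assert (kp : forall j, k * p j = th + 2 * PI * INR j) by (intros; unfold p; field; lra).
assert (kq : forall j, k * q j = 2 * PI * (INR j + 1) - th) by (intros; unfold q; field; lra).
assert (Zp : forall j, y (p j) = 0).
{ intros j. apply Hy. rewrite kp. replace (2 * PI * INR j) with (2 * INR j * PI) by ring. apply cos_period. }
assert (Zq : forall j, y (q j) = 0).
{ intros j. apply Hy. rewrite kq. rewrite <- (cos_neg th).
  replace (2 * PI * (INR j + 1) - th) with (- th + 2 * INR (S j) * PI) by (rewrite S_INR; ring).
  apply cos_period. }
(* The cover takes [S m] terms of each progression because of the unfinished period; the lower bound
   on [N] below uses only [m]. *)
assert (Cov : forall s, 0 <= s <= t -> y s = 0 -> In s (map p (seq 0 (S m)) ++ map q (seq 0 (S m)))).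
{ intros s Hs Es. apply Hy in Es. apply cos_eq_cos in Es. destruct Es as [z Hz].
  assert (Hks : 0 <= k * s <= k * t) by (split; [apply Rmult_le_pos|apply Rmult_le_compat_l]; lra).
  apply in_or_app. destruct Hz as [Hz|Hz].
  - left. assert (Z0 : (0 <= z)%Z).
    { apply Z.nlt_ge. intros Hn. assert (z <= -1)%Z by lia. apply IZR_le in H. nra. }
    apply in_map_iff. exists (Z.to_nat z). split.
    + unfold p. rewrite INR_IZR_INZ, Z2Nat.id by assumption. rewrite <- Hz. field. lra.
    + apply in_seq. split; [lia|]. apply INR_lt. rewrite INR_IZR_INZ, Z2Nat.id by assumption.
      rewrite Nat.add_0_l, S_INR. nra.
  - right. assert (Z0 : (1 <= z)%Z).
    { apply Z.nlt_ge. intros Hn. assert (z <= 0)%Z by lia. apply IZR_le in H. nra. }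
    apply in_map_iff. exists (Z.to_nat (z - 1)). split.
    + unfold q. rewrite INR_IZR_INZ, Z2Nat.id by lia. rewrite minus_IZR.
      replace (2 * PI * (IZR z - 1 + 1) - th) with (k * s) by (rewrite Hz; ring). field. lra.
    + apply in_seq. split; [lia|]. apply INR_lt. rewrite INR_IZR_INZ, Z2Nat.id by lia.
      rewrite Nat.add_0_l, S_INR, minus_IZR. nra. }
assert (Len : forall j, length (map p (seq 0 j) ++ map q (seq 0 j)) = (j + j)%nat)
  by (intros; now rewrite length_app, !length_map, length_seq).
destruct (nu_count_finite y t (INR (S m + S m))) as (N & EN & HN1 & HN2).
{ intros l Nl Hl. apply le_INR. rewrite <- Len. apply NoDup_incl_length; [assumption|].
  intros s Hs. apply Cov; now apply Hl. }
exists N. split; [assumption|].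
assert (HN3 : INR (m + m) <= N).
{ rewrite <- (Len m). apply HN2.
  - apply NoDup_app.
    + apply FinFun.Injective_map_NoDup; [|apply seq_NoDup].
      intros i j E. apply INR_eq. assert (K := kp i). rewrite E, kp in K.
      apply (Rmult_eq_reg_l (2 * PI)); lra.
    + apply FinFun.Injective_map_NoDup; [|apply seq_NoDup].
      intros i j E. apply INR_eq. assert (K := kq i). rewrite E, kq in K.
      apply (Rmult_eq_reg_l (2 * PI)); lra.
    (* A common term would make [th] an integer multiple of [PI]. *)
    + intros s Hp Hq. apply in_map_iff in Hp. apply in_map_iff in Hq.
      destruct Hp as (i & Hi & _). destruct Hq as (j & Hj & _).
      assert (K := kp i). rewrite Hi, <- Hj, kq in K.
      assert (K2 : th = PI * (INR j + 1 - INR i)) by lra.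
      rewrite !INR_IZR_INZ, <- plus_IZR, <- minus_IZR in K2.
      set (z := (Z.of_nat j + 1 - Z.of_nat i)%Z) in *.
      destruct (Z_le_gt_dec z 0) as [Hz|Hz].
      * apply IZR_le in Hz. nra.
      * assert (Hz' : (1 <= z)%Z) by lia. apply IZR_le in Hz'. nra.
  - intros s Hs. apply in_app_or in Hs.
    destruct Hs as [Hs|Hs]; apply in_map_iff in Hs; destruct Hs as (j & <- & Hj);
      apply in_seq in Hj; destruct Hj as [_ Hj]; simpl in Hj;
      assert (Hj' : INR j + 1 <= INR m) by (rewrite <- S_INR; apply le_INR; lia);
      assert (Hj0 := pos_INR j).
    + split; [|apply Zp]. split; apply (Rmult_le_reg_l k); try assumption; rewrite ?kp; nra.
    + split; [|apply Zq]. split; apply (Rmult_le_reg_l k); try assumption; rewrite ?kq; nra. }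
rewrite !plus_INR, S_INR in *.
assert (A1 : INR m + INR m <= k * t / PI) by (apply Rle_div_r; lra).
assert (A2 : k * t / PI <= INR m + INR m + 2) by (apply Rle_div_l; lra).
apply Rabs_le. lra.
Qed.

Lemma is_derive_scaled_prod (f w : R -> R) (k t f' w' : R) :
  is_derive f (k * t) f' -> is_derive w (k * t) w' ->
  is_derive (fun s => f (k * s) * w (k * s)) t (k * (f' * w (k * t) + f (k * t) * w')).
Proof.
intros Df Dw.
apply (is_derive_ext (fun s => (fun u => f u * w u) (k * s + 0))).
- intros s. now rewrite Rplus_0_r.
- apply (is_derive_affine (fun u => f u * w u)). rewrite Rplus_0_r.
  auto_derive; [split; [|split; [|easy]]; eexists; eassumption|]. der_rw. ring.
Qed.

Lemma pow_inj (x z : R) (n : nat) : (1 <= n)%nat -> 0 < x -> 0 < z -> x ^ n = z ^ n -> x = z.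
Proof.
intros Hn. destruct n as [|n]; [lia|]. clear Hn.
assert (K : forall x z, 0 < x -> x < z -> x ^ S n < z ^ S n).
{ clear. intros x z Hx Hz. simpl.
  assert (0 < x ^ n) by (apply pow_lt; lra).
  assert (x ^ n <= z ^ n) by (apply pow_incr; lra). nra. }
intros Hx Hz E. destruct (Rtotal_order x z) as [H|[H|H]]; [|assumption|].
- apply (K x z Hx) in H. lra.
- apply (K z x Hz) in H. lra.
Qed.

Theorem wandering_speed_near_bound (eps : R) : 0 < eps ->
     exists (a b c y : R -> R),
       smooth_Rplus a /\ smooth_Rplus b /\ smooth_Rplus c /\ smooth_Rplus y /\
       (forall t, 0 <= t ->
          Derive_n y 3 t + a t * Derive_n y 2 t + b t * Derive y t + c t * y t = 0) /\
       (exists t, 0 <= t /\ y t <> 0) /\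
       exists nu mu : R,
         nu_lower y = Finite nu /\ nu_upper y = Finite nu /\
         mu3_lower y (Derive y) (Derive_n y 2) = Finite mu /\
         mu3_upper y (Derive y) (Derive_n y 2) = Finite mu /\
         mu < (L_Omega / (2 * PI) + eps) * nu.
Proof.
intros Heps. assert (HPI := PI_RGT_0). assert (HPI2 := PI2_3_2).
destruct (half_length_bound eps Heps) as (n & eta & Hn & He & HV).
destruct (inv_INR_bounds n Hn) as [Hk HN].
set (k := / INR n) in *.
set (y := fun t => sh eta (k * t) ^ n - (2 * eta) ^ n).
set (f := fun u => sh eta u ^ (n - 1)).
set (f' := fun u => INR (n - 1) * - sin u * sh eta u ^ (n - 2)).
assert (En : n = S (S (n - 2))) by lia.
assert (En1 : (n - 1 = S (n - 2))%nat) by lia.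
assert (Hsh : forall u, 0 < sh eta u) by (intros u; generalize (sh_bounds eta u); lra).
assert (HNk : INR n * k = 1) by (unfold k; apply Rinv_r; lra).
assert (Df : forall u, is_derive f u (f' u)).
{ intros u. assert (D := is_derive_sh eta u). unfold f, f'. auto_derive.
  - eexists; exact D.
  - der_rw. rewrite En1. simpl pred. ring. }
assert (Hf : forall u, 0 < f u) by (intros; apply pow_lt, Hsh).
assert (EN1 : INR (n - 1) = INR n - 1) by (rewrite minus_INR by lia; reflexivity).
assert (Ey : forall t, y t = f (k * t) * W0 n eta (k * t)).
{ intros t. unfold y, f, W0, rho. set (s := sh eta (k * t)). assert (Hs : 0 < s) by apply Hsh.
  unfold Rdiv. rewrite (Rpow_mult_distr (2 * eta)), pow_inv.
  assert (E : s ^ n = s ^ (n - 1) * s) by (rewrite En at 1; rewrite En1; simpl; ring).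
  rewrite E. field. split; [lra|apply pow_nonzero; lra]. }
assert (D0 : forall t, is_derive y t (f (k * t) * - sin (k * t))).
{ intros t. assert (D := is_derive_sh eta (k * t)). unfold y.
  evar_last.
  - apply (is_derive_ext (fun s => (fun u => sh eta u ^ n - (2 * eta) ^ n) (k * s + 0))).
    { intros s. now rewrite Rplus_0_r. }
    apply (is_derive_affine (fun u => sh eta u ^ n - (2 * eta) ^ n)). rewrite Rplus_0_r.
    auto_derive; [eexists; exact D|reflexivity].
  - der_rw. unfold f. replace (pred n) with (n - 1)%nat by lia.
    transitivity (INR n * k * (sh eta (k * t) ^ (n - 1) * - sin (k * t))); [ring|].
    rewrite HNk. ring. }
assert (D1 : forall t, is_derive (fun t => f (k * t) * - sin (k * t)) t
   (f (k * t) * W2 n eta (k * t))).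
{ intros t. evar_last.
  - apply (is_derive_scaled_prod f (fun u => - sin u)); [apply Df|apply is_derive_opp_sin].
  - unfold f', f, W2. set (u := k * t). fold k. rewrite EN1, En1. simpl pow.
    assert (HS := sin2_cos2 u). unfold Rsqr in HS.
    assert (HS' : sin u * sin u = (1 - cos u) * (1 + cos u)) by lra.
    assert (Hc : 1 + cos u = sh eta u - eta) by (unfold sh; ring).
    assert (Hu := Hsh u). set (s := sh eta u) in *. set (P := s ^ (n - 2)).
    transitivity (P * ((INR n * k - k) * (sin u * sin u) - k * (s * cos u))); [ring|].
    rewrite HNk, HS', Hc. field. lra. }
assert (E1 : Derive y = fun t => f (k * t) * - sin (k * t))
  by (apply functional_extensionality; intros t; apply is_derive_unique, D0).
assert (E2 : Derive_n y 2 = fun t => f (k * t) * W2 n eta (k * t)).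
{ apply functional_extensionality. intros t. change (Derive (Derive y) t = f (k * t) * W2 n eta (k * t)).
  rewrite E1. apply is_derive_unique, D1. }
assert (Sy : forall m, differentiable_n m y).
{ intros m. unfold y, sh, Rminus.
  apply (differentiable_n_plus m (fun t => (1 + eta + cos (k * t)) ^ n)); [|apply differentiable_n_const].
  apply differentiable_n_pow. apply (differentiable_n_plus m (fun _ => 1 + eta)); [apply differentiable_n_const|].
  replace (fun t => cos (k * t)) with (fun t => cos (k * t + 0)); [apply differentiable_n_cos|].
  apply functional_extensionality; intros t. now rewrite Rplus_0_r. }
assert (S1 : forall m, differentiable_n m (Derive y)) by (intros m; apply (Sy (S m))).
assert (S2 : forall m, differentiable_n m (Derive_n y 2)) by (intros m; apply (Sy (S (S m)))).
assert (S3 : forall m, differentiable_n m (Derive_n y 3)) by (intros m; apply (Sy (S (S (S m))))).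
set (X := fun t => (y t, Derive y t, Derive_n y 2 t)).
assert (EX : forall t, X t = (f (k * t) * px (profile n eta (k * t)), f (k * t) * py (profile n eta (k * t)),
  f (k * t) * pz (profile n eta (k * t)))).
{ intros t. unfold X. rewrite E1, E2, Ey. reflexivity. }
assert (HW : forall u, 0 < dot (profile n eta u) (profile n eta u)) by (intros; now apply profile_pos).
assert (HX : forall t, 0 < dot (X t) (X t)).
{ intros t. rewrite EX. set (w := profile n eta (k * t)). 
  replace (dot _ _) with (f (k * t) ^ 2 * dot w w) by (unfold dot, px, py, pz; simpl; ring).
  apply Rmult_lt_0_compat; [apply pow_lt, Hf|apply HW]. }
set (q := fun t => Derive_n y 2 t * Derive_n y 2 t + Derive y t * Derive y t + y t * y t).
assert (Hq : forall t, q t <> 0).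
{ intros t. specialize (HX t). unfold X, dot, px, py, pz in HX; cbn [fst snd] in HX. unfold q. lra. }
assert (Sq : forall m, differentiable_n m (fun t => / q t)).
{ intros m. apply differentiable_n_inv; [assumption|].
  apply (differentiable_n_plus m (fun t => Derive_n y 2 t * Derive_n y 2 t + Derive y t * Derive y t)).
  - apply differentiable_n_plus; now apply differentiable_n_mult.
  - now apply differentiable_n_mult. }
(* Any smooth [y] with nonvanishing [x] solves such an equation: the coefficient vector
   [- y''' x / |x|^2] has scalar product [- y'''] with [x]. *)
set (co := fun (g : R -> R) t => - (Derive_n y 3 t * g t) * / q t).
assert (Sco : forall g, (forall m, differentiable_n m g) -> smooth_Rplus (co g)).
{ intros g Sg m t _. apply differentiable_n_ex_derive_n. intros j. unfold co.
  apply (differentiable_n_mult j (fun t => - (Derive_n y 3 t * g t))); [|apply Sq].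
  apply differentiable_n_opp. now apply (differentiable_n_mult j (Derive_n y 3)). }
exists (co (Derive_n y 2)), (co (Derive y)), (co y), y.
split; [now apply Sco|]. split; [now apply Sco|]. split; [now apply Sco|].
split; [intros m t _; now apply differentiable_n_ex_derive_n|].
split.
{ intros t _. unfold co. specialize (Hq t). unfold q in *. field. lra. }
(* [y] vanishes exactly where [sh = 2 * eta], that is [cos (k * t) = eta - 1]; [acos] puts this in
   the form of [zero_counting]. *)
assert (Hz : forall t, y t = 0 <-> cos (k * t) = cos (acos (eta - 1))).
{ intros t. rewrite cos_acos by lra. unfold y. split; intros H.
  - assert (E : sh eta (k * t) = 2 * eta).
    { apply (pow_inj _ _ n); [lia|apply Hsh|lra|lra]. }
    unfold sh in E. lra.
  - unfold sh. rewrite H. replace (1 + eta + (eta - 1)) with (2 * eta) by ring. ring. }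
split.
{ exists 0. split; [lra|]. rewrite Hz, cos_acos, Rmult_0_r, cos_0 by lra. lra. }
assert (Hth : PI / 2 < acos (eta - 1) < PI).
{ split; [|apply acos_bound_lt; lra].
  assert (B := acos_bound (eta - 1)). apply Rnot_le_lt. intros Hle.
  assert (0 <= cos (acos (eta - 1))) by (apply cos_ge_0; lra).
  rewrite cos_acos in H by lra. lra. }
assert (HNu := zero_counting y k (acos (eta - 1)) (proj1 Hk) Hth Hz).
assert (Cv : forall u, continuous (vel n eta) u) by (intros; now apply continuous_vel).
set (V := RInt (vel n eta) 0 PI) in *.
(* Changing the sign of [sin u] reflects the profile in its second coordinate and reverses the
   reflected velocity, so the speed stays the same. This covers both the period and the symmetry
   about [PI]. *)
assert (Hsym : forall u v, cos v = cos u -> (sin v = sin u \/ sin v = - sin u) ->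
  vel n eta v = vel n eta u).
{ intros u v Ec [Es|Es].
  - unfold vel, profile, profile', W0, W0', W2, W2', rho, sh. now rewrite Ec, Es.
  - assert (K1 : W0 n eta v = W0 n eta u) by (unfold W0, rho, sh; now rewrite Ec).
    assert (K2 : W2 n eta v = W2 n eta u) by (unfold W2, sh; now rewrite Ec).
    assert (K3 : W0' n eta v = - W0' n eta u) by (unfold W0', rho, sh; rewrite Ec, Es; ring).
    assert (K4 : W2' n eta v = - W2' n eta u) by (unfold W2', sh; rewrite Ec, Es; ring).
    unfold vel, profile, profile', speed. rewrite K1, K2, K3, K4, Ec, Es.
    unfold dot, cross, px, py, pz; simpl. f_equal; [f_equal|]; ring. }
assert (HP := periodic_primitive (vel n eta) Cv).
fold V in HP.
assert (HP' : forall u, 0 <= u -> Rabs (RInt (vel n eta) 0 u - V / PI * u) <= 2 * V).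
{ apply HP.
  - intros u. apply speed_ge0.
  - intros u. apply Hsym; [|left].
    + replace (u + 2 * PI) with (u + 2 * INR 1 * PI) by (simpl; ring). apply cos_period.
    + replace (u + 2 * PI) with (u + 2 * INR 1 * PI) by (simpl; ring). apply sin_period.
  - intros u. replace (2 * PI - u) with (- u + 2 * INR 1 * PI) by (simpl; ring).
    apply Hsym; [|right].
    + rewrite cos_period. apply cos_neg.
    + rewrite sin_period. apply sin_neg. }
assert (Hg : forall t, 0 <= t -> gamma3 y (Derive y) (Derive_n y 2) t = RInt (vel n eta) 0 (k * t)).
{ intros t Ht.
  assert (DD : forall s, is_derive y s (Derive y s) /\ is_derive (Derive y) s (Derive_n y 2 s) /\
    is_derive (Derive_n y 2) s (Derive_n y 3 s)).
  { intros s. refine (conj _ (conj _ _)); apply Derive_correct.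
    - apply (Sy 1%nat). - apply (S1 1%nat). - apply (S2 1%nat). }
  rewrite (gamma3_eq y (Derive y) (Derive_n y 2) (Derive_n y 3) t Ht); [|intros; apply DD|intros; apply HX].
  replace (RInt (vel n eta) 0 (k * t)) with (RInt (vel n eta) (k * 0 + 0) (k * t + 0))
    by (f_equal; ring).
  rewrite <- (RInt_comp_lin (vel n eta) k 0 0 t)
    by (apply (ex_RInt_continuous (vel n eta)); intros; apply Cv).
  apply RInt_ext. intros s _. rewrite Rplus_0_r. change (speed (X s) (Derive y s, Derive_n y 2 s, Derive_n y 3 s) = k * vel n eta (k * s)).
  rewrite EX. unfold vel. rewrite <- (speed_scale _ _ (f (k * s)) (f' (k * s)) k (Hf _)); [|lra|apply HW].
  f_equal.
  assert (L0 : Derive y s = k * (f' (k * s) * px (profile n eta (k * s)) + f (k * s) * px (profile' n eta (k * s)))).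
  { apply is_derive_unique. apply (is_derive_ext (fun s => f (k * s) * W0 n eta (k * s))).
    - intros; symmetry; apply Ey.
    - apply (is_derive_scaled_prod f (W0 n eta)); [apply Df|apply is_derive_W0; [lia|lra]]. }
  assert (L1 : Derive_n y 2 s = k * (f' (k * s) * py (profile n eta (k * s)) + f (k * s) * py (profile' n eta (k * s)))).
  { change (Derive (Derive y) s = k * (f' (k * s) * - sin (k * s) + f (k * s) * - cos (k * s))).
    rewrite E1. apply is_derive_unique.
    apply (is_derive_scaled_prod f (fun u => - sin u)); [apply Df|apply is_derive_opp_sin]. }
  assert (L2 : Derive_n y 3 s = k * (f' (k * s) * pz (profile n eta (k * s)) + f (k * s) * pz (profile' n eta (k * s)))).
  { change (Derive (Derive_n y 2) s = k * (f' (k * s) * W2 n eta (k * s) + f (k * s) * W2' n eta (k * s))).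
    rewrite E2. apply is_derive_unique.
    apply (is_derive_scaled_prod f (W2 n eta)); [apply Df|apply is_derive_W2; lra]. }
  now rewrite L0, L1, L2. }
(* Two zeros per period [2 * PI / k] give the frequency [k], and a path length [2 * V] per period
   gives the speed. *)
exists k, (k * V / PI).
assert (LN : nu_lower y = Finite k /\ nu_upper y = Finite k).
{ apply (Lim_infty_of_bounded _ (fun t => PI / t * real (nu_count y t)) k (2 * PI)).
  intros t Ht. destruct (HNu t) as (N & EN & HB); [lra|]. rewrite EN. simpl.
  split; [reflexivity|].
  replace (PI / t * N - k) with (PI / t * (N - k * t / PI)) by (field; lra).
  rewrite Rabs_mult, (Rabs_pos_eq (PI / t)) by (apply Rdiv_le_0_compat; lra).
  replace (2 * PI / t) with (PI / t * 2) by (field; lra).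
  apply Rmult_le_compat_l; [apply Rdiv_le_0_compat|]; lra. }
assert (LM : mu3_lower y (Derive y) (Derive_n y 2) = Finite (k * V / PI) /\
  mu3_upper y (Derive y) (Derive_n y 2) = Finite (k * V / PI)).
{ apply (Lim_infty_of_bounded _ (fun t => gamma3 y (Derive y) (Derive_n y 2) t / t) _ (2 * V)).
  intros t Ht. split; [reflexivity|]. rewrite Hg by lra.
  assert (Hkt : 0 <= k * t) by (apply Rmult_le_pos; lra).
  replace (RInt (vel n eta) 0 (k * t) / t - k * V / PI) with
    ((RInt (vel n eta) 0 (k * t) - V / PI * (k * t)) / t) by (field; lra).
  unfold Rdiv at 1. rewrite Rabs_mult, (Rabs_pos_eq (/ t)) by (left; now apply Rinv_0_lt_compat).
  apply Rmult_le_compat_r; [left; now apply Rinv_0_lt_compat|]. now apply HP'. }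
destruct LN as [L1 L2]. destruct LM as [L3 L4].
repeat split; try assumption.
(* The inequality is strict because [V <= L_Omega / 2 + eps] and [PI > 1]. *)
replace ((L_Omega / (2 * PI) + eps) * k) with (k * ((L_Omega / 2 + eps * PI) / PI)) by (field; lra).
replace (k * V / PI) with (k * (V / PI)) by (field; lra).
apply Rmult_lt_compat_l; [lra|]. apply Rmult_lt_compat_r; [apply Rinv_0_lt_compat; lra|]. nra.
Qed.

Theorem theorem2 :
  (* (a) *)
  (forall (a b c y y1 y2 y3 : R -> R),
     cont_Rplus a -> cont_Rplus b -> cont_Rplus c ->
     deriv_Rplus y y1 -> deriv_Rplus y1 y2 -> deriv_Rplus y2 y3 ->
     (forall t, 0 <= t -> y3 t + a t * y2 t + b t * y1 t + c t * y t = 0) ->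
     (exists t, 0 <= t /\ y t <> 0) ->
     Rbar_le (Rbar_mult (Finite (L_Omega / (2 * PI))) (nu_upper y)) (mu3_upper y y1 y2) /\
     Rbar_le (Rbar_mult (Finite (L_Omega / (2 * PI))) (nu_lower y)) (mu3_lower y y1 y2))
  /\
  (* (b) *)
  (forall eps : R, 0 < eps ->
     exists (a b c y : R -> R),
       smooth_Rplus a /\ smooth_Rplus b /\ smooth_Rplus c /\ smooth_Rplus y /\
       (forall t, 0 <= t ->
          Derive_n y 3 t + a t * Derive_n y 2 t + b t * Derive y t + c t * y t = 0) /\
       (exists t, 0 <= t /\ y t <> 0) /\
       exists nu mu : R,
         nu_lower y = Finite nu /\ nu_upper y = Finite nu /\
         mu3_lower y (Derive y) (Derive_n y 2) = Finite mu /\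
         mu3_upper y (Derive y) (Derive_n y 2) = Finite mu /\
         mu < (L_Omega / (2 * PI) + eps) * nu).
Proof.
split.
- exact zero_frequency_le_wandering_speed.
- exact wandering_speed_near_bound.
Qed.
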